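(* (a) Let $\Pi_1$ and $\Pi_2$ be bottom (respectively, reduced bottom) lattice polytopal complexes of the same dimension $d$ that can be conically glued, i.e., they admit conic realizations (respectively, reduced conic realizations) $C_1,C_2\subset\mathbb{R}^{d+1}$ together with a lattice isomorphism $\theta:F_1\to F_2$ between some facets $F_1\subset C_1$ and $F_2\subset C_2$. Then the conic gluing $\Pi_1\vee_\theta\Pi_2$ is bottom (respectively, reduced bottom). (b) Every stacked lattice polytopal complex is bottom; it is reduced bottom if and only if the facets of the complex are normal polytopes with respect to their lattices of reference.
   Context: Polytopes are convex. An affine lattice in an affine space $x+U$ ($U$ a real vector space) is a subset $x+\Lambda_0$ with $\Lambda_0\subset U$ a lattice. For an affine lattice $\Lambda$, a $\Lambda$-polytope is a polytope with all vertices in $\Lambda$. A $\mathbb{Z}^d$-polytope $P$ is normal if for all $c\in\mathbb{N}$ and $z\in cP\cap\mathbb{Z}^d$ there are $y_1,\dots,y_c\in P\cap\mathbb{Z}^d$ with $y_1+\cdots+y_c=z$; a $\Lambda$-polytope is normal with respect to $\Lambda$ if it is normal after making some (equivalently, any) point of $\Lambda$ the origin. A polytopal complex is a finite family $\Pi$ of sets $p$, each with a polytope $P_p$ and a bijection $\pi_p:P_p\to p$, such that $\pi_p(F)\in\Pi$ for every face $F\subset P_p$, and for all $p,q\in\Pi$ there are faces $F\subset P_p$, $G\subset P_q$ with $p\cap q=\pi_p(F)=\pi_q(G)$ and $\pi_q^{-1}\circ\pi_p:F\to G$ an affine isomorphism. One identifies $p$ with $P_p$. Elements of $\Pi$ are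 its faces, maximal ones its facets; $|\Pi|=\bigcup_{P\in\Pi}P$. A lattice polytopal complex is a polytopal complex $\Pi$ with affine lattices $\Lambda_P\subset\mathrm{Aff}(P)$, $P\in\Pi$ (the lattices of reference), such that each $P$ is a $\Lambda_P$-polytope and $\Lambda_P\cap\mathrm{Aff}(P\cap Q)=\Lambda_Q\cap\mathrm{Aff}(P\cap Q)$ for all $P,Q\in\Pi$. Two lattice polytopal complexes $\Pi,\Pi'$ are isomorphic if there is a bijection $|\Pi|\to|\Pi'|$ restricting, for every $P\in\Pi$, to an affine isomorphism onto some $P'\in\Pi'$ that maps $P\cap\Lambda_P$ bijectively to $P'\cap\Lambda_{P'}$ and whose affine extension maps $\Lambda_P$ isomorphically to $\Lambda_{P'}$. A cone $C\subset\mathbb{R}^d$ is a set $\sum_{i=1}^n\mathbb{R}_+x_i$ with $x_i\in\mathbb{Z}^d$, containing no positive-dimensional linear subspace. Cones (in particular, faces of cones) $C\subset\mathbb{R}^d$ and $C'\subset\mathbb{R}^{d'}$ are lattice isomorphic if the monoids $C\cap\mathbb{Z}^d$ and $C'\cap\mathbb{Z}^{d'}$ are isomorphic; a lattice isomorphism is the linear isomorphism of cones induced by such a monoid isomorphism. $\mathrm{Hilb}(C)$ is the set of indecomposable elements of the monoid $C\cap\mathbb{Z}^d$. The bottom $\mathrm{B}(C)$ is the union of the compact facets of $\mathrm{conv}((C\cap\mathbb{Z}^d)\setminus\{0\})$, and the bottom complex $\mathbb{B}(C)$ is the lattice polytopal complex whose facets are the maximal polytopes in $\mathrm{B}(C)$,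 with affine lattices induced from $\mathbb{Z}^d$. A lattice polytopal complex $\Pi$ is bottom if $\Pi\cong\mathbb{B}(C)$ for some cone $C$, called a conic realization of $\Pi$. It is reduced bottom if there is such a $C$ with $\mathrm{Hilb}(\mathbb{R}_+F)\subset F$ for every facet $F\in\mathbb{B}(C)$; such a $C$ is a reduced conic realization. Conic gluing: for $C_1,C_2,\theta$ as in (a), the bottom complexes $\mathbb{B}(F_i)$ are subcomplexes of $\mathbb{B}(C_i)\cong\Pi_i$, and $\theta$ identifies $\mathbb{B}(F_1)$ with $\mathbb{B}(F_2)$. The complex $\Pi_1\vee_\theta\Pi_2$ is obtained from $\Pi_1$ and $\Pi_2$ by identifying the faces corresponding to $\mathbb{B}(F_1)$ with those corresponding to $\mathbb{B}(F_2)$ along $\theta$. A lattice polytopal complex is stacked if its facets can be enumerated as $P_1,\dots,P_n$ so that $P_i\cap(P_1\cup\cdots\cup P_{i-1})$ is a facet of $P_i$ for every $i=2,\dots,n$.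
   Formalization: In (a) d≥1 is assumed (for d=0 the gluing is two disjoint points, not bottom). In (b) the stacked complex is also assumed to have facets of equal dimension and no facet of a facet lying in three facets; else e.g. three segments sharing an endpoint would be stacked but not bottom. *)

(* Defs.v *)
From mathcomp Require Import all_boot all_order all_algebra.
From mathcomp Require Import all_classical all_reals all_analysis.
Import Order.TTheory GRing.Theory Num.Theory.
Import numFieldNormedType.Exports.
Local Open Scope classical_set_scope.
Local Open Scope ring_scope.

(** * Affine and convex geometry in R^n *)

Section Geometry.
Context {R : realType}.

Definition aff_hull {n} (A : set 'rV[R]_n) : set 'rV[R]_n :=
  [set x | exists k (y : 'I_k -> 'rV[R]_n) (c : 'I_k -> R),
    [/\ forall i, A (y i), \sum_i c i = 1 & x = \sum_i c i *: y i]].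

Definition conv_hull {n} (A : set 'rV[R]_n) : set 'rV[R]_n :=
  [set x | exists k (y : 'I_k -> 'rV[R]_n) (c : 'I_k -> R),
    [/\ forall i, A (y i), forall i, 0 <= c i, \sum_i c i = 1
      & x = \sum_i c i *: y i]].

(* The empty set has no dimension. *)
Definition has_dim {n} (A : set 'rV[R]_n) (k : nat) : Prop :=
  exists (x0 : 'rV[R]_n) (U : {vspace 'rV[R]_n}),
    \dim U = k /\ aff_hull A = [set x0 + u | u in [set u | u \in U]].

(* Also the empty set (f = 0, m = -1) and A itself (f = 0, m = 0) are faces. *)
Definition face {n} (A F : set 'rV[R]_n) : Prop :=
  exists (f : {scalar 'rV[R]_n}) (m : R),
    (forall x, A x -> m <= f x) /\ F = A `&` [set x | f x = m].

(* Facets are nonempty, so that a point has no facets. *)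
Definition facet {n} (A F : set 'rV[R]_n) : Prop :=
  face A F /\ exists k, has_dim F k /\ has_dim A k.+1.

Definition polytope {n} (P : set 'rV[R]_n) : Prop :=
  exists s : seq 'rV[R]_n, P = conv_hull [set x | x \in s].

Definition affine_map {n m} (g : 'rV[R]_n -> 'rV[R]_m) : Prop :=
  exists (f : {linear 'rV[R]_n -> 'rV[R]_m}) (b : 'rV[R]_m),
    forall x, g x = f x + b.

Definition affine_lattice {n} (L : set 'rV[R]_n) : Prop :=
  exists (x0 : 'rV[R]_n) (k : nat) (b : k.-tuple 'rV[R]_n), free b /\
    L = [set x | exists z : 'I_k -> int, x = x0 + \sum_i tnth b i *~ z i].

Definition lattice_polytope {n} (L P : set 'rV[R]_n) : Prop :=
  polytope P /\ forall v, face P [set v] -> L v.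

(* Normality with respect to a lattice containing the origin. *)
Definition normal0 {n} (L P : set 'rV[R]_n) : Prop :=
  forall (c : nat) (z : 'rV[R]_n), L z -> (exists2 x, P x & z = c%:R *: x) ->
    exists y : 'I_c -> 'rV[R]_n,
      (forall i, P (y i) /\ L (y i)) /\ z = \sum_i y i.

Definition normal_polytope {n} (L P : set 'rV[R]_n) : Prop :=
  forall o, L o -> normal0 [set x - o | x in L] [set x - o | x in P].

End Geometry.

(** * Lattice polytopal complexes *)

(* A cell is a polytope with its chart and its lattice of reference.  The chart is a
   total map, of which only the values on the polytope matter. *)
Record cell (R : realType) (T : Type) := Cell {
  cell_dim : nat;
  cell_poly : set 'rV[R]_cell_dim;
  cell_chart : 'rV[R]_cell_dim -> T;
  cell_lat : set 'rV[R]_cell_dim }.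
Arguments cell_dim {R T} _.
Arguments cell_poly {R T} _.
Arguments cell_chart {R T} _.
Arguments cell_lat {R T} _.

Definition map_cell {R : realType} {T T' : Type} (j : T -> T') (c : cell R T)
    : cell R T' :=
  Cell R T' (cell_dim c) (cell_poly c) (j \o cell_chart c) (cell_lat c).

(* Only the data; the axioms are in lattice_complex below.  The faces are sets
   of points of an ambient type, and cell_of is relevant on faces only. *)
Record complex (R : realType) := Complex {
  points : Type;
  faces : set (set points);
  cell_of : set points -> cell R points }.
Arguments points {R} _.
Arguments faces {R} _ _.
Arguments cell_of {R} _ _.

Section Complexes.
Context {R : realType}.

Definition polytope_of {X : complex R} (p : set (points X)) :=
  cell_poly (cell_of X p).
Definition chart_of {X : complex R} (p : set (points X)) :=
  cell_chart (cell_of X p).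
Definition lattice_of {X : complex R} (p : set (points X)) :=
  cell_lat (cell_of X p).

Definition carrier (X : complex R) : set (points X) :=
  [set x | exists2 p, faces X p & p x].

Definition complex_facet {X : complex R} (p : set (points X)) : Prop :=
  faces X p /\ forall q, faces X q -> p `<=` q -> q = p.

Definition complex_dim (X : complex R) (d : nat) : Prop :=
  (exists2 p, faces X p & has_dim (polytope_of p) d) /\
  (forall p k, faces X p -> has_dim (polytope_of p) k -> (k <= d)%N).

(* The affine map g restricts to the chart change F -> G. *)
Definition transition {X : complex R} (p q : set (points X))
    (F : set 'rV[R]_(cell_dim (cell_of X p)))
    (G : set 'rV[R]_(cell_dim (cell_of X q)))
    (g : 'rV[R]_(cell_dim (cell_of X p)) -> 'rV[R]_(cell_dim (cell_of X q)))
    : Prop :=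
  [/\ face (polytope_of p) F /\ face (polytope_of q) G,
      p `&` q = chart_of p @` F, p `&` q = chart_of q @` G,
      affine_map g /\ set_bij F G g
    & forall x, F x -> chart_of q (g x) = chart_of p x].

Definition polytopal_complex (X : complex R) : Prop :=
  [/\ finite_set (faces X),
      forall p, faces X p ->
        polytope (polytope_of p) /\ set_bij (polytope_of p) p (chart_of p),
      forall p F, faces X p -> face (polytope_of p) F ->
        faces X (chart_of p @` F)
    & forall p q, faces X p -> faces X q ->
        exists F G g, transition p q F G g].

(* The face set0 of X has an empty lattice of reference.  In the last clause
   aff_hull F and aff_hull G are both Aff(p `&` q), identified by the affine
   extension g of the transition map. *)
Definition lattice_complex (X : complex R) : Prop :=
  [/\ polytopal_complex X,
      forall p, faces X p ->
        [/\ lattice_of p `<=` aff_hull (polytope_of p),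
            polytope_of p !=set0 -> affine_lattice (lattice_of p)
          & lattice_polytope (lattice_of p) (polytope_of p)]
    & forall p q F G g, faces X p -> faces X q ->
        transition p q F G g ->
        g @` (lattice_of p `&` aff_hull F) = lattice_of q `&` aff_hull G].

Definition complex_isom {X Y : complex R} (phi : points X -> points Y) : Prop :=
  set_bij (carrier X) (carrier Y) phi /\
  forall p, faces X p -> exists2 q, faces Y q &
    exists g : 'rV[R]_(cell_dim (cell_of X p)) -> 'rV[R]_(cell_dim (cell_of Y q)),
      [/\ affine_map g, set_bij (polytope_of p) (polytope_of q) g,
          forall x, polytope_of p x -> chart_of q (g x) = phi (chart_of p x),
          set_bij (polytope_of p `&` lattice_of p)
            (polytope_of q `&` lattice_of q) g
        & set_bij (lattice_of p) (lattice_of q) g].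

Definition stacked (X : complex R) : Prop :=
  exists (n : nat) (P : 'I_n -> set (points X)),
    set_bij [set: 'I_n] complex_facet P /\
    forall i : 'I_n, (0 < i)%N -> exists2 F, facet (polytope_of (P i)) F &
      P i `&` \bigcup_(j in [set j : 'I_n | (j < i)%N]) P j
        = chart_of (P i) @` F.

Definition pure (X : complex R) : Prop :=
  forall (p q : set (points X)) k, complex_facet p -> complex_facet q ->
    has_dim (polytope_of p) k -> has_dim (polytope_of q) k.

(* No facet of a facet of X lies in three facets of X.  Together with purity,
   this holds in every bottom complex. *)
Definition unbranched (X : complex R) : Prop :=
  forall (p1 p2 p3 : set (points X)) F, complex_facet p1 -> complex_facet p2 ->
    complex_facet p3 -> facet (polytope_of p1) F ->
    chart_of p1 @` F `<=` p2 -> chart_of p1 @` F `<=` p3 ->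
    [\/ p1 = p2, p1 = p3 | p2 = p3].

End Complexes.

(** * Cones and their bottom complexes *)

Section Bottom.
Context {R : realType}.

Definition int_points n : set 'rV[R]_n :=
  [set x | forall j, x 0 j \is a Num.int].

Definition lattice_monoid {n} (C : set 'rV[R]_n) : set 'rV[R]_n :=
  C `&` int_points n.

Definition cone {n} (C : set 'rV[R]_n) : Prop :=
  (exists (k : nat) (x : 'I_k -> 'rV[R]_n), (forall i, int_points n (x i)) /\
     C = [set y | exists c : 'I_k -> R,
            (forall i, 0 <= c i) /\ y = \sum_i c i *: x i]) /\
  (forall U : {vspace 'rV[R]_n}, (forall v, v \in U -> C v) -> \dim U = 0%N).

Definition monoid_isom {n m} (M : set 'rV[R]_n) (M' : set 'rV[R]_m)
    (h : 'rV[R]_n -> 'rV[R]_m) : Prop :=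
  [/\ set_bij M M' h, h 0 = 0 & forall x y, M x -> M y -> h (x + y) = h x + h y].

Definition lattice_isom {n m} (C : set 'rV[R]_n) (C' : set 'rV[R]_m)
    (theta : {linear 'rV[R]_n -> 'rV[R]_m}) : Prop :=
  set_bij C C' theta /\ monoid_isom (lattice_monoid C) (lattice_monoid C') theta.

Definition Hilb {n} (C : set 'rV[R]_n) : set 'rV[R]_n :=
  [set x | [/\ lattice_monoid C x, x != 0
    & forall y z, lattice_monoid C y -> lattice_monoid C z -> x = y + z ->
        y = 0 \/ z = 0]].

Definition cone_over {n} (F : set 'rV[R]_n) : set 'rV[R]_n :=
  [set y | exists c x, [/\ 0 <= c, F x & y = c *: x]].

Definition bottom_facet {n} (C F : set 'rV[R]_n) : Prop :=
  facet (conv_hull (lattice_monoid C `\ 0)) F /\ compact F.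

(* set0 is a face of every polytope, hence of every complex; it is listed
   separately only for C = {0}, which has no bottom facets. *)
Definition bottom_complex {n} (C : set 'rV[R]_n) : complex R :=
  Complex R 'rV[R]_n
    [set G | G = set0 \/ exists2 F, bottom_facet C F & face F G]
    (fun G => Cell R 'rV[R]_n n G id (int_points n `&` aff_hull G)).

Definition conic_realization {X : complex R} {n} (C : set 'rV[R]_n)
    (phi : points X -> 'rV[R]_n) : Prop :=
  cone C /\ complex_isom (X := X) (Y := bottom_complex C) phi.

Definition reduced_conic_realization {X : complex R} {n} (C : set 'rV[R]_n)
    (phi : points X -> 'rV[R]_n) : Prop :=
  conic_realization C phi /\
  forall F, complex_facet (X := bottom_complex C) F -> Hilb (cone_over F) `<=` F.

Definition is_bottom (X : complex R) : Prop :=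
  lattice_complex X /\
  exists n (C : set 'rV[R]_n) (phi : points X -> 'rV[R]_n), conic_realization C phi.

Definition is_reduced_bottom (X : complex R) : Prop :=
  lattice_complex X /\
  exists n (C : set 'rV[R]_n) (phi : points X -> 'rV[R]_n),
    reduced_conic_realization C phi.

End Bottom.

(** * Conic gluing *)

Section Gluing.
Context {R : realType} {X1 X2 : complex R} {n1 n2 : nat}.
Variables (phi1 : points X1 -> 'rV[R]_n1) (phi2 : points X2 -> 'rV[R]_n2).
Variables (F1 : set 'rV[R]_n1) (theta : 'rV[R]_n1 -> 'rV[R]_n2).

(* x in |X1| and y in |X2| correspond under theta : |B(F1)| -> |B(F2)|. *)
Definition glue_pair (x : points X1) (y : points X2) : Prop :=
  [/\ carrier X1 x, carrier X2 y, carrier (bottom_complex F1) (phi1 x)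
    & phi2 y = theta (phi1 x)].

(* An equivalence relation on the disjoint union, because glue_pair is a
   partial bijection. *)
Definition glue_rel (u v : points X1 + points X2) : Prop :=
  match u, v with
  | inl x, inl x' => x = x'
  | inl x, inr y => glue_pair x y
  | inr y, inl x => glue_pair x y
  | inr y, inr y' => y = y'
  end.

(* Points of the glued complex are the classes of glue_rel. *)
Definition glue_inl (x : points X1) : set (points X1 + points X2) :=
  glue_rel (inl x).
Definition glue_inr (y : points X2) : set (points X1 + points X2) :=
  glue_rel (inr y).

(* glue_inl and glue_inr are injective, so a face is the image of its
   preimage.  For an identified face, the cell of X1 is used. *)
Definition conic_gluing : complex R :=
  Complex R (set (points X1 + points X2))
    [set p | (exists2 q, faces X1 q & p = glue_inl @` q) \/
             (exists2 q, faces X2 q & p = glue_inr @` q)]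
    (fun p => if `[< exists2 q, faces X1 q & p = glue_inl @` q >]
              then map_cell glue_inl (cell_of X1 (glue_inl @^-1` p))
              else map_cell glue_inr (cell_of X2 (glue_inr @^-1` p))).

End Gluing.

(* Main.v *)
(** Bottom facets of a cone C correspond to functionals that are >= 1 on the nonzero lattice
    points of C and whose points of value 1 span the space.  To glue C1 and C2 along a common
    facet F, a lattice automorphism extending theta puts them on opposite sides of F, and C2 is
    then sheared far along a lattice vector v in the interior of F.  After a large enough shear
    every segment between lattice points of the two sides crosses F in F + 2v.  Hence the union
    is a convex cone, and no bottom facet straddles the wall; moreover the finitely many bottom
    functionals of either side exceed 1 on the lattice points strictly across the wall, so the
    bottom of the union is the union of the bottoms.

    A lattice polytope P is the bottom of the cone over P x {1}, and a stacked complex is obtained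
    by gluing such cones one facet at a time.  The induction carries along that every facet of a
    cell lying in no other cell glued so far is cut out by a functional that is nonnegative on the
    cone: shearing far enough keeps these supporting functionals positive across the wall, and
    unbranchedness says that the next wall is one of them.  A facet F is normal exactly if
    the elements of Hilb(R_+ F) have height 1 over F, that is, lie in F. *)
Require Import Defs.
From HB Require Import structures.
From mathcomp Require Import all_boot all_order all_algebra.
From mathcomp Require Import all_classical all_reals all_analysis.
From mathcomp Require Import zify ring lra.
Import Order.TTheory GRing.Theory Num.Theory.
Import numFieldNormedType.Exports.
Set Implicit Arguments.
Unset Strict Implicit.
Local Open Scope classical_set_scope.
Local Open Scope ring_scope.

(** * Affine hulls and linear functionals *)

Section Linear.
Context {R : realType}.

(** A single shear must serve for every requirement at once, and it must be an integral multiple of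
    one fixed transformation to preserve the lattice. This is possible because only finitely many
    functionals matter: Gordan's lemma confines the tight points of all bottom functionals of a cone
    to one finite list. Integrality enters a second time through the gap between 0 and 1: a lattice
    point off the wall has height at least 1 over it, so a push by twice the height already exceeds
    1.

    The isomorphism [theta] is known on the wall only. To extend it to the whole lattice one needs a
    lattice vector at height exactly 1 on either side, hence a primitive integral functional for
    each wall.

    The axioms of a lattice polytopal complex are never checked by hand for a glued complex. A map
    to the bottom complex of a cone, injective on points and matching the faces, pulls all of them
    back. In the other direction, an isomorphism of complexes does not say that each bottom face is
    the image of a face; this is recovered from a point of a facet that lies in no proper face. *)

Definition pr {n} (c : 'cV[R]_n) (x : 'rV[R]_n) : R := (x *m c) 0 0.

Fact pr_is_scalar n (c : 'cV[R]_n) : scalar (pr c).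
Proof. by move=> a u v; rewrite /pr mulmxDl -scalemxAl !mxE. Qed.

HB.instance Definition _ n (c : 'cV[R]_n) :=
  GRing.isLinear.Build R 'rV[R]_n R *%R (pr c) (pr_is_scalar c).

(** With functionals as column vectors, integrality of a functional is integrality of a matrix, and
    pulling back along a matrix is a product ([prMr]). *)
Lemma scalar_pr n (f : {scalar 'rV[R]_n}) : exists c, f =1 pr c.
Proof.
exists (\col_j f (delta_mx 0 j)) => x.
rewrite {1}(row_sum_delta x) linear_sum /pr mxE; apply: eq_bigr => j _.
by rewrite linearZ mxE.
Qed.

Lemma prD n (c : 'cV[R]_n) x y : pr c (x + y) = pr c x + pr c y.
Proof. by rewrite linearD. Qed.

Lemma prN n (c : 'cV[R]_n) x : pr c (- x) = - pr c x.
Proof. by rewrite linearN. Qed.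

Lemma prB n (c : 'cV[R]_n) x y : pr c (x - y) = pr c x - pr c y.
Proof. by rewrite linearB. Qed.

Lemma prZ n (c : 'cV[R]_n) a x : pr c (a *: x) = a * pr c x.
Proof. by rewrite linearZ. Qed.

Lemma pr0 n (c : 'cV[R]_n) : pr c 0 = 0.
Proof. by rewrite linear0. Qed.

Lemma prMr n m (c : 'cV[R]_m) (M : 'M[R]_(n, m)) x : pr c (x *m M) = pr (M *m c) x.
Proof. by rewrite /pr mulmxA. Qed.

Lemma prDc n (c d : 'cV[R]_n) x : pr (c + d) x = pr c x + pr d x.
Proof. by rewrite /pr mulmxDr mxE. Qed.

Lemma prZc n a (c : 'cV[R]_n) x : pr (a *: c) x = a * pr c x.
Proof. by rewrite /pr -scalemxAr mxE. Qed.

Lemma prNc n (c : 'cV[R]_n) x : pr (- c) x = - pr c x.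
Proof. by rewrite /pr mulmxN mxE. Qed.

Lemma prBc n (c d : 'cV[R]_n) x : pr (c - d) x = pr c x - pr d x.
Proof. by rewrite prDc prNc. Qed.

Lemma pr0c n x : pr (0 : 'cV[R]_n) x = 0.
Proof. by rewrite /pr mulmx0 mxE. Qed.

Lemma pr_eq0 n (c : 'cV[R]_n) : (forall x, pr c x = 0) -> c = 0.
Proof.
move=> c0; apply/matrixP => i j; rewrite ord1 mxE.
by have := c0 (delta_mx 0 i); rewrite /pr -rowE mxE.
Qed.

(** Free lists in [A] have length at most the dimension of the space, so a longest one exists;
    maximality puts all of [A] into its span. *)
Lemma vspan_ex n (A : set 'rV[R]_n) :
  {W : {vspace 'rV[R]_n} | [/\ forall x, A x -> x \in W
    & exists s : seq 'rV[R]_n, [/\ forall x, x \in s -> A x, free s & W = span s]]}.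
Proof.
apply: cid.
pose P k := `[< exists s : seq 'rV[R]_n, [/\ forall x, x \in s -> A x, free s & size s = k] >].
have P0 : exists k, P k by exists 0%N; apply/asboolP; exists [::]; rewrite // nil_free.
have Pn k : P k -> (k <= \dim {: 'rV[R]_n})%N.
  by move=> /asboolP [s [_ /eqP <- <-]]; apply: dimvS; apply: subvf.
have := ex_maxnP P0 Pn; case => k /asboolP [s [sA sf sk]] kmax.
exists (span s); split; last by exists s.
move=> x Ax; apply/negPn/negP => xs; suff : (k.+1 <= k)%N by rewrite ltnn.
apply: kmax; apply/asboolP; exists (x :: s); rewrite /= sk free_cons xs; split=> // y.
by rewrite inE => /orP [/eqP ->|/sA].
Qed.

Definition vspan {n} (A : set 'rV[R]_n) : {vspace 'rV[R]_n} := projT1 (vspan_ex A).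

Lemma mem_vspan n (A : set 'rV[R]_n) x : A x -> x \in vspan A.
Proof. by rewrite /vspan; case: vspan_ex => W [] /= + _; exact. Qed.

Lemma vspan_free n (A : set 'rV[R]_n) :
  exists s : seq 'rV[R]_n, [/\ forall x, x \in s -> A x, free s & vspan A = span s].
Proof. by rewrite /vspan; case: vspan_ex => W []. Qed.

Lemma vspan_seq n (A : set 'rV[R]_n) :
  exists2 s : seq 'rV[R]_n, (forall x, x \in s -> A x) & vspan A = span s.
Proof. by have [s [sA _ sE]] := vspan_free A; exists s. Qed.

Lemma vspan_sub n (A : set 'rV[R]_n) (W : {vspace 'rV[R]_n}) :
  (forall x, A x -> x \in W) -> (vspan A <= W)%VS.
Proof. by have [s sA ->] := vspan_seq A => AW; apply/span_subvP => x /sA /AW. Qed.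

Lemma vspanS n (A B : set 'rV[R]_n) : A `<=` B -> (vspan A <= vspan B)%VS.
Proof. by move=> AB; apply: vspan_sub => x /AB /mem_vspan. Qed.

Lemma in_vspanP n (A : set 'rV[R]_n) x : x \in vspan A <->
  exists k (y : 'I_k -> 'rV[R]_n) (c : 'I_k -> R),
    (forall i, A (y i)) /\ x = \sum_i c i *: y i.
Proof.
split=> [|[k [y [c [yA ->]]]]]; last first.
  by apply: memv_suml => i _; apply/memvZ/mem_vspan.
have [s sA ->] := vspan_seq A => xs.
exists (size s), (fun i => s`_i), (fun i => coord (in_tuple s) i x); split.
  by move=> i; apply/sA/mem_nth.
exact: (@coord_span _ _ _ (in_tuple s)).
Qed.

Lemma vspan_ind n (A : set 'rV[R]_n) (P : 'rV[R]_n -> Prop) :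
  P 0 -> (forall x y, P x -> P y -> P (x + y)) -> (forall a x, A x -> P (a *: x)) ->
  forall x, x \in vspan A -> P x.
Proof.
move=> P0 PD PZ x /in_vspanP [k [y [c [yA ->]]]].
by elim/big_ind : _ => // i _; apply: PZ.
Qed.

(** The residue [x - projv W x] is nonzero, so one of its coordinates is; that coordinate of the
    residue is the functional. *)
Lemma vspace_sep n (W : {vspace 'rV[R]_n}) x : x \notin W ->
  exists2 c, (forall w, w \in W -> pr c w = 0) & pr c x != 0.
Proof.
move=> xW; pose f z := z - projv W z.
have [j fj] : exists j, f x 0 j != 0.
  apply/existsP; apply: contraNT xW; rewrite negb_exists => /forallP fx0.
  suff -> : x = projv W x by apply: memv_proj.
  apply/subr0_eq/matrixP => i j; rewrite ord1 [RHS]mxE.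
  by apply/eqP; have := fx0 j; rewrite negbK.
pose g z := f z 0 j.
have gl : scalar g.
  by move=> a u v; rewrite /g /f linearP /= !mxE; ring.
pose gL := GRing.isLinear.Build R 'rV[R]_n R *%R g gl.
pose G : {scalar 'rV[R]_n} := HB.pack g gL.
have [c gc] := scalar_pr G; exists c; last by rewrite -gc.
by move=> w wW; rewrite -gc /= /g /f projv_id // subrr mxE.
Qed.

(** Translates the spanning condition of [bottom_functional], which is phrased with functionals,
    into an inclusion of subspaces that can be tested by dimension. *)
Lemma vspan_dualP n (A B : set 'rV[R]_n) : (vspan A <= vspan B)%VS <->
  forall c, (forall x, B x -> pr c x = 0) -> forall x, A x -> pr c x = 0.
Proof.
have van c (D : set 'rV[R]_n) :
    (forall x, D x -> pr c x = 0) -> forall x, x \in vspan D -> pr c x = 0.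
  move=> cD; apply: vspan_ind => [|x y px py|a x /cD]; rewrite ?linear0 //.
    by rewrite linearD /= px py addr0.
  by rewrite linearZ /= => ->; rewrite mulr0.
split=> [/subvP AB c cB x Ax|H].
  by apply: (van _ _ cB); apply/AB/mem_vspan.
apply: vspan_sub => x Ax; case: (boolP (x \in vspan B)) => // /vspace_sep [c cB /eqP []].
by apply: H Ax => y /mem_vspan; apply: cB.
Qed.

Lemma pr_vspan n (A : set 'rV[R]_n) c : (forall x, A x -> pr c x = 0) ->
  forall x, x \in vspan A -> pr c x = 0.
Proof.
move=> cD; apply: vspan_ind => [|x y px py|a x /cD]; rewrite ?linear0 //.
  by rewrite linearD /= px py addr0.
by rewrite linearZ /= => ->; rewrite mulr0.
Qed.

Lemma aff_hullP n (A : set 'rV[R]_n) x0 x : A x0 ->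
  aff_hull A x <-> x - x0 \in vspan [set y - x0 | y in A].
Proof.
move=> Ax0; split=> [[k [y [c [yA c1 ->]]]]|].
  have -> : \sum_i c i *: y i - x0 = \sum_i c i *: (y i - x0).
    under [RHS]eq_bigr do rewrite scalerBr.
    by rewrite sumrB -scaler_suml c1 scale1r.
  apply: memv_suml => i _; apply/memvZ/mem_vspan; exists (y i) => //; exact: yA.
move=> /in_vspanP [k [y [c [yA xE]]]].
(* The extra index carries [x0] with the weight that completes the total to 1. *)
exists k.+1, (fun i => if unlift ord0 i is Some j then y j + x0 else x0),
  (fun i => if unlift ord0 i is Some j then c j else 1 - \sum_j c j); split.
- move=> i; case: unliftP => // j _; have [z zA <-] := yA j.
  by rewrite subrK.
- rewrite big_ord_recl unlift_none; under [X in _ + X]eq_bigr do rewrite liftK.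
  by rewrite subrK.
- rewrite big_ord_recl unlift_none; under [X in _ + X]eq_bigr do rewrite liftK scalerDr.
  rewrite big_split /= -xE -scaler_suml addrCA -scalerDl.
  by rewrite subrK scale1r subrK.
Qed.

Lemma aff_hull_neq0 n (A : set 'rV[R]_n) x : aff_hull A x -> A !=set0.
Proof.
move=> [[|k] [y [c [yA c1 _]]]]; last by exists (y ord0).
by move: c1; rewrite big_ord0 => /esym/eqP; rewrite oner_eq0.
Qed.

Lemma has_dim_nonempty n (A : set 'rV[R]_n) k : has_dim A k -> A !=set0.
Proof.
move=> [x0 [U [_ AE]]]; apply: (@aff_hull_neq0 _ _ x0).
by rewrite AE; exists 0; rewrite ?addr0 //= mem0v.
Qed.

Lemma has_dimP n (A : set 'rV[R]_n) x0 k : A x0 ->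
  has_dim A k <-> \dim (vspan [set y - x0 | y in A]) = k.
Proof.
move=> Ax0; split=> [[y0 [U [<- AE]]]|<-]; last first.
  exists x0, (vspan [set y - x0 | y in A]); split => //.
  apply/seteqP; split => x.
    by move=> /(aff_hullP _ Ax0) xU; exists (x - x0); rewrite //= addrC subrK.
  by move=> [u /= uU <-]; apply/(aff_hullP _ Ax0); rewrite addrC addKr.
congr (\dim _); apply/eqP; rewrite eqEsubv; apply/andP.
have memA x : aff_hull A x <-> x - y0 \in U.
  rewrite AE; split=> [[u uU <-]|xU]; first by rewrite addrC addKr.
  by exists (x - y0); rewrite //= addrC subrK.
have x0U : x0 - y0 \in U.
  by apply/memA/(aff_hullP _ Ax0); rewrite subrr mem0v.
split; first apply/vspan_sub => _ [x Ax <-].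
  rewrite -[x](subrK y0) -addrA rpredD //.
    by apply/memA/(aff_hullP _ Ax0)/mem_vspan; exists x.
  by rewrite -opprB rpredN.
apply/subvP => u uU.
have /(aff_hullP _ Ax0) : aff_hull A (x0 + u).
  by apply/memA; rewrite addrAC rpredD.
by rewrite addrC addKr.
Qed.

Lemma aff_hull_sub n (A : set 'rV[R]_n) : A `<=` aff_hull A.
Proof. by move=> x Ax; apply/(aff_hullP _ Ax); rewrite subrr mem0v. Qed.

Lemma aff_hull_mono n (A B : set 'rV[R]_n) : A `<=` B -> aff_hull A `<=` aff_hull B.
Proof. by move=> AB x [k [y [c [yA c1 ->]]]]; exists k, y, c; split=> // i; apply: AB. Qed.

Lemma aff_hull_height n (A : set 'rV[R]_n) f x : (forall y, A y -> pr f y = 1) ->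
  aff_hull A x <-> x \in vspan A /\ pr f x = 1.
Proof.
move=> f1; have fs k (y : 'I_k -> 'rV[R]_n) (c : 'I_k -> R) : (forall i, A (y i)) ->
    pr f (\sum_i c i *: y i) = \sum_i c i.
  by move=> yA; rewrite linear_sum; apply: eq_bigr => i _; rewrite linearZ /= f1 // mulr1.
split=> [[k [y [c [yA c1 ->]]]]|[/in_vspanP [k [y [c [yA ->]]]]]]; rewrite fs //.
  by split=> //; apply/in_vspanP; exists k, y, c.
by move=> c1; exists k, y, c.
Qed.

(** The functional [f] vanishes on all differences and is 1 at [x0], so the line of [x0] is
    complementary to the direction space. This accounts for the shift by one between a polytope and
    the cone over it. *)
Lemma vspan_height n (A : set 'rV[R]_n) f x0 : (forall y, A y -> pr f y = 1) -> A x0 ->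
  \dim (vspan A) = (\dim (vspan [set y - x0 | y in A])).+1.
Proof.
move=> f1 Ax0; set U := vspan [set _ | _ in _].
have x0n : x0 != 0.
  apply: contra_eqN (f1 _ Ax0) => /eqP ->.
  by rewrite linear0 eq_sym oner_eq0.
have -> : vspan A = (U + <[x0]>)%VS.
  apply/eqP; rewrite eqEsubv; apply/andP; split.
    apply: vspan_sub => x Ax; rewrite -[x](subrK x0); apply: memv_add; last exact: memv_line.
    by apply: mem_vspan; exists x.
  rewrite subv_add -memvE mem_vspan // andbT; apply: vspan_sub => _ [x Ax <-].
  by rewrite rpredB ?mem_vspan.
rewrite dimv_disjoint_sum ?dim_vline ?x0n ?addn1 //.
apply/eqP; rewrite -subv0; apply/subvP => u; rewrite memv_cap => /andP [uU /vlineP [a ua]].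
have : pr f u = 0.
  by apply: pr_vspan uU => _ [x Ax <-]; rewrite linearB /= !f1 // subrr.
by rewrite ua linearZ /= f1 // mulr1 => ->; rewrite scale0r mem0v.
Qed.

Lemma has_dim_height n (A : set 'rV[R]_n) f k : (forall y, A y -> pr f y = 1) ->
  has_dim A k <-> \dim (vspan A) = k.+1.
Proof.
move=> f1; split=> [Ak|Ak].
  have [x0 Ax0] := has_dim_nonempty Ak; move: Ak => /(has_dimP _ Ax0) <-.
  exact: vspan_height f1 Ax0.
have [x0 Ax0] : A !=set0.
  apply/set0P; apply: contra_eqN Ak => /eqP ->; have [s s0 ->] := vspan_seq (@set0 'rV[R]_n).
  case: s s0 => [|x s] s0; last by have := s0 x (mem_head _ _).
  by rewrite span_nil dimv0.
by apply/(has_dimP _ Ax0); move: Ak; rewrite (vspan_height f1 Ax0) => -[].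
Qed.

Lemma has_dim_linear n (A : set 'rV[R]_n) k : aff_hull A 0 ->
  has_dim A k <-> \dim (vspan A) = k.
Proof.
move=> A0; have [x0 Ax0] := aff_hull_neq0 A0.
rewrite (has_dimP _ Ax0); suff -> : vspan [set y - x0 | y in A] = vspan A by [].
have /(aff_hullP _ Ax0) := A0; rewrite sub0r rpredN => x0U.
apply/eqP; rewrite eqEsubv; apply/andP; split; apply: vspan_sub => x.
  by move=> [y Ay <-]; rewrite rpredB ?mem_vspan.
move=> Ax; rewrite -[x](subrK x0) rpredD //; apply: mem_vspan; by exists x.
Qed.

End Linear.

(** * Convex hulls and faces *)

Section Convex.
Context {R : realType}.

Definition is_conv {n} (A : set 'rV[R]_n) : Prop := forall x y t,
  A x -> A y -> 0 <= t <= 1 -> A (t *: x + (1 - t) *: y).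

Lemma conv_hull_sub n (A : set 'rV[R]_n) : A `<=` conv_hull A.
Proof.
move=> x Ax; exists 1%N, (fun=> x), (fun=> 1); split=> //.
- by rewrite big_ord1.
- by rewrite big_ord1 scale1r.
Qed.

Lemma conv_hullS n (A B : set 'rV[R]_n) : A `<=` B -> conv_hull A `<=` conv_hull B.
Proof. by move=> AB x [k [y [c [yA c0 c1 ->]]]]; exists k, y, c; split=> // i; apply: AB. Qed.

Lemma conv_hull_aff n (A : set 'rV[R]_n) : conv_hull A `<=` aff_hull A.
Proof. by move=> x [k [y [c [yA c0 c1 ->]]]]; exists k, y, c. Qed.

Lemma conv_hull_convex n (A : set 'rV[R]_n) : is_conv (conv_hull A).
Proof.
move=> _ _ t [k [y [c [yA c0 c1 ->]]]] [l [z [d [zA d0 d1 ->]]]] /andP [t0 t1].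
exists (k + l)%N, (fun i => match fintype.split i with inl a => y a | inr b => z b end),
  (fun i => match fintype.split i with inl a => t * c a | inr b => (1 - t) * d b end).
have sl (a : 'I_k) : fintype.split (lshift l a) = inl a by have := @unsplitK k l (inl a).
have sr (b : 'I_l) : fintype.split (rshift k b) = inr b by have := @unsplitK k l (inr b).
split.
- by move=> i; case: fintype.split.
- by move=> i; case: fintype.split => a; rewrite mulr_ge0 // subr_ge0.
- rewrite big_split_ord; under eq_bigr do rewrite sl; under [X in _ + X = _]eq_bigr do rewrite sr.
  by rewrite -!mulr_sumr c1 d1 !mulr1 addrC subrK.
- rewrite big_split_ord !scaler_sumr; congr (_ + _); apply: eq_bigr => i _.
    by rewrite sl scalerA.
  by rewrite sr scalerA.
Qed.

Lemma conv_comb n (B : set 'rV[R]_n) k (y : 'I_k -> 'rV[R]_n) (c : 'I_k -> R) :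
  is_conv B -> (forall i, B (y i)) -> (forall i, 0 <= c i) -> \sum_i c i = 1 ->
  B (\sum_i c i *: y i).
Proof.
move=> Bc; elim: k y c => [|k IH] y c yB c0; first by rewrite big_ord0 => /esym/eqP; rewrite oner_eq0.
rewrite !big_ord_recl => c1.
have r0 : \sum_(i < k) c (lift ord0 i) = 1 - c ord0 by rewrite -c1 addrC addKr.
have : 0 <= 1 - c ord0 by rewrite -r0 sumr_ge0.
rewrite le_eqVlt eq_sym => /orP [/eqP e0|lt].
  have /(psumr_eq0P (fun i _ => c0 _)) ci0 : \sum_(i < k) c (lift ord0 i) = 0 by rewrite r0.
  rewrite big1 => [|i _]; last by rewrite ci0 // scale0r.
  by rewrite addr0 -(subr0_eq e0) scale1r.
set S := \sum_(i < k) _ *: _.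
have -> : S = (1 - c ord0) *: \sum_(i < k) (c (lift ord0 i) / (1 - c ord0)) *: y (lift ord0 i).
  rewrite scaler_sumr; apply: eq_bigr => i _; rewrite scalerA mulrC divfK //.
  by rewrite gt_eqF.
apply: Bc => //; last by rewrite c0 -subr_ge0 ltW.
apply: IH => // [i|]; first by rewrite divr_ge0 // ltW.
by rewrite -mulr_suml r0 divff // gt_eqF.
Qed.

Lemma conv_hull_min n (A B : set 'rV[R]_n) : is_conv B -> A `<=` B -> conv_hull A `<=` B.
Proof.
by move=> Bc AB x [k [y [c [yA c0 c1 ->]]]]; apply: conv_comb => // i; apply: AB.
Qed.

Lemma conv_ge n (c : 'cV[R]_n) m : is_conv [set x | m <= pr c x].
Proof.
move=> x y t /= mx my /andP [t0 t1]; rewrite linearD !linearZ /=.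
by have : 0 <= 1 - t by [lra]; nra.
Qed.

Lemma conv_eq n (c : 'cV[R]_n) m : is_conv [set x | pr c x = m].
Proof. by move=> x y t /= mx my _; rewrite linearD !linearZ /= mx my; ring. Qed.

Lemma is_convI n (A B : set 'rV[R]_n) : is_conv A -> is_conv B -> is_conv (A `&` B).
Proof. by move=> Ac Bc x y t [Ax Bx] [Ay By] t01; split; [exact: Ac|exact: Bc]. Qed.

Lemma conv_hull_ge n (A : set 'rV[R]_n) c m :
  (forall x, A x -> m <= pr c x) -> forall x, conv_hull A x -> m <= pr c x.
Proof. by move=> Am; apply: conv_hull_min Am; exact: conv_ge. Qed.

Lemma conv_hull_eq n (A : set 'rV[R]_n) c m :
  (forall x, A x -> pr c x = m) -> forall x, conv_hull A x -> pr c x = m.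
Proof. by move=> Am; apply: conv_hull_min Am; exact: conv_eq. Qed.

(** If a convex combination attains the minimum, the nonnegative terms [a i * (pr c (y i) - m)] add
    up to 0, so positive weight sits on minimizers only. Points of weight 0 are replaced by one
    minimizer [y i0]. *)
Lemma conv_hull_face n (A : set 'rV[R]_n) c m : (forall x, A x -> m <= pr c x) ->
  conv_hull A `&` [set x | pr c x = m] = conv_hull (A `&` [set x | pr c x = m]).
Proof.
move=> Am; apply/seteqP; split; last first.
  apply: conv_hull_min; first by apply: is_convI; [exact: conv_hull_convex|exact: conv_eq].
  by move=> x [Ax xm]; split=> //; apply: conv_hull_sub.
move=> _ [[k [y [a [yA a0 a1 ->]]]] /= xm].
have [i0 ai0] : exists i, a i != 0.
  apply/existsP; apply: contra_eqT a1; rewrite negb_exists => /forallP a00.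
  rewrite big1 => [|i _]; first by rewrite eq_sym oner_eq0.
  by apply/eqP; have := a00 i; rewrite negbK.
have H i : a i * (pr c (y i) - m) = 0.
  have /psumr_eq0P : \sum_i a i * (pr c (y i) - m) = 0.
    under eq_bigr do rewrite mulrBr; rewrite sumrB -mulr_suml a1 mul1r.
    rewrite -[X in _ - X]xm linear_sum; apply/eqP; rewrite subr_eq0; apply/eqP.
    by apply: eq_bigr => i0' _; rewrite linearZ.
  by apply=> // j _; rewrite mulr_ge0 // subr_ge0 Am.
have H' i : a i != 0 -> pr c (y i) = m.
  by move=> /negPf ai; have /eqP := H i; rewrite mulf_eq0 ai subr_eq0 => /eqP.
exists k, (fun i => if a i == 0 then y i0 else y i), a; split=> //.
- by move=> i; case: eqVneq => ai; split=> //=; apply: H'.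
- by apply: eq_bigr => i _; case: eqVneq => // ->; rewrite !scale0r.
Qed.

Lemma affine_comb n m (g : 'rV[R]_n -> 'rV[R]_m) k (y : 'I_k -> 'rV[R]_n) c :
  affine_map g -> \sum_i c i = 1 -> g (\sum_i c i *: y i) = \sum_i c i *: g (y i).
Proof.
move=> [f [b gE]] c1; rewrite gE linear_sum.
under [RHS]eq_bigr do rewrite gE scalerDr.
rewrite big_split /= -scaler_suml c1 scale1r; congr (_ + _).
by apply: eq_bigr => i _; rewrite linearZ.
Qed.

Lemma image_family n m (g : 'rV[R]_n -> 'rV[R]_m) (A : set 'rV[R]_n) k (y : 'I_k -> 'rV[R]_m) :
  (forall i, (g @` A) (y i)) -> exists z : 'I_k -> 'rV[R]_n,
  (forall i, A (z i)) /\ y = g \o z.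
Proof.
move=> yA; have : forall i, exists z, A z /\ g z = y i by move=> i; have [z] := yA i; exists z.
move=> /choice [z zP]; exists z; split=> [i|]; first by have [] := zP i.
by apply/funext => i /=; have [] := zP i.
Qed.

Lemma conv_hull_image n m (g : 'rV[R]_n -> 'rV[R]_m) (A : set 'rV[R]_n) :
  affine_map g -> g @` conv_hull A = conv_hull (g @` A).
Proof.
move=> ga; apply/seteqP; split=> [_ [_ [k [y [c [yA c0 c1 ->]]]] <-]|x].
  exists k, (g \o y), c; split=> // [i|]; first by exists (y i).
  exact: affine_comb.
move=> [k [y [c [/image_family [z [zA ->]] c0 c1 ->]]]].
by exists (\sum_i c i *: z i); [exists k, z, c|exact: affine_comb].
Qed.

Lemma aff_hull_image n m (g : 'rV[R]_n -> 'rV[R]_m) (A : set 'rV[R]_n) :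
  affine_map g -> g @` aff_hull A = aff_hull (g @` A).
Proof.
move=> ga; apply/seteqP; split=> [_ [_ [k [y [c [yA c1 ->]]]] <-]|x].
  exists k, (g \o y), c; split=> // [i|]; first by exists (y i).
  exact: affine_comb.
move=> [k [y [c [/image_family [z [zA ->]] c1 ->]]]].
by exists (\sum_i c i *: z i); [exists k, z, c|exact: affine_comb].
Qed.

Lemma affine_comp n m p (g : 'rV[R]_m -> 'rV[R]_p) (h : 'rV[R]_n -> 'rV[R]_m) :
  affine_map g -> affine_map h -> affine_map (g \o h).
Proof.
move=> [f [b gE]] [f' [b' hE]]; exists (f \o f' : {linear _ -> _}), (f b' + b) => x /=.
by rewrite gE hE linearD addrA.
Qed.

Lemma affine_mulmx n m (M : 'M[R]_(n, m)) : affine_map (fun x : 'rV[R]_n => x *m M).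
Proof. by exists (mulmxr M), 0 => x /=; rewrite addr0. Qed.

Lemma affine_pr n m (g : 'rV[R]_n -> 'rV[R]_m) c : affine_map g ->
  exists d e, forall x, pr c (g x) = pr d x + e.
Proof.
move=> [f [b gE]]; have [d fd] := scalar_pr (pr c \o f : {scalar _}).
by exists d, (pr c b) => x; rewrite gE linearD /= -fd.
Qed.

End Convex.

(** * Faces of polytopes *)

Section Faces.
Context {R : realType}.

Lemma facePr n (A F : set 'rV[R]_n) : face A F <->
  exists c m, (forall x, A x -> m <= pr c x) /\ F = A `&` [set x | pr c x = m].
Proof.
split=> [[f [m [fm ->]]]|[c [m [cm ->]]]]; last by exists (pr c), m.
have [c fc] := scalar_pr f; exists c, m; split=> [x /fm|]; first by rewrite fc.
by apply/seteqP; split=> x [Ax] /=; rewrite fc.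
Qed.

Lemma face_sub n (A F : set 'rV[R]_n) : face A F -> F `<=` A.
Proof. by move=> [f [m [_ ->]]] x []. Qed.

Lemma face_refl n (A : set 'rV[R]_n) : face A A.
Proof.
apply/facePr; exists 0, 0; split=> [x _|]; first by rewrite pr0c.
by apply/seteqP; split=> x; [move=> Ax; split; rewrite //= pr0c|case].
Qed.

Lemma face_set0 n (A : set 'rV[R]_n) : face A set0.
Proof.
apply/facePr; exists 0, (- 1); split=> [x _|]; first by rewrite pr0c lerN10.
apply/seteqP; split=> x // [_] /=; rewrite pr0c => /eqP.
by rewrite eq_sym oppr_eq0 oner_eq0.
Qed.

Lemma face_conv n (A F : set 'rV[R]_n) : is_conv A -> face A F -> is_conv F.
Proof. by move=> Ac /facePr [c [m [_ ->]]]; apply: is_convI => //; exact: conv_eq. Qed.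

Lemma face_seq n (s : seq 'rV[R]_n) F : face (conv_hull [set x | x \in s]) F ->
  exists c m, [/\ forall x, x \in s -> m <= pr c x,
   F = conv_hull [set x | x \in s] `&` [set x | pr c x = m]
   & F = conv_hull [set x | x \in [seq x <- s | pr c x == m]]].
Proof.
move=> /facePr [c [m [cm FE]]]; have cs x : x \in s -> m <= pr c x.
  by move=> xs; apply/cm/conv_hull_sub.
exists c, m; split=> //; rewrite FE conv_hull_face //; congr conv_hull.
apply/seteqP; split=> x /=; rewrite mem_filter; first by case=> -> ->; rewrite eqxx.
by move=> /andP [/eqP].
Qed.

(** A large multiple of the functional cutting out [F], plus the one cutting out [E] in [F], is
    minimal exactly on [E]: off [F] the first term outweighs the second. Finitely many generators
    make one multiple suffice. *)
Lemma face_trans n (P F E : set 'rV[R]_n) : polytope P -> face P F -> face F E -> face P E.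
Proof.
move=> [s ->] /face_seq [c [m [cm FE _]]] /facePr [d [e [de EE]]].
(* Each summand bounds the ratio needed at one generator off [F], and the 1 makes the domination
   strict; on [F] the denominator is 0 and the summand is 0 by convention. *)
pose K := 1 + \sum_(x <- s) `|pr d x - e| / (pr c x - m).
have K1 x : x \in s -> m < pr c x -> 0 < K * (pr c x - m) + (pr d x - e).
  move=> xs mx; have mx0 : 0 < pr c x - m by rewrite subr_gt0.
  have : 1 + `|pr d x - e| / (pr c x - m) <= K.
    rewrite lerD2l (big_rem x) //= lerDl big_seq sumr_ge0 // => y /mem_rem ys.
    by rewrite divr_ge0 // subr_ge0 cm.
  rewrite -(ler_pM2r mx0) mulrDl mul1r divfK ?gt_eqF // => Kx.
  by have := ler_norm (- (pr d x - e)); rewrite normrN; lra.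
have Fs x : x \in s -> pr c x = m -> e <= pr d x.
  by move=> xs xm; apply: de; rewrite FE; split=> //; apply: conv_hull_sub.
have K0 x : x \in s -> 0 <= K * (pr c x - m) + (pr d x - e).
  move=> xs; have := cm x xs; rewrite le_eqVlt => /orP [/eqP mE|/(K1 _ xs)/ltW //].
  by rewrite -mE subrr mulr0 add0r subr_ge0 Fs.
have prE x : pr (K *: c + d) x = K * pr c x + pr d x by rewrite prDc prZc.
apply/facePr; exists (K *: c + d), (K * m + e); split.
  by apply: conv_hull_ge => x /K0; rewrite prE; lra.
apply/seteqP; split=> x.
  by rewrite EE FE => -[[xP /= xm] xe]; split=> //=; rewrite prE xm xe.
rewrite conv_hull_face => [xH|y /K0]; last by rewrite prE; lra.
have xm : pr c x = m.
  apply: conv_hull_eq xH => y [ys] /=; rewrite prE => yE.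
  have := cm y ys; rewrite le_eqVlt => /orP [/eqP //|/(K1 _ ys)]; lra.
have xP : conv_hull [set x | x \in s] x by apply: conv_hullS xH => y [].
have : pr (K *: c + d) x = K * m + e by apply: conv_hull_eq xH => y [].
rewrite prE xm => xd; rewrite EE FE; split; first by split.
by move=> /=; lra.
Qed.

Lemma face_polytope n (P F : set 'rV[R]_n) : polytope P -> face P F -> polytope F.
Proof. by move=> [s ->] /face_seq [c [m [_ _ ->]]]; exists [seq x <- s | pr c x == m]. Qed.

Lemma polytope_conv n (P : set 'rV[R]_n) : polytope P -> is_conv P.
Proof. by move=> [s ->]; exact: conv_hull_convex. Qed.

(** Stands in for a relative interior point: a functional attaining its minimum at the average of
    the generators attains it at each of them. *)
Lemma barycentre n (s : seq 'rV[R]_n) : s != [::] ->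
  exists2 x, conv_hull [set x | x \in s] x &
  forall F, face (conv_hull [set x | x \in s]) F -> F x ->
    F = conv_hull [set x | x \in s].
Proof.
move=> s0; have k0 : 0 < (size s)%:R :> R by rewrite ltr0n lt0n size_eq0.
have i1 : \sum_(i < size s) (size s)%:R^-1 = 1 :> R.
  by rewrite sumr_const card_ord -[X in X *+ _]mul1r -mulrnAr -mulr_natr mulVf ?mulr1 // gt_eqF.
exists (\sum_(i < size s) (size s)%:R^-1 *: s`_i).
  exists (size s), (fun i => s`_i), (fun=> (size s)%:R^-1); split=> //=.
  by move=> i; apply: mem_nth.
move=> F /face_seq [c [m [cm -> _]]] [_ /= xm].
apply/seteqP; split=> [x []//|x xs]; split=> //=.
apply: conv_hull_eq xs => _ /= /(nthP 0) [i si <-].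
have /psumr_eq0P : \sum_(i < size s) (size s)%:R^-1 * (pr c s`_i - m) = 0.
  under eq_bigr do rewrite mulrBr; rewrite sumrB -mulr_suml i1 mul1r.
  rewrite -[X in _ - X]xm linear_sum; apply/eqP; rewrite subr_eq0; apply/eqP.
  by apply: eq_bigr => i0' _; rewrite linearZ.
have H (j : 'I_(size s)) : 0 <= (size s)%:R^-1 * (pr c s`_j - m).
  by apply: mulr_ge0; [rewrite invr_ge0 ltW|rewrite subr_ge0 cm // mem_nth].
move=> /(_ (fun j _ => H j) (Ordinal si) isT) /eqP.
by rewrite mulf_eq0 invr_eq0 (gt_eqF k0) /= subr_eq0 => /eqP.
Qed.

End Faces.

(** * Compactness, separation, vertices, and inverses of affine maps on polytopes *)

Section Faces.
Context {R : realType}.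

Lemma continuous_sum_fun (T : topologicalType) (V : normedModType R) (I : Type) (r : seq I)
    (f : I -> T -> V) :
  (forall i, continuous (f i)) -> continuous (fun x => \sum_(i <- r) f i x).
Proof.
move=> fc; elim: r => [|i r IH].
  have -> : (fun x => \sum_(i <- [::]) f i x) = cst 0.
    by apply/funext => x; rewrite big_nil.
  by move=> x; apply: cvg_cst.
have -> : (fun x => \sum_(j <- i :: r) f j x) = (fun x => f i x + \sum_(j <- r) f j x).
  by apply/funext => x; rewrite big_cons.
by move=> x; apply: cvgD; [apply: fc|apply: IH].
Qed.

Lemma conv_hull_seqP n (s : seq 'rV[R]_n) x : conv_hull [set x | x \in s] x <->
  exists w : 'rV[R]_(size s), [/\ forall i, 0 <= w 0 i, \sum_i w 0 i = 1
    & x = \sum_(i < size s) w 0 i *: s`_i].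
Proof.
split=> [|[w [w0 w1 ->]]]; last first.
  by exists (size s), (fun i => s`_i), (w 0); split=> // i; apply: mem_nth.
move: x; apply: conv_hull_min => [x y t [w [w0 w1 ->]] [v [v0 v1 ->]] /andP [t0 t1]|x /= xs].
  exists (t *: w + (1 - t) *: v); split.
  - by move=> i; rewrite !mxE addr_ge0 // mulr_ge0 // subr_ge0.
  - under eq_bigr do rewrite !mxE.
    by rewrite big_split /= -!mulr_sumr w1 v1 !mulr1 addrC subrK.
  - rewrite !scaler_sumr -big_split; apply: eq_bigr => i _ /=.
    by rewrite !scalerA !mxE -scalerDl.
have si : (index x s < size s)%N by rewrite index_mem.
exists (\row_i (i == Ordinal si)%:R); split=> [i||].
- by rewrite mxE ler0n.
- rewrite (bigD1 (Ordinal si)) //= big1 ?addr0 ?mxE ?eqxx // => i /negPf ni.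
  by rewrite mxE ni.
- rewrite (bigD1 (Ordinal si)) //= big1 ?addr0 => [|i /negPf ni].
    by rewrite mxE eqxx scale1r nth_index.
  by rewrite mxE ni scale0r.
Qed.

(** The hull is the continuous image of the simplex of weights, a closed subset of a cube. *)
Lemma conv_hull_compact n (s : seq 'rV[R]_n) : compact (conv_hull [set x | x \in s]).
Proof.
pose S := [set w : 'rV[R]_(size s) | forall i, `[0, 1]%classic (w 0 i)]
  `&` [set w | \sum_i w 0 i = 1].
have -> : conv_hull [set x | x \in s] = (fun w => \sum_(i < size s) w 0 i *: s`_i) @` S.
  apply/seteqP; split=> x; last first.
    move=> [w [wS w1] <-]; apply/conv_hull_seqP; exists w; split=> // i.
    by have /= := wS i; rewrite in_itv => /andP [].
  move=> /conv_hull_seqP [w [w0 w1 ->]]; exists w => //; split=> // i /=.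
  rewrite in_itv /= w0 /= -w1 (bigD1 i) //= lerDl sumr_ge0 //.
apply: continuous_compact.
  apply: continuous_subspaceT; apply: continuous_sum_fun => i w.
  by apply: (@cvgZ _ _ _ (nbhs w) (nbhs_filter w)); [exact: coord_continuous|exact: cvg_cst].
apply: compact_closedI.
  by apply: (@rV_compact R _ (fun=> `[0, 1]%classic)) => i; apply: segment_compact.
apply: (@closed_comp _ _ (fun w : 'rV[R]_(size s) => \sum_i w 0 i) [set x | x = 1]).
  by move=> w _; apply: continuous_sum_fun => i; apply: coord_continuous.
exact: closed_eq.
Qed.

(** The functional is the inner product with [x0 - v], where [x0] is the point of the hull nearest
    to [v]: a generator on the wrong side of the hyperplane through [x0] would give a segment along
    which the distance decreases. *)
Lemma conv_hull_sep n (s : seq 'rV[R]_n) v : ~ conv_hull [set x | x \in s] v ->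
  exists c, forall x, x \in s -> pr c v < pr c x.
Proof.
move=> vs; case: (pselect (conv_hull [set x | x \in s] !=set0)) => [P0|Pe]; last first.
  exists 0 => x xs; case: Pe; exists x; exact: conv_hull_sub.
pose dot (x y : 'rV[R]_n) := \sum_i x 0 i * y 0 i.
pose f x := dot (x - v) (x - v).
have fc : continuous f.
  apply: continuous_sum_fun => i x.
  have h : continuous (fun x : 'rV[R]_n => (x - v) 0 i).
    under eq_fun do rewrite !mxE.
    by move=> y; apply: (@cvgB _ _ _ (nbhs y) (nbhs_filter y)); [apply: coord_continuous|apply: cvg_cst].
  by apply: (@cvgM _ _ (nbhs x) (nbhs_filter x)); apply: h.
have [x0 /set_mem x0P x0min] := EVT_min_rV P0 (@conv_hull_compact _ s) (continuous_subspaceT fc).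
pose a := x0 - v; exists a^T => y ys.
have prd z : pr a^T z = dot z a.
  by rewrite /pr mxE; apply: eq_bigr => i _; rewrite !mxE.
have dotDl x y' z : dot (x + y') z = dot x z + dot y' z.
  by rewrite /dot -big_split; apply: eq_bigr => i _; rewrite mxE mulrDl.
have dotZl t x z : dot (t *: x) z = t * dot x z.
  by rewrite /dot mulr_sumr; apply: eq_bigr => i _; rewrite mxE mulrA.
have dotC x z : dot x z = dot z x by apply: eq_bigr => i _; rewrite mulrC.
have dotE p q t : dot (p + t *: q) (p + t *: q) = dot p p + 2 * t * dot q p + t * t * dot q q.
  by rewrite dotDl dotZl (dotC p (p + _)) (dotC q (p + _)) !dotDl !dotZl (dotC p q); ring.
have dot0 x : 0 <= dot x x by apply: sumr_ge0 => i _; rewrite -expr2 sqr_ge0.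
have aa : 0 < dot a a.
  rewrite lt_neqAle dot0 andbT eq_sym; apply/eqP => /psumr_eq0P a0; apply: vs.
  suff -> : v = x0 by [].
  apply/esym/subr0_eq/matrixP => i j; rewrite ord1 [RHS]mxE.
  have /eqP := a0 (fun j _ => sqr_ge0 (a 0 j)) j isT.
  by rewrite mulf_eq0 orbb => /eqP.
pose d := y - x0.
have ad : 0 <= dot d a.
  rewrite leNgt; apply/negP => neg; have dd := dot0 d.
  (* This step length is at most 1 and satisfies [t * dot d d <= - dot d a], so that the change
     [t * (2 * dot d a + t * dot d d)] of the squared distance is negative. *)
  pose t := - dot d a / (dot d d - dot d a).
  have D0 : 0 < dot d d - dot d a by lra.
  have t0 : 0 < t by rewrite divr_gt0 // oppr_gt0.
  have t1 : t <= 1 by rewrite ler_pdivrMr //; lra.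
  have tD : t * (dot d d - dot d a) = - dot d a by rewrite divfK // gt_eqF.
  have xt : conv_hull [set x | x \in s] (t *: y + (1 - t) *: x0).
    apply: conv_hull_convex => //; first exact: conv_hull_sub.
    by rewrite (ltW t0).
  have := x0min _ (mem_set xt); rewrite /f.
  have -> : t *: y + (1 - t) *: x0 - v = a + t *: d.
    by rewrite /a /d; apply/matrixP => i j; rewrite !mxE; ring.
  rewrite -/a dotE => H.
  have : 0 <= t * (2 * dot d a + t * dot d d) by lra.
  by rewrite pmulr_rge0 //; nra.
have : dot (y - v) a = dot d a + dot a a by rewrite -dotDl /d /a addrA subrK.
move=> E; rewrite !prd.
have -> : dot y a = dot (y - v) a + dot v a by rewrite -dotDl subrK.
by lra.
Qed.

Lemma face_vertexE n (P : set 'rV[R]_n) c v : P v ->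
  (forall x, P x -> pr c v <= pr c x) -> (forall x, P x -> pr c x = pr c v -> x = v) ->
  face P [set v].
Proof.
move=> Pv cP cv; apply/facePr; exists c, (pr c v); split=> //.
by apply/seteqP; split=> x; [move=> ->|case=> Px /= /(cv _ Px)].
Qed.

(* Minkowski: discard redundant points until each one is exposed. *)
Lemma polytope_vertices n (P : set 'rV[R]_n) : polytope P ->
  exists2 s : seq 'rV[R]_n, P = conv_hull [set x | x \in s] &
    forall v, v \in s -> face P [set v].
Proof.
move=> [s ->]; have [m sm] := ubnP (size s); elim: m => // m IH in s sm *.
pose r v := [seq x <- s | x != v].
case: (pselect (exists2 v, v \in s & conv_hull [set x | x \in r v] v)) => [[v vs vr]|H].
  have -> : conv_hull [set x | x \in s] = conv_hull [set x | x \in r v].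
    apply/seteqP; split; last by apply: conv_hullS => x /=; rewrite mem_filter => /andP [].
    apply: conv_hull_min; first exact: conv_hull_convex.
    move=> x /= xs; have [-> //|xv] := eqVneq x v.
    by apply: conv_hull_sub; rewrite /= mem_filter xv.
  apply: IH; apply: leq_trans (_ : size s <= m)%N => //.
  rewrite size_filter -(count_predC (pred1 v) s) addnC -addn1 leq_add2l.
  by rewrite -has_count has_pred1.
exists s => // v vs; have : ~ conv_hull [set x | x \in r v] v by move=> vr; case: H; exists v.
move=> /conv_hull_sep [c cv].
have cv' x : x \in s -> pr c v <= pr c x.
  by move=> xs; have [->//|xv] := eqVneq x v; apply/ltW/cv; rewrite mem_filter xv.
apply: (@face_vertexE _ _ c); first exact: conv_hull_sub.
  exact: conv_hull_ge.
move=> x xP xv; have : conv_hull [set x | x \in s] `&` [set x | pr c x = pr c v] `<=` [set v].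
  rewrite conv_hull_face // => z; apply: conv_hull_min => [? ? t -> ->|y].
    by move=> _ /=; rewrite -scalerDl addrC subrK scale1r.
  move=> [/= ys yv]; have [//|yv'] := eqVneq y v.
  by have := cv y; rewrite mem_filter yv' ys yv ltxx => /(_ isT).
by apply.
Qed.

(** Convexity makes every direction of [P] a multiple of a difference of two points of [P].
    Injectivity on [P] therefore passes to the linear part on the direction space, where it can be
    inverted. *)
Lemma affine_linv n m (g : 'rV[R]_n -> 'rV[R]_m) (P : set 'rV[R]_n) :
  affine_map g -> is_conv P -> set_inj P g ->
  exists2 r, affine_map r & forall x, aff_hull P x -> r (g x) = x.
Proof.
move=> [f [b gE]] Pc ginj.
case: (pselect (P !=set0)) => [[x0 Px0]|P0]; last first.
  exists (fun=> 0); first by exists \0, 0 => x; rewrite addr0.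
  by move=> x /aff_hull_neq0.
set W := vspan [set y - x0 | y in P].
have WP w : w \in W -> exists p q s, [/\ P p, P q & w = s *: (p - q)].
  move=> /in_vspanP [k [y [c [/image_family [z [zP ->]] ->]]]].
  pose cp i := Num.max (c i) 0; pose cm i := Num.max (- c i) 0.
  have cpm i : c i = cp i - cm i.
    have [h|/ltW h] := lerP 0 (c i); rewrite /cp /cm.
      rewrite (_ : Num.max (c i) 0 = c i); last exact/max_idPl.
      by rewrite (_ : Num.max (- c i) 0 = 0) ?subr0 //; apply/max_idPr; rewrite oppr_le0.
    rewrite (_ : Num.max (c i) 0 = 0); last exact/max_idPr.
    by rewrite (_ : Num.max (- c i) 0 = - c i) ?sub0r ?opprK //; apply/max_idPl; rewrite oppr_ge0.
  have cp0 i : 0 <= cp i by rewrite le_max lexx orbT.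
  have cm0 i : 0 <= cm i by rewrite le_max lexx orbT.
  (* Dividing by [S] turns the positive and the negative part of the combination into convex
     combinations, the remaining weight going to [x0]; the 1 keeps [S] positive. *)
  pose Sp := \sum_i cp i; pose Sm := \sum_i cm i; pose S := Sp + Sm + 1.
  have Sp0 : 0 <= Sp by apply: sumr_ge0.
  have Sm0 : 0 <= Sm by apply: sumr_ge0.
  have S0 : 0 < S by rewrite /S; lra.
  have comb (d : 'I_k -> R) : (forall i, 0 <= d i) -> \sum_i d i <= S ->
      P (x0 + S^-1 *: \sum_i d i *: (z i - x0)).
    move=> d0 dS.
    pose zz (i : 'I_k.+1) := if unlift ord0 i is Some j then z j else x0.
    pose dd (i : 'I_k.+1) := if unlift ord0 i is Some j then d j / S else 1 - (\sum_j d j) / S.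
    have -> : x0 + S^-1 *: \sum_i d i *: (z i - x0) = \sum_i dd i *: zz i.
      rewrite big_ord_recl /dd /zz unlift_none.
      rewrite [X in _ = _ + X](eq_bigr (fun i => (d i / S) *: z i)); last first.
        by move=> i _; rewrite liftK.
      rewrite scaler_sumr [LHS](_ : _ = x0 + (\sum_i (d i / S) *: z i - (\sum_i d i / S) *: x0)).
        by rewrite scalerBl scale1r -mulr_suml [RHS]addrAC -addrA.
      congr (_ + _); rewrite scaler_suml -sumrB; apply: eq_bigr => i _.
      by rewrite scalerA scalerBr mulrC.
    apply: conv_comb => // [i|i|].
    - by rewrite /zz; case: unliftP.
    - rewrite /dd; case: unliftP => [j _|_]; first by rewrite divr_ge0 // ltW.
      by rewrite subr_ge0 ler_pdivrMr // mul1r.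
    - rewrite big_ord_recl /dd unlift_none.
      rewrite [X in _ + X](eq_bigr (fun i => d i / S)); last by move=> i _; rewrite liftK.
      by rewrite -mulr_suml subrK.
  exists (x0 + S^-1 *: \sum_i cp i *: (z i - x0)), (x0 + S^-1 *: \sum_i cm i *: (z i - x0)), S.
  have SpS : Sp <= S by rewrite /S; lra.
  have SmS : Sm <= S by rewrite /S; lra.
  split; [exact: comb|exact: comb|].
  rewrite opprD addrACA subrr add0r -scalerBr scalerA divff ?gt_eqF // scale1r -sumrB.
  by apply: eq_bigr => i _; rewrite -scalerBl -cpm.
have finj w : w \in W -> f w = 0 -> w = 0.
  move=> /WP [p [q [s [Pp Pq ->]]]]; rewrite linearZ /= => /eqP.
  rewrite scaler_eq0 => /orP [/eqP ->|]; first by rewrite scale0r.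
  rewrite linearB subr_eq0 => /eqP pq; rewrite (ginj p q) ?subrr ?scaler0 ?inE //.
  by rewrite !gE pq.
(* [h^-1] is a right inverse on the image of [h] only and may leave [W]; projecting back to [W],
   where [f] is injective, makes it a left inverse there. *)
pose h := (linfun f \o projv W)%VF.
have hE w : w \in W -> h w = f w by move=> wW; rewrite comp_lfunE projv_id // lfunE.
pose r0 := (projv W \o h^-1)%VF.
exists (fun y => r0 (y - g x0) + x0).
  exists r0, (- r0 (g x0) + x0) => y.
  by rewrite linearB addrA.
move=> x /(aff_hullP _ Px0) xW; rewrite !gE.
have -> : f x + b - (f x0 + b) = f (x - x0) by rewrite opprD addrACA subrr addr0 [RHS]linearB.
rewrite comp_lfunE; suff -> : projv W (h^-1%VF (f (x - x0))) = x - x0 by rewrite subrK.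
apply/subr0_eq; apply: finj; first by rewrite rpredB // memv_proj.
rewrite linearB /= -hE //; apply/eqP; rewrite subr_eq0; apply/eqP.
have := limg_lfunVK (memv_img h (memvf (x - x0))).
by rewrite {1}/h comp_lfunE lfunE.
Qed.

End Faces.

(** * Cones and their bottoms *)

Section Cones.
Context {R : realType}.

Lemma int_points0 n : int_points n (0 : 'rV[R]_n).
Proof. by move=> j; rewrite mxE rpred0. Qed.

Lemma int_pointsD n (x y : 'rV[R]_n) :
  int_points n x -> int_points n y -> int_points n (x + y).
Proof. by move=> xi yi j; rewrite mxE rpredD. Qed.

Lemma int_pointsN n (x : 'rV[R]_n) : int_points n x -> int_points n (- x).
Proof. by move=> xi j; rewrite mxE rpredN. Qed.

Lemma int_pointsB n (x y : 'rV[R]_n) :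
  int_points n x -> int_points n y -> int_points n (x - y).
Proof. by move=> xi yi; apply: int_pointsD => //; apply: int_pointsN. Qed.

Lemma int_pointsZ n a (x : 'rV[R]_n) :
  a \is a Num.int -> int_points n x -> int_points n (a *: x).
Proof. by move=> ai xi j; rewrite mxE rpredM. Qed.

Lemma int_points_sum n (I : Type) (r : seq I) (x : I -> 'rV[R]_n) :
  (forall i, int_points n (x i)) -> int_points n (\sum_(i <- r) x i).
Proof.
move=> xi; elim/big_ind : _ => //; [exact: int_points0|exact: int_pointsD].
Qed.

Definition intmx n m (M : 'M[R]_(n, m)) := forall i j, M i j \is a Num.int.

Lemma int_points_mulmx n m (M : 'M[R]_(n, m)) x :
  intmx M -> int_points n x -> int_points m (x *m M).
Proof. by move=> Mi xi j; rewrite mxE rpred_sum // => i _; rewrite rpredM. Qed.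

Lemma intmx_mul n m p (M : 'M[R]_(n, m)) (N : 'M[R]_(m, p)) :
  intmx M -> intmx N -> intmx (M *m N).
Proof. by move=> Mi Ni i j; rewrite mxE rpred_sum // => k _; rewrite rpredM. Qed.

Lemma intmx_points n m (M : 'M[R]_(n, m)) :
  (forall x, int_points n x -> int_points m (x *m M)) -> intmx M.
Proof.
move=> H i j; have := H (delta_mx 0 i); rewrite -rowE => /(_ _ j); rewrite mxE; apply.
by move=> k; rewrite mxE; case: (_ && _); rewrite ?rpred0 ?rpred1.
Qed.

Lemma pr_int n (c : 'cV[R]_n) x : intmx c -> int_points n x -> pr c x \is a Num.int.
Proof. by move=> ci xi; rewrite /pr mxE rpred_sum // => i _; rewrite rpredM. Qed.

Lemma int_ge1 (a : R) : a \is a Num.int -> 0 < a -> 1 <= a.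
Proof.
by move=> /intrP [z ->]; rewrite ltr0z => z0; rewrite ler1z -gtz0_ge1.
Qed.

(** * Lattice points, bottom functionals and bottom faces of one cone *)

Section OneCone.
Variables (n : nat) (C : set 'rV[R]_n).

Definition cone_hull k (x : 'I_k -> 'rV[R]_n) : set 'rV[R]_n :=
  [set y | exists c : 'I_k -> R, (forall i, 0 <= c i) /\ y = \sum_i c i *: x i].

Lemma cone_hullD k (x : 'I_k -> 'rV[R]_n) y z :
  cone_hull x y -> cone_hull x z -> cone_hull x (y + z).
Proof.
move=> [c [c0 ->]] [d [d0 ->]]; exists (fun i => c i + d i); split.
  by move=> i; rewrite addr_ge0.
by rewrite -big_split; apply: eq_bigr => i _; rewrite scalerDl.
Qed.

Lemma cone_hullZ k (x : 'I_k -> 'rV[R]_n) a y :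
  0 <= a -> cone_hull x y -> cone_hull x (a *: y).
Proof.
move=> a0 [c [c0 ->]]; exists (fun i => a * c i); split.
  by move=> i; rewrite mulr_ge0.
by rewrite scaler_sumr; apply: eq_bigr => i _; rewrite scalerA.
Qed.

Lemma cone_hull_gen k (x : 'I_k -> 'rV[R]_n) i : cone_hull x (x i).
Proof.
exists (fun j => (j == i)%:R); split=> [j|]; first exact: ler0n.
rewrite (bigD1 i) //= eqxx scale1r big1 ?addr0 // => j /negPf ->.
by rewrite scale0r.
Qed.

Lemma cone_hull_min k (x : 'I_k -> 'rV[R]_n) (D : set 'rV[R]_n) : D 0 ->
  (forall y z, D y -> D z -> D (y + z)) -> (forall a y, 0 <= a -> D y -> D (a *: y)) ->
  (forall i, D (x i)) -> cone_hull x `<=` D.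
Proof.
move=> D0 DD DZ Dx y [c [c0 ->]].
by elim/big_ind : _ => // i _; apply: DZ.
Qed.

Lemma cone_intro k (x : 'I_k -> 'rV[R]_n) : (forall i, int_points n (x i)) ->
  (forall y, cone_hull x y -> cone_hull x (- y) -> y = 0) -> C = cone_hull x -> cone C.
Proof.
move=> xi xp ->; split; first by exists k, x.
move=> U UC; apply/eqP; rewrite dimv_eq0 -subv0; apply/subvP => v vU.
by rewrite (xp v) ?mem0v //; apply: UC; rewrite ?rpredN.
Qed.

Hypothesis Cc : cone C.

Lemma cone_gens : exists k (x : 'I_k -> 'rV[R]_n),
  (forall i, int_points n (x i)) /\ C = cone_hull x.
Proof. by have [] := Cc. Qed.

Lemma coneD y z : C y -> C z -> C (y + z).
Proof. by have [k [x [_ ->]]] := cone_gens; apply: cone_hullD. Qed.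

Lemma coneZ a y : 0 <= a -> C y -> C (a *: y).
Proof. by have [k [x [_ ->]]] := cone_gens; apply: cone_hullZ. Qed.

Lemma cone0 : C 0.
Proof.
have [k [x [_ ->]]] := cone_gens; exists (fun=> 0); split=> //.
by rewrite big1 // => i _; rewrite scale0r.
Qed.

Lemma cone_convex : is_conv C.
Proof.
move=> x y t Cx Cy /andP [t0 t1]; apply: coneD; apply: coneZ => //.
by rewrite subr_ge0.
Qed.

Lemma cone_pointed y : C y -> C (- y) -> y = 0.
Proof.
move=> Cy CNy; have [_ /(_ <[y]>%VS)] := Cc.
rewrite dim_vline => H; apply/eqP; have : (y != 0) = 0%N :> nat.
  apply: H => v /vlineP [a ->]; have [a0|/ltW a0] := lerP 0 a; first exact: coneZ.
  by rewrite -[y]opprK scalerN -scaleNr; apply: coneZ; rewrite // oppr_ge0.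
by case: eqP.
Qed.

Definition pts : set 'rV[R]_n := lattice_monoid C `\ 0.

Lemma lattice_monoid0 : lattice_monoid C 0.
Proof. by split; [exact: cone0|exact: int_points0]. Qed.

Lemma lattice_monoidD x y : lattice_monoid C x -> lattice_monoid C y -> lattice_monoid C (x + y).
Proof. by move=> [Cx xi] [Cy yi]; split; [exact: coneD|exact: int_pointsD]. Qed.

Lemma lattice_monoidMn x m : lattice_monoid C x -> lattice_monoid C (x *+ m).
Proof.
move=> Cx; elim: m => [|m IH]; first by rewrite mulr0n; exact: lattice_monoid0.
by rewrite mulrS; apply: lattice_monoidD.
Qed.

Lemma ptsP x : pts x <-> [/\ C x, int_points n x & x != 0].
Proof.
split=> [[[Cx xi] /eqP x0]|[Cx xi /eqP x0]]; [by []|by split].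
Qed.

Lemma ptsMn x m : pts x -> pts (x *+ m.+1).
Proof.
move=> [/(lattice_monoidMn m.+1) xm /= x0]; split=> //=.
by rewrite -scaler_nat => /eqP; rewrite scaler_eq0 pnatr_eq0 /= => /eqP.
Qed.

Definition tight (c : 'cV[R]_n) : set 'rV[R]_n := pts `&` [set x | pr c x = 1].

(* The functionals cutting out the bottom facets, normalized to 1 on them. *)
Definition bottom_functional (c : 'cV[R]_n) : Prop :=
  [/\ tight c !=set0, forall x, pts x -> 1 <= pr c x
    & forall d, (forall x, tight c x -> pr d x = 0) -> forall x, pts x -> pr d x = 0].

Lemma int_box N : exists s : seq 'rV[R]_n, forall x, int_points n x ->
  (forall j, `|x 0 j| <= N%:R) -> x \in s.
Proof.
exists [seq \row_j ((f : {ffun 'I_n -> 'I_(N + N).+1}) j)%:R - const_mx N%:R | f : {ffun 'I_n -> 'I_(N + N).+1}].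
move=> x xi xN; pose z j := Num.floor (x 0 j).
have zE j : x 0 j = (z j)%:~R by rewrite floorK //.
have zN j : (0 <= z j + N%:Z <= (N + N)%:Z).
  have := xN j; rewrite zE -intr_norm -[N%:R]/((Posz N)%:~R) ler_int; lia.
apply/mapP; exists [ffun j => inord (absz (z j + N%:Z))]; first by rewrite mem_enum.
apply/matrixP => i j; rewrite ord1 !mxE ffunE inordK; last by have := zN j; lia.
rewrite zE; have := zN j => /andP [z0 _].
have -> : (absz (z j + N%:Z))%:R = (z j + N%:Z)%:~R :> R by rewrite pmulrn gez0_abs.
by rewrite intrD addrK.
Qed.

(** Gordan's lemma: after subtracting the integral parts of the coefficients, a lattice point of the
    cone becomes a lattice point with coefficients in [0, 1], which lies in a fixed box. [H]
    collects the nonzero lattice points of the cone in that box, including the nonzero generators of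
    the cone. *)
Lemma gordan : exists H : seq 'rV[R]_n, (forall h, h \in H -> pts h) /\
  forall x, lattice_monoid C x -> exists s : seq 'rV[R]_n,
    (forall y, y \in s -> y \in H) /\ x = \sum_(y <- s) y.
Proof.
have [k [g [gi CE]]] := cone_gens.
pose B := \sum_i \sum_j `|g i 0 j|; pose N := (Num.truncn B).+1.
have B0 : 0 <= B by apply: sumr_ge0 => i _; apply: sumr_ge0.
have BN : B <= N%:R by apply/ltW/truncnS_gt.
have gB j : \sum_i `|g i 0 j| <= B.
  rewrite /B exchange_big (bigD1 j) //= lerDl sumr_ge0 // => l _.
  exact: sumr_ge0.
have [s sP] := int_box N; pose H := [seq h <- s | `[< pts h >]].
have HP h : h \in H -> pts h by rewrite mem_filter => /andP [/asboolP].
exists H; split=> //.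
pose Gen (x : 'rV[R]_n) := exists s : seq 'rV[R]_n,
    (forall y, y \in s -> y \in H) /\ x = \sum_(y <- s) y.
have Gen0 : Gen 0 by exists [::]; split=> //; rewrite big_nil.
have GenD x y : Gen x -> Gen y -> Gen (x + y).
  move=> [sx [sxH ->]] [sy [syH ->]]; exists (sx ++ sy); rewrite big_cat; split=> // z.
  by rewrite mem_cat => /orP [/sxH|/syH].
have GenH x : C x -> int_points n x -> (forall j, `|x 0 j| <= N%:R) -> Gen x.
  move=> Cx xi xN; have [->//|x0] := eqVneq x 0.
  exists [:: x]; rewrite big_seq1; split=> // y; rewrite inE => /eqP ->.
  by rewrite mem_filter sP // andbT; apply/asboolP/ptsP.
have GenM x m : Gen x -> Gen (x *+ m).
  by move=> Gx; elim: m => [|m IH]; rewrite ?mulr0n // mulrS; apply: GenD.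
have Geng i : Gen (g i).
  apply: GenH => // [|j]; first by rewrite CE; apply: cone_hull_gen.
  apply: le_trans BN; apply: le_trans (gB j).
  by rewrite (bigD1 i) //= lerDl sumr_ge0.
move=> x [Cx xi]; have := Cx; rewrite {1}CE => -[c [c0 xE]].
have tc i := truncn_itv (c0 i).
pose q := \sum_i g i *+ Num.truncn (c i).
have qi : int_points n q.
  by apply: int_points_sum => i; rewrite -scaler_nat; apply: int_pointsZ; rewrite ?rpred_nat.
have rE : x - q = \sum_i (c i - (Num.truncn (c i))%:R) *: g i.
  rewrite xE -sumrB; apply: eq_bigr => i _.
  by rewrite scalerBl scaler_nat.
rewrite -[x](subrK q); apply: (GenD); last first.
  by apply: (big_ind Gen Gen0 GenD) => i _; apply: GenM.
have fc i : 0 <= c i - (Num.truncn (c i))%:R <= 1.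
  have /andP [t1 t2] := tc i; rewrite subr_ge0 t1 /= lerBlDl.
  by apply: ltW; rewrite -natr1 in t2.
apply: GenH.
- rewrite CE rE; exists (fun i => c i - (Num.truncn (c i))%:R); split=> // i.
  by have /andP [] := fc i.
- exact: int_pointsB.
- move=> j; apply: le_trans BN; apply: le_trans (gB j); rewrite rE summxE.
  apply: le_trans (ler_norm_sum _ _ _) _; apply: ler_sum => i _.
  rewrite mxE normrM; have /andP [f0 f1] := fc i.
  by rewrite (ger0_norm f0) ler_piMl.
Qed.

(** A sum of two or more generators has value at least 2, and the empty sum has value 0. *)
Lemma tight_in_gens (H : seq 'rV[R]_n) c :
  (forall x, lattice_monoid C x -> exists s : seq 'rV[R]_n,
    (forall y, y \in s -> y \in H) /\ x = \sum_(y <- s) y) ->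
  (forall h, h \in H -> 1 <= pr c h) -> forall x, tight c x -> x \in H.
Proof.
move=> HG c1 x [[xM /= _] x1]; have [[|y [|z s]] [sH xE]] := HG x xM.
- by move: x1; rewrite xE big_nil linear0 => /esym/eqP; rewrite oner_eq0.
- by rewrite xE big_seq1; apply: sH; rewrite mem_head.
- have s0 : 0 <= pr c (\sum_(j <- s) j).
    rewrite linear_sum big_seq sumr_ge0 // => j js.
    by apply: le_trans (c1 j _); rewrite ?ler01 // sH // !inE js !orbT.
  have y1 : 1 <= pr c y by apply/c1/sH; rewrite !inE eqxx.
  have z1 : 1 <= pr c z by apply/c1/sH; rewrite !inE eqxx !orbT.
  by move: x1; rewrite xE !big_cons !linearD /=; lra.
Qed.

Lemma gens_ge1 (H : seq 'rV[R]_n) c :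
  (forall x, lattice_monoid C x -> exists s : seq 'rV[R]_n,
    (forall y, y \in s -> y \in H) /\ x = \sum_(y <- s) y) ->
  (forall h, h \in H -> 1 <= pr c h) -> forall x, pts x -> 1 <= pr c x.
Proof.
move=> HG c1 x [xM /= x0]; have [[|y s] [sH xE]] := HG x xM.
  by case: x0; rewrite xE big_nil.
have s0 : 0 <= pr c (\sum_(j <- s) j).
  rewrite linear_sum big_seq sumr_ge0 // => j js.
  by apply: le_trans (c1 j _); rewrite ?ler01 // sH // !inE js !orbT.
have y1 : 1 <= pr c y by apply/c1/sH; rewrite !inE eqxx.
by rewrite xE big_cons linearD /=; lra.
Qed.

Lemma hull_tight c : (forall x, pts x -> 1 <= pr c x) ->
  conv_hull pts `&` [set x | pr c x = 1] = conv_hull (tight c).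
Proof. exact: conv_hull_face. Qed.

(** The list [H] is chosen before [c]. This uniformity makes the bottom functionals of a
    full-dimensional cone and the bottom faces finite in number. *)
Lemma tight_seq : exists H : seq 'rV[R]_n, forall c, (forall x, pts x -> 1 <= pr c x) ->
  tight c = [set x | x \in [seq h <- H | pr c h == 1]].
Proof.
have [H [Hp HG]] := gordan; exists H => c c1.
apply/seteqP; split=> x; last by rewrite /= mem_filter => /andP [/eqP x1 /Hp].
move=> xt; have xH : x \in H by apply: (tight_in_gens HG) xt => h /Hp /c1.
by rewrite /= mem_filter xH andbT; case: xt => _ /eqP.
Qed.

(* The ratio test of the simplex method: tilt the functional until it is tight at more
   generators. *)
Lemma bottom_functional_above c : (forall x, pts x -> 1 <= pr c x) -> tight c !=set0 ->
  exists2 c', bottom_functional c' & tight c `<=` tight c'.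
Proof.
have [H [Hp HG]] := gordan.
pose mu c := count (fun h => pr c h != 1) H.
have [m cm] := ubnP (mu c); elim: m => // m IH in c cm * => c1 c0.
case: (pselect (bottom_functional c)) => [bc|nbc]; first by exists c.
have [d [dt [x0 x0p dx0]]] : exists d, (forall x, tight c x -> pr d x = 0) /\
    exists2 x, pts x & pr d x != 0.
  apply: contrapT => nd; apply: nbc; split=> // d dt x xp.
  by apply: contrapT => /eqP dx; apply: nd; exists d; split=> //; exists x.
(* A functional that vanishes at all generators vanishes on all of [pts], so [d] is nonzero at some
   generator, and [d] or its negative is negative there. *)
have [e [et [h0 h0H eh0]]] : exists e, (forall x, tight c x -> pr e x = 0) /\
    exists2 h, h \in H & pr e h < 0.
  case: (pselect (exists2 h, h \in H & pr d h != 0)) => [[h hH dh]|nh].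
    case: (ltrP (pr d h) 0) => dh0; first by exists d; split=> //; exists h.
    exists (- d); split=> [x /dt|]; first by rewrite prNc => ->; rewrite oppr0.
    by exists h => //; rewrite prNc oppr_lt0 lt_neqAle eq_sym dh.
  have [s [sH xE]] := HG x0 x0p.1; case/eqP: dx0.
  rewrite xE linear_sum big_seq big1 // => y /sH yH.
  by apply: contrapT => /eqP dy; apply: nh; exists y.
pose ratio h := (pr c h - 1) / - pr e h.
pose Hneg := [seq h <- H | pr e h < 0].
have i0 : (index h0 Hneg < size Hneg)%N by rewrite index_mem mem_filter eh0.
case: (@arg_minP _ _ _ (Ordinal i0) xpredT (fun i => ratio Hneg`_i) isT) => i _ imin.
set h1 := Hneg`_i in imin.
have /[!mem_filter] /andP [eh1 h1H] : h1 \in Hneg by apply: mem_nth.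
pose t := ratio h1; pose c' := c + t *: e.
have t0 : 0 <= t by rewrite divr_ge0 // ?oppr_ge0 ?(ltW eh1) // subr_ge0 c1 //; apply: Hp.
have prE x : pr c' x = pr c x + t * pr e x by rewrite prDc prZc.
have h1t : pr c' h1 = 1.
  by rewrite prE /t /ratio invrN mulrN mulNr divfK ?lt_eqF //; ring.
have c'1 h : h \in H -> 1 <= pr c' h.
  move=> hH; have ch := c1 h (Hp h hH); rewrite prE; case: (ltrP (pr e h) 0) => eh; last first.
    by have := mulr_ge0 t0 eh; lra.
  have hN : h \in Hneg by rewrite mem_filter eh.
  have hi : (index h Hneg < size Hneg)%N by rewrite index_mem.
  have := imin (Ordinal hi) isT; rewrite /= nth_index // -/t /ratio.
  by rewrite ler_pdivlMr ?oppr_gt0 //; lra.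
have c'p := gens_ge1 HG c'1.
have tt' : tight c `<=` tight c'.
  by move=> x [xp x1]; split=> //=; rewrite prE et // x1 mulr0 addr0.
have [||c'' bc'' tc''] := IH c' _ c'p.
(* Tight generators stay tight, and [h1], where the ratio is smallest, becomes tight: the count of
   slack generators drops. *)
- rewrite -ltnS; apply: leq_trans cm; rewrite /mu ltnS.
  have e1 : pr c h1 != 1.
    by apply/eqP => e1; move: eh1; rewrite et ?ltxx //; split=> //; apply: Hp.
  have sub : subpred (fun h => (h \in H) && (pr c' h != 1)) (fun h => pr c h != 1).
    move=> h /andP [hH]; apply: contraNN => /eqP ch.
    by have [_ ->] : tight c' h by apply: tt'; split=> //; apply: Hp.
  rewrite (@eq_in_count _ _ (fun h => (h \in H) && (pr c' h != 1))); last by move=> h /= ->.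
  rewrite !(seq.permP (perm_to_rem h1H)) /=.
  by rewrite h1t eqxx e1 andbF add0n add1n ltnS; apply: sub_count.
- by have [x /tt' xt] := c0; exists x.
by exists c'' => //; apply: subset_trans tt' tc''.
Qed.

Lemma vspan_conv_hull (A : set 'rV[R]_n) : vspan (conv_hull A) = vspan A.
Proof.
apply/eqP; rewrite eqEsubv (vspanS (@conv_hull_sub _ _ A)) andbT.
apply: vspan_sub => x [k [y [c [yA _ _ ->]]]].
by apply: memv_suml => i _; apply/memvZ/mem_vspan.
Qed.

Lemma vspan_pts : vspan pts = vspan C.
Proof.
apply/eqP; rewrite eqEsubv; apply/andP; split; first by apply: vspanS => x /ptsP [].
have [k [g [gi CE]]] := cone_gens; apply: vspan_sub => x; rewrite {1}CE => -[c [_ ->]].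
apply: memv_suml => i _; apply: memvZ; have [->|g0] := eqVneq (g i) 0; first exact: mem0v.
by apply/mem_vspan/ptsP; split=> //; rewrite CE; apply: cone_hull_gen.
Qed.

(** A facet is given by [m <= pr c]. If [c] were negative at a lattice point, multiples of this
    point would fall below [m]; if [m] were 0, multiples of a point of the facet would stay in it,
    against compactness. So [m] is positive and [c] can be rescaled to the value 1; comparing
    dimensions then gives the spanning condition. *)
Lemma bottom_facetP F : bottom_facet C F <->
  exists2 c, bottom_functional c & F = conv_hull (tight c).
Proof.
(* The affine combination is 2 times [x] minus 1 times [x *+ 2]; hence dimensions of the hull of
   [pts] are those of linear spans. *)
have aff0 x : pts x -> aff_hull (conv_hull pts) 0.
  move=> xp; exists 2, (fun i : 'I_2 => if i == ord0 then x else x *+ 2),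
    (fun i : 'I_2 => if i == ord0 then 2 else -1); split.
  - move=> i; apply: conv_hull_sub; case: ifP => // _; exact: ptsMn.
  - by rewrite !big_ord_recl big_ord0 /=; ring.
  - rewrite !big_ord_recl big_ord0 /= addr0 scaleN1r -[X in _ - X]scaler_nat.
    by rewrite subrr.
have hE c : (forall x, tight c x -> pr c x = 1) by move=> x [].
split=> [[[/facePr [c [m [cm FE]]] [k [Fk Nk]]] Fcomp]|[c [t0 c1 cd] ->]]; last first.
  have [x0 x0t] := t0; split; last first.
    by have [H ->] := tight_seq => //; apply: conv_hull_compact.
  split; first by apply/facePr; exists c, 1; split; [exact: conv_hull_ge|rewrite hull_tight].
  exists (\dim (vspan (tight c))).-1; split.
    apply/(has_dim_height (f := c)) => [x|].
      by apply: conv_hull_eq; apply: hE.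
    rewrite vspan_conv_hull prednK // lt0n dimv_eq0; apply: contra_eq_neq (hE c x0 x0t).
    move=> t00; have := mem_vspan x0t; rewrite t00 memv0 => /eqP ->.
    by rewrite linear0 eq_sym oner_eq0.
  have ve : vspan pts = vspan (tight c).
    apply/eqP; rewrite eqEsubv; apply/andP; split; first exact/vspan_dualP.
    by apply: vspanS => x [].
  apply/has_dim_linear; first exact: aff0 x0t.1.
  rewrite vspan_conv_hull ve prednK // lt0n dimv_eq0; apply: contra_eq_neq (hE c x0 x0t).
  move=> t00; have := mem_vspan x0t; rewrite t00 memv0 => /eqP ->.
  by rewrite linear0 eq_sym oner_eq0.
have cm' x : pts x -> m <= pr c x by move=> xp; apply/cm/conv_hull_sub.
have cpos x : pts x -> 0 <= pr c x.
  move=> xp; rewrite leNgt; apply/negP => neg.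
  have lt : 0 <= `|m| / - pr c x by rewrite divr_ge0 // oppr_ge0 ltW.
  have /andP [_ T] := truncn_itv lt; have := cm' _ (ptsMn (Num.truncn (`|m| / - pr c x)) xp).
  rewrite linearMn -mulr_natr; move: T; rewrite ltr_pdivrMr ?oppr_gt0 // => T.
  have : - m <= `|m| by rewrite -normrN ler_norm.
  by rewrite mulrC; lra.
have Ft : F = conv_hull (pts `&` [set x | pr c x = m]) by rewrite FE conv_hull_face.
have [y [yp ym]] : (pts `&` [set x | pr c x = m]) !=set0.
  by have [x] := has_dim_nonempty Fk; rewrite Ft => /conv_hull_aff/aff_hull_neq0.
have m0 : 0 < m.
  rewrite lt_neqAle -{2}ym cpos // andbT; apply/eqP => m0.
  have [M [_ HM]] := compact_bounded Fcomp.
  have yF j : F (y *+ j.+1).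
    by rewrite Ft; apply: conv_hull_sub; split; [exact: ptsMn|rewrite /= linearMn /= ym -m0 mul0rn].
  have ny : 0 < `|y| by rewrite normr_gt0; case/ptsP: yp.
  have MM : M < `|M| + 1 by have := ler_norm M; lra.
  have lt : 0 <= (`|M| + 1) / `|y| by rewrite divr_ge0 // addr_ge0.
  have /andP [_] := truncn_itv lt; rewrite ltr_pdivrMr // => T.
  have := HM _ MM _ (yF (Num.truncn ((`|M| + 1) / `|y|))).
  by rewrite /= normrMn -mulr_natl leNgt T.
have prE x : pr (m^-1 *: c) x = m^-1 * pr c x by rewrite prZc.
have tE : tight (m^-1 *: c) = pts `&` [set x | pr c x = m].
  apply/seteqP; split=> x [xp] /= H; split=> //=; last by rewrite prE H mulVf // gt_eqF.
  by move: H; rewrite prE => /(congr1 ( *%R m)); rewrite mulVKf ?gt_eqF // mulr1.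
exists (m^-1 *: c); last by rewrite Ft tE.
have c1 x : pts x -> 1 <= pr (m^-1 *: c) x.
  by move=> /cm' mx; rewrite prE mulrC ler_pdivlMr // mul1r.
split=> //; first by exists y; rewrite tE.
apply/vspan_dualP.
have sub : (vspan (tight (m^-1 *: c)) <= vspan pts)%VS by apply: vspanS => x [].
have /eqP -> // : vspan (tight (m^-1 *: c)) == vspan pts.
rewrite eqEdim sub; move/(has_dim_linear _ (aff0 y yp)) : Nk; rewrite vspan_conv_hull => ->.
rewrite tE -vspan_conv_hull -Ft; suff -> : \dim (vspan F) = k.+1 by rewrite ltnS leqnn.
apply/(has_dim_height (f := m^-1 *: c)) => // x; rewrite Ft -tE.
by apply: conv_hull_eq; apply: hE.
Qed.

(** The difference [c' - c] vanishes on [tight c], hence by the spanning condition on all lattice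
    points. No bottom facet is thus properly contained in another. *)
Lemma bottom_functional_inj c c' : bottom_functional c -> bottom_functional c' ->
  conv_hull (tight c) `<=` conv_hull (tight c') -> tight c = tight c'.
Proof.
move=> [c0 c1 cd] [c0' c1' cd'] sub.
have H x : pts x -> pr (c' - c) x = 0.
  move: x; apply: cd => x xt; rewrite prBc; have [_ ->] := xt.
  apply/eqP; rewrite subr_eq0; apply/eqP.
  by apply: conv_hull_eq (sub _ (conv_hull_sub xt)) => y [].
by apply/seteqP; split=> x [xp x1]; split=> //=; have /eqP := H x xp;
  rewrite prBc subr_eq0 => /eqP; rewrite x1.
Qed.

(** A bottom functional is determined by which members of the fixed list are tight. Full dimension
    is what makes equal values on the cone give equal functionals. *)
Lemma finite_bottom_functional : vspan C = fullv -> finite_set bottom_functional.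
Proof.
move=> Cf; have [H HP] := tight_seq.
pose A c := [set i : 'I_(size H) | pr c H`_i == 1]%SET.
have Ainj c c' : bottom_functional c -> bottom_functional c' -> A c = A c' -> c = c'.
  move=> [c0 c1 cd] [c0' c1' cd'] AE; have tE : tight c = tight c'.
    rewrite !HP //; apply/seteqP; split=> x /=; rewrite !mem_filter => /andP [x1 xH];
      rewrite xH andbT; have xi := xH; rewrite -index_mem in xi;
      have /setP /(_ (Ordinal xi)) := AE; rewrite !inE /= nth_index // x1.
    - by move=> <-.
    - by move=> ->.
  apply/eqP; rewrite -subr_eq0; apply/eqP/pr_eq0 => x.
  have : x \in vspan pts by rewrite vspan_pts Cf memvf.
  apply: pr_vspan; apply: cd => y yt; rewrite prBc; have [_ ->] := yt.
  by rewrite tE in yt; have [_ ->] := yt; rewrite subrr.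
pose g (B : {set 'I_(size H)}) := xget 0 [set c | bottom_functional c /\ A c = B].
apply: (@sub_finite_set _ _ (g @` [set: {set 'I_(size H)}])).
  move=> c bc; exists (A c) => //; rewrite /g; case: xgetP => [d _ [bd Ad]|/(_ c)[]//].
  exact: Ainj.
by apply: finite_image; apply: finite_finset.
Qed.

Notation bottom_face := (faces (bottom_complex C)).

Lemma bottom_face_polytope G : bottom_face G -> polytope G.
Proof.
move=> [->|[F /bottom_facetP [c [_ c1 _] ->]]].
  by exists [::]; apply/seteqP; split=> // x /conv_hull_aff/aff_hull_neq0 [].
by apply: face_polytope; have [H ->] := tight_seq => //; exists [seq h <- H | pr c h == 1].
Qed.

Lemma bottom_face_face G E : bottom_face G -> face G E -> bottom_face E.
Proof.
move=> [->|[F FC FG]] GE; first by left; apply/seteqP; split=> // x /(face_sub GE).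
right; exists F => //; apply: face_trans FG GE; apply: bottom_face_polytope.
by right; exists F => //; apply: face_refl.
Qed.

Lemma bottom_face_sub G : bottom_face G -> G `<=` conv_hull pts.
Proof.
move=> [-> //|[F /bottom_facetP [c [_ c1 _] ->] FG] x /(face_sub FG)].
by apply: conv_hullS => y [].
Qed.

Lemma hull_pts_sub : conv_hull pts `<=` C.
Proof. by apply: conv_hull_min; [exact: cone_convex|move=> x /ptsP []]. Qed.

(** The functional of the bottom facet [F] containing [E2] is at least 1 on [E1], so it cuts out the
    face of points of [E1] in [F]; the functional of [E2] then cuts out a face of that face. *)
Lemma bottom_face_setI E1 E2 : bottom_face E1 -> bottom_face E2 -> face E1 (E1 `&` E2).
Proof.
move=> b1 [->|[F /bottom_facetP [c [_ c1 _] FE] FG]].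
  by rewrite setI0; exact: face_set0.
have cN := conv_hull_ge c1; have cE1 x : E1 x -> 1 <= pr c x by move/(bottom_face_sub b1)/cN.
have f1 : face E1 (E1 `&` F).
  apply/facePr; exists c, 1; split=> //; rewrite FE -hull_tight //.
  by apply/seteqP; split=> x [E1x]; [case|split=> //; split=> //; apply: (bottom_face_sub b1)].
apply: face_trans (bottom_face_polytope b1) f1 _.
move: FG => /facePr [d [e [de ->]]]; apply/facePr; exists d, e; split=> [x [_ /de]//|].
by apply/seteqP; split=> x [Ex]; [case=> Fx; split|case: Ex => ?; split].
Qed.

Lemma finite_bottom_face : finite_set bottom_face.
Proof.
have [H HP] := tight_seq.
pose g (A : {set 'I_(size H)}) : set 'rV[R]_n :=
  conv_hull [set x | exists2 i : 'I_(size H), i \in A & x = H`_i].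
apply: (@sub_finite_set _ _ ([set set0] `|` g @` [set: {set 'I_(size H)}])); last first.
  rewrite finite_setU; split; first exact: finite_set1.
  by apply: finite_image; apply: finite_finset.
move=> G [->|[F /bottom_facetP [c [_ c1 _] ->]]]; first by left.
rewrite (HP c c1) => /face_seq [d [m [_ _ ->]]]; right.
exists [set i : 'I_(size H) | (pr c H`_i == 1) && (pr d H`_i == m)]%SET => //.
congr conv_hull; apply/seteqP; split=> x /=.
  by move=> [i]; rewrite inE => /andP [h1 h2] ->; rewrite !mem_filter h2 h1 mem_nth.
rewrite !mem_filter => /and3P [h2 h1 xH]; have xi := xH; rewrite -index_mem in xi.
by exists (Ordinal xi); rewrite ?inE /= nth_index // h1.
Qed.

End OneCone.
End Cones.

(** * Gluing two cones *)

Section Gluing.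
Context {R : realType}.

(** Only generators lying on the face contribute to its points; the others are replaced by 0, which
    keeps the index type. *)
Lemma cone_face n (C : set 'rV[R]_n) t : cone C -> (forall x, C x -> 0 <= pr t x) ->
  cone (C `&` [set x | pr t x = 0]).
Proof.
move=> Cc tC; have [k [g [gi CE]]] := cone_gens Cc.
pose g' i := if pr t (g i) == 0 then g i else 0.
have g'F i : (C `&` [set x | pr t x = 0]) (g' i).
  rewrite /g'; case: eqP => ti; last by split; [exact: cone0|rewrite /= linear0].
  by split=> //; rewrite CE; apply: cone_hull_gen.
have FE : C `&` [set x | pr t x = 0] = cone_hull g'.
  apply/seteqP; split=> x; last first.
    move: x; apply: cone_hull_min => //.
    - by split; [exact: cone0|rewrite /= linear0].
    - move=> y z [Cy ty] [Cz tz]; split; first exact: coneD.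
      by rewrite /= linearD /= ty tz addr0.
    - move=> a y a0 [Cy ty]; split; first exact: coneZ.
      by rewrite /= linearZ /= ty mulr0.
  rewrite {1}CE => -[[c [c0 ->]]] /=; rewrite linear_sum => /psumr_eq0P H.
  exists c; split=> //; apply: eq_bigr => i _; rewrite /g'; case: eqP => // ti.
  have : pr t (c i *: g i) = 0.
    apply: H => // j _; rewrite linearZ mulr_ge0 // tC // CE; exact: cone_hull_gen.
  by rewrite linearZ /= => /eqP; rewrite mulf_eq0 => /orP [/eqP ->|/eqP //]; rewrite scaler0 scale0r.
apply: (cone_intro _ _ FE).
- by move=> i; rewrite /g'; case: ifP => // _; apply: int_points0.
- by rewrite -FE => y [Cy _] [CNy _]; apply: cone_pointed CNy.
Qed.

(** Relative interior of a cone, in the form of an absorption property: every vector of the span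
    enters [F] after a long enough push along [v]. *)
Definition deep {n} (F : set 'rV[R]_n) (v : 'rV[R]_n) :=
  forall z, z \in vspan F -> exists K, forall s, K <= s -> F (z + s *: v).

(** The sum of the generators works, since adding a multiple of it raises all coefficients at
    once. *)
Lemma deep_ex n (F : set 'rV[R]_n) : cone F -> exists2 v, lattice_monoid F v & deep F v.
Proof.
move=> Fc; have [k [g [gi FE]]] := cone_gens Fc.
have gF i : F (g i) by rewrite FE; apply: cone_hull_gen.
exists (\sum_i g i).
  by apply: big_ind => [|x y|i _]; [exact: lattice_monoid0|exact: lattice_monoidD|split].
apply: vspan_ind => [|x y [K HK] [L HL]|a x].
- exists 0 => s s0; rewrite add0r; apply: coneZ => //.
  by apply: big_ind => [|x y|i _] //; [exact: cone0|exact: coneD].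
- exists (K + L) => s Ks.
  have -> : x + y + s *: \sum_i g i = (x + K *: \sum_i g i) + (y + (s - K) *: \sum_i g i).
    by rewrite addrACA -scalerDl addrC [K + _]addrC subrK addrC.
  by apply: coneD => //; [exact: HK|apply: HL; lra].
- rewrite {1}FE => -[c [c0 ->]]; exists (\sum_i `|a * c i|) => s Ks.
  rewrite !scaler_sumr -big_split FE /=; exists (fun i => a * c i + s); split; last first.
    by apply: eq_bigr => i _; rewrite scalerDl scalerA.
  move=> i; have : `|a * c i| <= s.
    by apply: le_trans Ks; rewrite (bigD1 i) //= lerDl sumr_ge0.
  by have := ler_norm (- (a * c i)); rewrite normrN; lra.
Qed.

Lemma deep_pos n (F : set 'rV[R]_n) v l : cone F -> deep F v ->
  (forall x, F x -> 0 <= pr l x) -> (exists2 x, F x & pr l x != 0) -> 0 < pr l v.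
Proof.
move=> Fc Fv l0 [x Fx lx]; have lx0 : 0 < pr l x by rewrite lt_neqAle eq_sym lx l0.
have [|K HK] := Fv (- x); first by rewrite rpredN mem_vspan.
have Ks : K <= `|K| + 1 by have := ler_norm K; lra.
have := l0 _ (HK _ Ks); rewrite linearD linearN linearZ /= => H.
by rewrite -(pmulr_rgt0 _ (_ : 0 < `|K| + 1)) ?ltr_wpDl //; lra.
Qed.

Lemma intmx_det n (M : 'M[R]_n) : intmx M -> \det M \is a Num.int.
Proof.
move=> Mi; rewrite /determinant rpred_sum // => s _; rewrite rpredM ?rpredX ?rpredN ?rpred1 //.
by rewrite rpred_prod.
Qed.

Lemma intmx_adj n (M : 'M[R]_n) : intmx M -> intmx (\adj M).
Proof.
move=> Mi i j; rewrite mxE /cofactor rpredM ?rpredX ?rpredN ?rpred1 //.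
by apply: intmx_det => a b; rewrite !mxE.
Qed.

Lemma int_delta n (j : 'I_n) : int_points n (delta_mx 0 j : 'rV[R]_n).
Proof. by move=> k; rewrite mxE; case: (_ && _); rewrite ?rpred0 ?rpred1. Qed.

(* Cramer's rule makes a rational hyperplane the kernel of an integral functional. *)
Lemma rational_functional d (F : set 'rV[R]_d.+1) t : cone F -> \dim (vspan F) = d ->
  (forall x, F x -> pr t x = 0) -> t != 0 -> exists2 a, 0 < a & intmx (a *: t).
Proof.
move=> Fc; rewrite -vspan_pts //; have [s [sF sfree ->]] := vspan_free (pts F).
move: (sfree) => /eqP -> sd tF t0.
have [j tj] : exists j, pr t (delta_mx 0 j) != 0.
  apply/existsP; apply: contraNT t0; rewrite negb_exists => /forallP tj.
  apply/eqP/matrixP => i j; rewrite ord1 !mxE; have := tj i.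
  by rewrite negbK /pr -rowE mxE => /eqP.
pose w := delta_mx 0 j :: s; have wd : size w = d.+1 by rewrite /= sd.
have wi x : x \in w -> int_points _ x.
  by rewrite inE => /orP [/eqP ->|/sF /ptsP []]; first exact: int_delta.
have wfree : free w.
  rewrite free_cons sfree andbT; apply: contra tj => js; apply/eqP.
  apply: (@pr_vspan _ _ [set x | x \in s]) => [x /= /sF /ptsP [/tF]//|].
  by move: js; apply/subvP/span_subvP => x xs; apply: mem_vspan.
pose M := \matrix_(i < d.+1) w`_i : 'M[R]_d.+1.
have Mi : intmx M by move=> i k; rewrite !mxE; apply: wi; rewrite mem_nth ?wd.
have D0 : \det M != 0.
  apply/negP => /det0P [x x0]; rewrite mulmx_sum_row => xM; case/eqP: x0.
  have /freeP wf : free (tcast wd (in_tuple w)) by rewrite val_tcast.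
  apply/matrixP => i k; rewrite ord1 mxE; apply: (wf (x 0)).
  rewrite -[RHS]xM; apply: eq_bigr => l _; rewrite rowK; congr (_ *: _).
  by rewrite val_tcast.
have MtE : M *m t = pr t (delta_mx 0 j) *: delta_mx 0 0.
  apply/matrixP => i k; rewrite ord1 !mxE.
  have -> : \sum_j0 M i j0 * t j0 0 = pr t w`_i.
    by rewrite /pr mxE; apply: eq_bigr => l _; rewrite !mxE.
  case: (unliftP ord0 i) => [l ->|->]; last by rewrite eqxx mulr1.
  rewrite /= mulr0; apply: tF; have : (w`_(lift ord0 l)) \in s by rewrite /= mem_nth // sd add0n ltn_ord.
  by move=> /sF /ptsP [].
have tE : \det M *: t = pr t (delta_mx 0 j) *: col 0 (\adj M).
  have /(congr1 (mulmx (\adj M))) := MtE; rewrite mulmxA mul_adj_mx mul_scalar_mx => ->.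
  by rewrite -scalemxAr colE.
have ti : intmx ((\det M / pr t (delta_mx 0 j)) *: t).
  rewrite mulrC -scalerA tE scalerA mulVf // scale1r => i k; rewrite mxE.
  exact: intmx_adj.
exists `|\det M / pr t (delta_mx 0 j)|; first by rewrite normr_gt0 mulf_neq0 // invr_eq0.
case: (ger0P (\det M / pr t (delta_mx 0 j))) => _ // i k.
by rewrite scaleNr mxE rpredN.
Qed.

(** The least positive value of an integral functional on the lattice divides all its values,
    because a remainder would be a smaller positive value. Division by this minimum leaves an
    integral functional that attains 1. *)
Lemma primitive_functional d (F : set 'rV[R]_d.+1) t : cone F -> \dim (vspan F) = d ->
  (forall x, F x -> pr t x = 0) -> t != 0 ->
  exists a u, [/\ 0 < a, intmx (a *: t), int_points _ u & pr (a *: t) u = 1].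
Proof.
move=> Fc Fd tF t0; have [a a0 ati] := rational_functional Fc Fd tF t0.
set t' := a *: t in ati.
pose P m := `[< exists2 u, int_points _ u & pr t' u = m.+1%:R >].
have P0 : exists m, P m.
  have [j tj] : exists j, pr t' (delta_mx 0 j) != 0.
    apply/existsP; apply: contraNT t0; rewrite negb_exists => /forallP tj.
    apply/eqP/matrixP => i j; rewrite ord1 mxE; have := tj i.
    rewrite negbK /pr -rowE !mxE mulf_eq0 gt_eqF //=; by move/eqP.
  have : `|pr t' (delta_mx 0 j)| \is a Num.nat by rewrite natr_norm_int // pr_int //; apply: int_delta.
  move=> /natrP [[|m] mE]; first by move/eqP: mE; rewrite normr_eq0 (negPf tj).
  exists m; apply/asboolP; case: (ger0P (pr t' (delta_mx 0 j))) mE => _ mE.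
    by exists (delta_mx 0 j) => //; apply: int_delta.
  by exists (- delta_mx 0 j); [apply/int_pointsN/int_delta|rewrite linearN].
case: (ex_minnP P0) => m /asboolP [u ui um] mmin.
have m0 : 0 < m.+1%:R :> R by rewrite ltr0n.
exists (a / m.+1%:R), u; split=> //; [by rewrite divr_gt0| |]; last first.
  by rewrite prZc mulrAC -prZc -/t' um divff // gt_eqF.
move=> i k; rewrite ord1; have : pr t' (delta_mx 0 i) \is a Num.int by rewrite pr_int //; apply: int_delta.
have -> : (a / m.+1%:R *: t) i 0 = pr t' (delta_mx 0 i) / m.+1%:R.
  by rewrite /pr -rowE !mxE mulrAC.
move=> /intrP [z zE]; pose q := (z %/ Posz m.+1)%Z; pose r := (z %% Posz m.+1)%Z.
have zqr : z = q * Posz m.+1 + r by exact: divz_eq.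
have r0 : 0 <= r by rewrite modz_ge0.
have rm : r < Posz m.+1 by rewrite ltz_pmod.
suff rz : r = 0 by rewrite zE zqr rz addr0 intrM mulfK ?gt_eqF // intr_int.
case: (ltrgtP r 0) r0 => // rpos _; case: r rm rpos zqr => [[|r']|r'] // rm _ zqr.
have : P r'.
  apply/asboolP; exists (delta_mx 0 i - q%:~R *: u).
    by apply: int_pointsB; [exact: int_delta|apply: int_pointsZ; rewrite ?intr_int].
  by rewrite linearB linearZ /= um zE {1}zqr intrD intrM addrC addKr.
by move/mmin; lia.
Qed.

Section Approach.
Variables (n : nat) (C : set 'rV[R]_n) (t : 'cV[R]_n) (u v : 'rV[R]_n).
Hypotheses (Cc : cone C) (tC : forall x, C x -> 0 <= pr t x).
Let F := C `&` [set x | pr t x = 0].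
Hypotheses (tu : pr t u = 1) (tv : pr t v = 0) (Fker : forall z, pr t z = 0 -> z \in vspan F).
Hypothesis (Fv : deep F v).

(** Subtracting [pr t p] times [u] moves [p] into the span of the wall, from where [v] leads into
    [F]. The push needed is proportional to the height of [p], with a factor common to all [p] since
    [C] is finitely generated. *)
Lemma approach : exists2 k0, 0 <= k0 &
  forall p, C p -> F (p - pr t p *: u + (pr t p * k0) *: v).
Proof.
have Fc : cone F by apply: cone_face.
have [k [g [gi CE]]] := cone_gens Cc.
have gC i : C (g i) by rewrite CE; apply: cone_hull_gen.
have /choice [K HK] : forall i, exists K, forall s, K <= s ->
    F (g i - pr t (g i) *: u + (pr t (g i) * s) *: v).
  move=> i; have := tC (gC i); rewrite le_eqVlt => /orP [/eqP ti|ti].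
    exists 0 => s _; rewrite -ti mul0r !scale0r addr0 subr0; split=> //.
  have [|K HK] := Fv (z := g i - pr t (g i) *: u).
    by apply: Fker; rewrite linearB linearZ /= tu mulr1 subrr.
  exists (K / pr t (g i)) => s; rewrite ler_pdivrMr // mulrC => Ks; exact: HK.
exists (\sum_i `|K i|); first exact: sumr_ge0.
rewrite [in X in forall p, X p -> _]CE; apply: cone_hull_min.
- by rewrite linear0 mul0r !scale0r addr0 subr0; apply: cone0.
- move=> y z Fy Fz; set K0 := \sum_i _ in Fy Fz *; rewrite linearD /=.
  rewrite (_ : _ + _ = (y - pr t y *: u + (pr t y * K0) *: v) +
    (z - pr t z *: u + (pr t z * K0) *: v)); first exact: coneD.
  by apply/matrixP => i j; rewrite !mxE; ring.
- move=> a y a0 Fy; set K0 := \sum_i _ in Fy *.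
  have -> : pr t (a *: y) = a * pr t y by rewrite linearZ.
  rewrite (_ : _ + _ = a *: (y - pr t y *: u + (pr t y * K0) *: v)); first exact: coneZ.
  by apply/matrixP => i j; rewrite !mxE; ring.
- move=> i; apply: HK; apply: le_trans (ler_norm _) _.
  by rewrite (bigD1 i) //= lerDl sumr_ge0.
Qed.

(* Shearing far along v pushes C deep into any half-space positive at v. *)
Lemma push l : (forall x, F x -> 0 <= pr l x) -> 0 < pr l v ->
  exists K, forall k, K <= k -> forall p, C p ->
    2 * pr t p <= pr l (p + (k * pr t p) *: v).
Proof.
move=> lF lv; have [k0 k00 H] := approach.
(* Up to [k0] the point only reaches [F]; the second term pays for the discarded multiple of [u] and
   for the gain of 2 per unit of height. *)
exists (k0 + (2 + `|pr l u|) / pr l v) => k kK p Cp.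
have tp := tC Cp; have := lF _ (H p Cp).
rewrite !(prD, prN, prZ).
have : (2 + `|pr l u|) <= (k - k0) * pr l v by rewrite -ler_pdivrMr // lerBrDl.
have := ler_norm (- pr l u); rewrite normrN => h1 h2 h3.
have : pr t p * (2 - pr l u) <= pr t p * ((k - k0) * pr l v) by apply: ler_wpM2l => //; lra.
lra.
Qed.

End Approach.

Lemma finite_eventually (T : choiceType) (L : set T) (P : T -> R -> Prop) : finite_set L ->
  (forall l, L l -> exists K, forall k, K <= k -> P l k) ->
  exists K, forall k, K <= k -> forall l, L l -> P l k.
Proof.
move=> /finite_seqP [s ->]; elim: s => [|a s IH] H; first by exists 0.
have [K HK] := H a (mem_head _ _).
have [|K' HK'] := IH; first by move=> l /= ls; apply: H; rewrite /= inE ls orbT.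
exists (Num.max K K') => k; rewrite ge_max => /andP [kK kK'] l /=.
by rewrite inE => /orP [/eqP ->|ls]; [exact: HK|exact: HK'].
Qed.

End Gluing.

(** * Unimodular maps, shears along a wall, and the union of two cones *)

Section ConeGluing.
Context {R : realType}.

Definition imx {n m} (C : set 'rV[R]_n) (B : 'M[R]_(n, m)) : set 'rV[R]_m :=
  [set x *m B | x in C].

(** An element of GL(n, Z), carried with its inverse so that images under it can be treated as
    preimages ([mem_imx]). *)
Definition lattice_inverse {n} (B B' : 'M[R]_n) :=
  [/\ intmx B, intmx B', B *m B' = 1%:M & B' *m B = 1%:M].

Lemma mx_ext n m (A B : 'M[R]_(n, m)) : (forall x : 'rV_n, x *m A = x *m B) -> A = B.
Proof. by move=> AB; apply/row_matrixP => i; rewrite !rowE AB. Qed.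

Section Imx.
Variables (n : nat) (B B' : 'M[R]_n).
Hypothesis BB : lattice_inverse B B'.

Lemma lattice_inverseC : lattice_inverse B' B.
Proof. by case: BB. Qed.

Lemma lattice_mulK (x : 'rV[R]_n) : x *m B *m B' = x.
Proof. by case: BB => _ _ e _; rewrite -mulmxA e mulmx1. Qed.

Lemma lattice_mulVK (x : 'rV[R]_n) : x *m B' *m B = x.
Proof. by case: BB => _ _ _ e; rewrite -mulmxA e mulmx1. Qed.

Lemma int_points_lattice (x : 'rV[R]_n) : int_points n (x *m B) <-> int_points n x.
Proof.
have [Bi Bi' _ _] := BB; split; last exact: int_points_mulmx.
by move=> /(int_points_mulmx Bi'); rewrite lattice_mulK.
Qed.

Lemma mem_imx C y : imx C B y <-> C (y *m B').
Proof.
split=> [[x Cx <-]|Cy]; first by rewrite lattice_mulK.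
by exists (y *m B'); rewrite ?lattice_mulVK.
Qed.

Lemma pts_imx C : pts (imx C B) = imx (pts C) B.
Proof.
apply/seteqP; split=> y.
  move=> /ptsP [[x Cx <-] xi x0]; exists x => //; apply/ptsP; split=> //.
    exact/int_points_lattice.
  by apply: contraNneq x0 => ->; rewrite mul0mx.
move=> [x /ptsP [Cx xi x0] <-]; apply/ptsP; split; [by exists x|exact/int_points_lattice|].
by apply: contraNneq x0 => x0; rewrite -(lattice_mulK x) x0 mul0mx.
Qed.

Lemma tight_imx C c : tight (imx C B) c = imx (tight C (B *m c)) B.
Proof.
rewrite /tight pts_imx; apply/seteqP; split=> y.
  by move=> [[x xp <-]] /=; rewrite prMr => x1; exists x.
by move=> [x [xp x1] <-]; split; [exists x|rewrite /= prMr].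
Qed.

Lemma bottom_functional_imx C c :
  bottom_functional (imx C B) c <-> bottom_functional C (B *m c).
Proof.
have [_ _ e _] := BB; have e' d : d = B *m (B' *m d) by rewrite mulmxA e mul1mx.
rewrite /bottom_functional tight_imx pts_imx; split=> -[[x xt] c1 cd]; split.
- by case: xt => y yt _; exists y.
- by move=> y yp; rewrite -prMr; apply: c1; exists y.
- move=> d dt y yp; rewrite [d]e' -prMr; apply: cd; last by exists y.
  by move=> _ [z zt <-]; rewrite prMr -e'; apply: dt.
- by exists (x *m B); exists x.
- by move=> _ [y yp <-]; rewrite prMr; apply: c1.
- move=> d dt _ [y yp <-]; rewrite prMr; apply: cd => // z zt.
  by rewrite -prMr; apply: dt; exists z.
Qed.

Lemma cone_imx C : cone C -> cone (imx C B).
Proof.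
move=> Cc; have [k [g [gi CE]]] := cone_gens Cc; have [Bi _ _ _] := BB.
have E : imx C B = cone_hull (fun i => g i *m B).
  rewrite CE; apply/seteqP; split=> y.
    move=> [_ [c [c0 ->]] <-]; exists c; split=> //.
    by rewrite mulmx_suml; apply: eq_bigr => i _; rewrite scalemxAl.
  move=> [c [c0 ->]]; exists (\sum_i c i *: g i); first by exists c.
  by rewrite mulmx_suml; apply: eq_bigr => i _; rewrite scalemxAl.
apply: (cone_intro _ _ E); first by move=> i; apply: int_points_mulmx.
rewrite -E => _ [x Cx <-] /mem_imx; rewrite mulNmx lattice_mulK => /(cone_pointed Cc Cx) ->.
by rewrite mul0mx.
Qed.

End Imx.

Lemma cone_ge0 n (C : set 'rV[R]_n) c : cone C -> (forall x, pts C x -> 0 <= pr c x) ->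
  forall x, C x -> 0 <= pr c x.
Proof.
move=> Cc c0; have [k [g [gi CE]]] := cone_gens Cc; rewrite {1}CE => _ [a [a0 ->]].
rewrite linear_sum /= sumr_ge0 // => i _; rewrite prZ mulr_ge0 //.
have [->|gn] := eqVneq (g i) 0; first by rewrite pr0.
by apply: c0; apply/ptsP; split=> //; rewrite CE; apply: cone_hull_gen.
Qed.

Section Positioned.
Variables (n : nat) (C1 C2 : set 'rV[R]_n) (t : 'cV[R]_n) (u v : 'rV[R]_n).
Let F := C1 `&` [set x | pr t x = 0].
Hypotheses (C1c : cone C1) (C2c : cone C2).
Hypotheses (tC1 : forall x, C1 x -> 0 <= pr t x) (tC2 : forall x, C2 x -> 0 <= pr (- t) x).
Hypothesis FE : C2 `&` [set x | pr (- t) x = 0] = F.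
Hypotheses (ti : intmx t) (ui : int_points n u) (tu : pr t u = 1).
Hypotheses (Fker : forall z, pr t z = 0 -> z \in vspan F).
Hypotheses (vF : lattice_monoid F v) (Fv : deep F v) (v0 : v != 0).

Let tv : pr t v = 0. Proof. by case: vF => -[]. Qed.
Let Fc : cone F. Proof. exact: cone_face. Qed.

Let F2 x : C2 x -> pr t x = 0 -> F x.
Proof. by move=> C2x tx; rewrite -FE; split=> //=; rewrite prNc tx oppr0. Qed.

Let FC2 x : F x -> C2 x.
Proof. by rewrite -FE => -[]. Qed.

Definition shear (k : R) : 'M[R]_n := 1%:M - k *: (t *m v).

Lemma shearE k x : x *m shear k = x - (k * pr t x) *: v.
Proof.
rewrite mulmxBr mulmx1 -scalemxAr mulmxA -scalerA; congr (_ - _ *: _).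
by rewrite [x *m t]mx11_scalar mul_scalar_mx.
Qed.

Lemma pr_shear k x : pr t (x *m shear k) = pr t x.
Proof. by rewrite shearE prB prZ tv mulr0 subr0. Qed.

Lemma shear_inverse (k : nat) : lattice_inverse (shear k%:R) (shear (- k%:R)).
Proof.
have [_ vi] := vF.
have si (s : R) : s \is a Num.int -> intmx (shear s).
  move=> si; apply: intmx_points => x xi; rewrite shearE; apply: int_pointsB => //.
  by apply: int_pointsZ => //; rewrite rpredM // pr_int.
split; [by apply: si; rewrite rpred_nat|by apply: si; rewrite rpredN rpred_nat| |];
  apply: mx_ext => x; rewrite mulmxA mulmx1 shearE pr_shear shearE;
  by apply/matrixP => i j; rewrite !mxE; ring.
Qed.

(** Weighting each point by the height of the other cancels the component across the wall. By
    [approach] on both sides the result lies in [F] up to a fixed multiple of [v], while the shear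
    adds a multiple growing linearly with [k]. *)
Lemma crossing : exists2 k0, 0 <= k0 & forall k p1 p2, C1 p1 -> C2 p2 ->
  exists2 f, F f & (- pr t p2) *: p1 + pr t p1 *: (p2 *m shear k) =
    f + (pr t p1 * - pr t p2 * (k - 2 * k0)) *: v.
Proof.
have [k1 k10 H1] := approach C1c tC1 tu Fker Fv.
have [|||k2 k20 H2] := @approach R n C2 (- t) (- u) v C2c tC2.
- by rewrite prNc prN opprK.
- by move=> z; rewrite prNc => /eqP; rewrite oppr_eq0 => /eqP; rewrite FE; apply: Fker.
- by rewrite FE.
rewrite FE in H2; exists (k1 + k2); first exact: addr_ge0.
have Fvn s : 0 <= s -> F (s *: v) by move=> s0; apply: coneZ => //; case: vF.
move=> k p1 p2 Cp1 Cp2; have a0 := tC1 Cp1; have := tC2 Cp2; rewrite prNc => b0.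
have := H1 _ Cp1; have := H2 _ Cp2; rewrite prNc scalerN opprK => h2 h1.
pose a := pr t p1; pose b := - pr t p2; have ab : 0 <= a * b by rewrite mulr_ge0.
exists (b *: (p1 - a *: u + (a * k1) *: v) + a *: (p2 + b *: u + (b * k2) *: v) +
   (a * b * (k1 + k2)) *: v).
  apply: coneD => //; first by apply: coneD => //; apply: coneZ.
  by apply: Fvn; rewrite mulr_ge0 // addr_ge0.
rewrite shearE -/a -/b; have -> : pr t p2 = - b by rewrite opprK.
by apply/matrixP => i j; rewrite !mxE; ring.
Qed.

(* Crossing points of segments joining the two sides lie so deep in F that the union of the
   cones is convex and no bottom facet of it meets both sides off F. *)
Lemma shear_far : exists K : R, forall k : nat, K <= k%:R ->
  let C := C1 `|` imx C2 (shear k%:R) in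
  cone C /\ forall c, bottom_functional C c ->
    (tight C c `<=` C1) \/ (tight C c `<=` imx C2 (shear k%:R)).
Proof.
(* Beyond [2 * k0] the surplus along [v] is nonnegative, which gives closure under sums, and
   positive, which gives pointedness. The surplus 3 is chosen to beat the 2 in [a + b <= 2 * a * b]
   for heights [a], [b] at least 1. *)
have [k0 k00 cross] := crossing; exists (2 * k0 + 3) => k kK C.
have SI := shear_inverse k; have C2S := cone_imx SI C2c.
have Fvn s : 0 <= s -> F (s *: v) by move=> s0; apply: coneZ => //; case: vF.
have tS x : imx C2 (shear k%:R) x -> 0 <= - pr t x.
  by move=> [y C2y <-]; rewrite pr_shear -prNc tC2.
have FC1 x : F x -> C1 x by case.
have FS x : F x -> imx C2 (shear k%:R) x.
  move=> Fx; exists x; first exact: FC2.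
  by rewrite shearE; case: Fx => _ /= ->; rewrite mulr0 scale0r subr0.
have SF x : imx C2 (shear k%:R) x -> pr t x = 0 -> F x.
  move=> [y C2y <-]; rewrite pr_shear => ty.
  by rewrite shearE ty mulr0 scale0r subr0; apply: F2.
have crossF p1 p2 : C1 p1 -> imx C2 (shear k%:R) p2 ->
    F ((- pr t p2) *: p1 + pr t p1 *: p2).
  move=> Cp1 [y C2y <-]; rewrite pr_shear; have [f Ff ->] := cross k%:R _ _ Cp1 C2y.
  apply: coneD => //; apply: Fvn; rewrite mulr_ge0 ?mulr_ge0 ?tC1 //; last by lra.
  by rewrite -prNc tC2.
(* Replacing the point of smaller height by a multiple of the crossing point, which lies in both
   cones, writes the sum with points of one cone only. *)
have addC p1 p2 : C1 p1 -> imx C2 (shear k%:R) p2 -> C (p1 + p2).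
  move=> Cp1 Cp2; have := crossF _ _ Cp1 Cp2; set a := pr t p1; set b := - pr t p2 => Fw.
  have a0 : 0 <= a by apply: tC1. have b0 : 0 <= b by apply: tS.
  have [/eqP a00|ap] := eqVneq a 0.
    by right; apply: coneD => //; apply: FS; split=> //; apply/eqP.
  have [/eqP b00|bp] := eqVneq b 0.
    left; apply: coneD => //; apply: FC1; apply: SF => //.
    by apply/eqP; rewrite -oppr_eq0.
  have a1 : 0 < a by rewrite lt_neqAle eq_sym ap.
  have b1 : 0 < b by rewrite lt_neqAle eq_sym bp.
  have [ab|/ltW ab] := lerP b a; [left|right].
    have -> : p1 + p2 = a^-1 *: (b *: p1 + a *: p2) + (1 - a^-1 * b) *: p1.
      apply/matrixP => i j; rewrite !mxE; field; exact: ap.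
    apply: coneD => //; first by apply: coneZ => //; [rewrite invr_ge0|exact: FC1].
    by apply: coneZ => //; rewrite subr_ge0 mulrC ler_pdivrMr // mul1r.
  have -> : p1 + p2 = b^-1 *: (b *: p1 + a *: p2) + (1 - b^-1 * a) *: p2.
    apply/matrixP => i j; rewrite !mxE; field; exact: bp.
  apply: coneD => //; first by apply: coneZ => //; [rewrite invr_ge0|exact: FS].
  by apply: coneZ => //; rewrite subr_ge0 mulrC ler_pdivrMr // mul1r.
have CD y z : C y -> C z -> C (y + z).
  move=> [y1|y2] [z1|z2]; [by left; apply: coneD|exact: addC|by rewrite addrC; apply: addC|].
  by right; apply: coneD.
have CZ a y : 0 <= a -> C y -> C (a *: y).
  by move=> a0 [y1|y2]; [left|right]; apply: coneZ.
split.
  have [m1 [g1 [g1i CE1]]] := cone_gens C1c; have [m2 [g2 [g2i CE2]]] := cone_gens C2S.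
  pose g (i : 'I_(m1 + m2)) := match fintype.split i with inl a => g1 a | inr b => g2 b end.
  have E : C = cone_hull g.
    apply/seteqP; split; last first.
      apply: cone_hull_min => // [|i]; first by left; apply: cone0.
      rewrite /g; case: fintype.split => a; [left; rewrite CE1|right; rewrite CE2];
        exact: cone_hull_gen.
    have g0 : cone_hull g 0.
      by exists (fun=> 0); split=> //; rewrite big1 // => i _; rewrite scale0r.
    move=> y [|]; [rewrite CE1|rewrite CE2]; apply: cone_hull_min => //;
      try (by move=> *; apply: cone_hullD); try (by move=> *; apply: cone_hullZ).
      move=> i; have := cone_hull_gen g (lshift m2 i); rewrite /g.
      by have /= -> := @unsplitK m1 m2 (inl i).
    move=> i; have := cone_hull_gen g (rshift m1 i); rewrite /g.
    by have /= -> := @unsplitK m1 m2 (inr i).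
  apply: (cone_intro _ _ E).
    by move=> i; rewrite /g; case: fintype.split => a.
  (* For opposite points off the wall the weighted sum in [crossing] is 0, so a positive multiple of
     [v] is the negative of a point of [F]; pointedness of [F] forbids this. *)
  have mixed p : C1 p -> imx C2 (shear k%:R) (- p) -> p = 0.
    move=> Cp CNp; have /tS := CNp; rewrite prN opprK => _.
    have [tp0|tp] := eqVneq (pr t p) 0.
      apply: cone_pointed Cp _ => //; apply: FC1; apply: SF => //.
      by rewrite prN tp0 oppr0.
    have tp1 : 0 < pr t p by rewrite lt_neqAle eq_sym tp tC1.
    case: CNp => q C2q qE; have tq : pr t q = - pr t p by rewrite -prN -qE pr_shear.
    have [f Ff] := cross k%:R _ _ Cp C2q; rewrite qE tq opprK scalerN subrr => /esym/eqP.
    set s := (_ * _ * _) => fs.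
    have s0 : 0 < s by rewrite mulr_gt0 ?mulr_gt0 //; lra.
    case/negP: v0; apply/eqP; apply: (cone_pointed Fc); first by case: vF.
    have -> : - v = s^-1 *: f.
      move: fs; rewrite addr_eq0 => /eqP ->.
      by rewrite scalerN scalerA mulVf ?gt_eqF // scale1r.
    by apply: coneZ => //; rewrite invr_ge0 ltW.
  rewrite -E => y [y1|y2] [z1|z2].
  - exact: cone_pointed z1.
  - exact: mixed.
  - by apply/eqP; rewrite -oppr_eq0; apply/eqP; apply: mixed => //; rewrite opprK.
  - exact: cone_pointed z2.
move=> c [_ c1 _].
case: (pselect (exists2 p, tight C c p & C1 p /\ pr t p != 0)) => [[p1 [p1p /= c11] [Cp1 tp1]]|H].
  left=> p2 [p2p /= c12]; have := p2p => /ptsP [[//|Cp2] p2i _].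
  have [tp20|tp2] := eqVneq (pr t p2) 0; first by apply: FC1; apply: SF.
  exfalso; have a0 : 1 <= pr t p1.
    apply: int_ge1; last by rewrite lt_neqAle eq_sym tp1 tC1.
    by apply: pr_int => //; case/ptsP: p1p.
  case: Cp2 => y C2y yE; have tye : pr t p2 = pr t y by rewrite -yE pr_shear.
  have b0 : 1 <= - pr t y.
    rewrite -tye; apply: int_ge1; first by rewrite rpredN pr_int.
    by rewrite lt_neqAle eq_sym oppr_eq0 tp2 /= tye -prNc tC2.
  (* If both points are tight, [c] takes the value [a + b] on the weighted sum, but the multiple of
     [v] alone contributes at least [3 * a * b], since [c] is at least 1 at [v]. *)
  have [f Ff] := cross k%:R _ _ Cp1 C2y; rewrite yE => /(congr1 (pr c)).
  rewrite !(prD, prZ) c11 c12 !mulr1.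
  have c0 x : pts C1 x -> 0 <= pr c x.
    move=> /ptsP [Cx xi x0]; apply: le_trans (c1 x _); first exact: ler01.
    by apply/ptsP; split=> //; left.
  have f0 : 0 <= pr c f by apply: (cone_ge0 C1c c0); apply: FC1.
  have v1 : 1 <= pr c v.
    by apply: c1; have [[vC _] vi] := vF; apply/ptsP; split=> //; left.
  have kk : 3 <= k%:R - 2 * k0 by lra.
  set a := pr t p1 in a0 *; set b := - pr t y in b0 *; set w := pr c v in v1 *.
  have ab1 : 1 <= a * b by rewrite -[1]mulr1 ler_pM.
  have kw : 3 <= (k%:R - 2 * k0) * w by rewrite -[3]mulr1 ler_pM.
  have : a * b * 3 <= a * b * ((k%:R - 2 * k0) * w) by rewrite ler_wpM2l //; lra.
  nra.
right=> p2 p2t; case: (p2t) => /ptsP [[Cp2|//] _ _] _; apply: FS; split=> //=.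
by apply: contrapT => /eqP tp; apply: H; exists p2.
Qed.

(** The two parts serve functionals of the two sides: from the position of the second cone before
    the shear, it is the first cone that moves, by the inverse shear. *)
Lemma shear_push l : (forall x, F x -> 0 <= pr l x) -> 0 < pr l v ->
  exists K, forall k, K <= k ->
    (forall p, C2 p -> 2 * - pr t p <= pr l (p *m shear k)) /\
    (forall p, C1 p -> 2 * pr t p <= pr l (p *m shear (- k))).
Proof.
move=> lF lv; have [K1 H1] := push C1c tC1 tu Fker Fv lF lv.
have [|||||K2 H2] := @push R n C2 (- t) (- u) v C2c tC2 _ _ _ l.
- by rewrite prNc prN opprK.
- by move=> z; rewrite prNc => /eqP; rewrite oppr_eq0 => /eqP; rewrite FE; apply: Fker.
- by rewrite FE.
- by rewrite FE.
- by [].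
exists (Num.max K1 K2) => k; rewrite ge_max => /andP [k1 k2]; split=> p Cp.
  by have := H2 k k2 p Cp; rewrite prNc shearE [k * _]mulrN scaleNr.
by have := H1 k k1 p Cp; rewrite shearE [- k * _]mulNr scaleNr opprK.
Qed.

End Positioned.

Lemma ker_vspan d (F : set 'rV[R]_d.+1) t x0 : \dim (vspan F) = d ->
  (forall x, F x -> pr t x = 0) -> pr t x0 != 0 -> forall z, pr t z = 0 -> z \in vspan F.
Proof.
move=> Fd Ft tx0 z tz; apply: contraNT tx0 => zF; apply/eqP.
have z0 : z != 0 by apply: contraNneq zF => ->; apply: mem0v.
have : x0 \in (vspan F + <[z]>)%VS.
  have -> : (vspan F + <[z]> = fullv)%VS; last exact: memvf.
  apply/eqP; rewrite eqEdim subvf dimvf /= dimv_disjoint_sum.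
    by rewrite Fd dim_vline z0 /dim /= mul1n addn1.
  apply/eqP; rewrite -subv0; apply/subvP => w; rewrite memv_cap => /andP [wF /vlineP [a wE]].
  have [a0|a0] := eqVneq a 0; first by rewrite wE a0 scale0r mem0v.
  by move: zF; rewrite -[z](scalerK a0) -wE rpredZ.
by move=> /memv_addP [f fF [_ /vlineP [a ->] ->]]; rewrite prD prZ tz mulr0 addr0 (pr_vspan Ft).
Qed.

Lemma vspan_full d (C : set 'rV[R]_d.+1) t x0 : C x0 -> pr t x0 != 0 ->
  \dim (vspan (C `&` [set x | pr t x = 0])) = d -> vspan C = fullv.
Proof.
move=> Cx0 tx0 Cd; apply/eqP; rewrite eqEsubv subvf; apply/subvP => z _.
rewrite -[z](subrK ((pr t z / pr t x0) *: x0)) rpredD //; last by rewrite rpredZ // mem_vspan.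
have : z - (pr t z / pr t x0) *: x0 \in vspan (C `&` [set x | pr t x = 0]).
  by apply: (ker_vspan Cd _ tx0) => [x []//|]; rewrite prB prZ divfK // subrr.
by apply: subvP; apply: vspanS => x [].
Qed.

(** [T] is constrained only on the wall and its lattice; [B] undoes it there and places the second
    cone across the wall. [L1] and [L2] are further functionals to be kept positive across the wall:
    none when two given complexes are glued, those of the free faces when a complex is stacked. They
    may not vanish on the wall, for else no shear could influence them. *)
Lemma cone_gluing d (C1 C2 : set 'rV[R]_d.+1) s1 s2 (T : 'M[R]_d.+1)
    (L1 L2 : set 'cV[R]_d.+1) :
  (0 < d)%N -> cone C1 -> cone C2 ->
  (forall x, C1 x -> 0 <= pr s1 x) -> (forall x, C2 x -> 0 <= pr s2 x) ->
  (exists2 x, C1 x & pr s1 x != 0) -> (exists2 x, C2 x & pr s2 x != 0) ->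
  \dim (vspan (C1 `&` [set x | pr s1 x = 0])) = d ->
  \dim (vspan (C2 `&` [set x | pr s2 x = 0])) = d ->
  imx (C1 `&` [set x | pr s1 x = 0]) T = C2 `&` [set x | pr s2 x = 0] ->
  (forall z, int_points _ z -> pr s1 z = 0 -> int_points _ (z *m T)) ->
  (forall y, int_points _ y -> pr s2 y = 0 ->
     exists z, [/\ int_points _ z, pr s1 z = 0 & z *m T = y]) ->
  finite_set L1 -> finite_set L2 ->
  (forall l, L1 l -> (forall x, C1 x -> 0 <= pr l x) /\
     exists2 x, C1 x /\ pr s1 x = 0 & pr l x != 0) ->
  (forall l, L2 l -> (forall x, C2 x -> 0 <= pr l x) /\
     exists2 x, C2 x /\ pr s2 x = 0 & pr l x != 0) ->
  exists B B', let C := C1 `|` imx C2 B in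
  [/\ lattice_inverse B B', cone C, forall x, C1 x -> pr s1 x = 0 -> x *m T *m B = x
    & forall x, C2 x -> C1 (x *m B) -> pr s2 x = 0 /\ pr s1 (x *m B) = 0] /\
  [/\ forall l x, L1 l -> C2 x -> pr s2 x != 0 -> 0 < pr l (x *m B)
    & forall l x, L2 l -> C1 x -> pr s1 x != 0 -> 0 < pr l (x *m B')] /\
  [/\ forall c, bottom_functional C c <->
         bottom_functional C1 c \/ bottom_functional (imx C2 B) c,
      forall c, bottom_functional C1 c -> tight C c = tight C1 c
    & forall c, bottom_functional (imx C2 B) c -> tight C c = tight (imx C2 B) c].
Proof.
move=> d0 C1c C2c sC1 sC2 y1 y2 Fd1 Fd2 TF sTi sTS L1f L2f sL1P sL2P.
(* A positive rescaling to a primitive functional keeps the kernel and the sign. The vector [u] at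
   height 1 splits the lattice into the wall lattice and the multiples of [u]. *)
have prim (C : set 'rV[R]_d.+1) s : cone C -> (forall x, C x -> 0 <= pr s x) ->
    \dim (vspan (C `&` [set x | pr s x = 0])) = d -> (exists2 x, C x & pr s x != 0) ->
    exists t u, [/\ intmx t, int_points _ u, pr t u = 1, forall x, pr t x = 0 <-> pr s x = 0
      & forall x, C x -> 0 <= pr t x].
  move=> Cc sC Fd [x _ sx].
  have s0 : s != 0 by apply: contraNneq sx => ->; rewrite pr0c.
  have ker y : (C `&` [set x | pr s x = 0]) y -> pr s y = 0 by case.
  have [a [u [a0 ti ui tu]]] := primitive_functional (cone_face Cc sC) Fd ker s0.
  exists (a *: s), u; split=> // y; rewrite prZc; last by move=> /sC sy; rewrite mulr_ge0 // ltW.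
  by split=> [/eqP|->]; [rewrite mulf_eq0 gt_eqF // => /eqP|rewrite mulr0].
have [t1 [u1 [t1i u1i tu1 t1s tC1]]] := prim _ _ C1c sC1 Fd1 y1.
have [t2 [u2 [t2i u2i tu2 t2s tC2]]] := prim _ _ C2c sC2 Fd2 y2.
have kE (C : set 'rV[R]_d.+1) s t : (forall x, pr t x = 0 <-> pr s x = 0) ->
    C `&` [set x | pr s x = 0] = C `&` [set x | pr t x = 0].
  by move=> ts; apply/seteqP; split=> x [Cx] /ts.
have nz (s t : 'cV[R]_d.+1) x : (forall x, pr t x = 0 <-> pr s x = 0) -> pr s x != 0 -> pr t x != 0.
  by move=> ts; apply: contra_neq => /ts.
rewrite (kE C1 _ _ t1s) in Fd1 TF; rewrite (kE C2 _ _ t2s) in Fd2 TF.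
have [x1 C1x1 /(nz _ t1 _ t1s) tx1] := y1; have [x2 C2x2 /(nz _ t2 _ t2s) tx2] := y2.
have Ti z : int_points _ z -> pr t1 z = 0 -> int_points _ (z *m T) by move=> zi /t1s; apply: sTi.
have TS y : int_points _ y -> pr t2 y = 0 ->
    exists z, [/\ int_points _ z, pr t1 z = 0 & z *m T = y].
  by move=> yi /t2s /(sTS _ yi) [z [zi tz zT]]; exists z; split=> //; apply/t1s.
have L1P l : L1 l -> (forall x, C1 x -> 0 <= pr l x) /\
     exists2 x, C1 x /\ pr t1 x = 0 & pr l x != 0.
  by move=> /sL1P [l0 [x [Cx /t1s tx] lx]]; split=> //; exists x.
have L2P l : L2 l -> (forall x, C2 x -> 0 <= pr l x) /\
     exists2 x, C2 x /\ pr t2 x = 0 & pr l x != 0.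
  by move=> /sL2P [l0 [x [Cx /t2s tx] lx]]; split=> //; exists x.
set F1 := C1 `&` _ in Fd1 TF; set F2 := C2 `&` _ in Fd2 TF.
have F1c : cone F1 by apply: cone_face.
have ker1 : forall z, pr t1 z = 0 -> z \in vspan F1 by apply: (ker_vspan Fd1 _ tx1) => x [].
have full1 := vspan_full C1x1 tx1 Fd1; have full2 := vspan_full C2x2 tx2 Fd2.
have [v vF Fv] := deep_ex F1c.
have v0 : v != 0.
  apply/eqP => v00; have [_ /(_ (vspan F1)) F1p] := F1c; move: d0; rewrite -Fd1 F1p //.
  by move=> z /Fv [K /(_ K (lexx _))]; rewrite v00 scaler0 addr0.
(* A swaps the sides of the two hyperplanes and extends T. *)
pose A : 'M[R]_d.+1 := T - t1 *m (u1 *m T) - t1 *m u2.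
have AE x : x *m A = (x - pr t1 x *: u1) *m T - pr t1 x *: u2.
  have e (w : 'rV_d.+1) : x *m (t1 *m w) = pr t1 x *: w.
    by rewrite mulmxA [x *m t1]mx11_scalar mul_scalar_mx.
  by rewrite !mulmxBr !e mulmxBl -scalemxAl.
have kerT z : pr t1 z = 0 -> pr t2 (z *m T) = 0.
  move=> /ker1; rewrite prMr; apply: pr_vspan => x Fx; rewrite -prMr.
  have : imx F1 T (x *m T) by exists x.
  by rewrite TF => -[].
have t1u x : pr t1 (x - pr t1 x *: u1) = 0 by rewrite prB prZ tu1 mulr1 subrr.
have tA x : pr t2 (x *m A) = - pr t1 x.
  by rewrite AE prB prZ tu2 mulr1 kerT ?t1u // sub0r.
have Ai : intmx A.
  apply: intmx_points => x xi; have xu : pr t1 x \is a Num.int by apply: pr_int.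
  rewrite AE; apply: int_pointsB; last exact: int_pointsZ.
  by apply: Ti => //; apply: int_pointsB => //; apply: int_pointsZ.
have AS y : int_points _ y -> exists x, int_points _ x /\ x *m A = y.
  move=> yi; have yu : pr t2 y \is a Num.int by apply: pr_int.
  have [||z [zi tz zT]] := TS (y - pr t2 y *: u2).
  - by apply: int_pointsB => //; apply: int_pointsZ.
  - by rewrite prB prZ tu2 mulr1 subrr.
  exists (z - pr t2 y *: u1); split; first by apply: int_pointsB => //; apply: int_pointsZ.
  rewrite AE prB prZ tz tu1 mulr1 sub0r !scaleNr !opprK subrK zT.
  by rewrite subrK.
(* Integral preimages of the unit vectors are the rows of an integral inverse of [A]. *)
have /choice [r rP] : forall i : 'I_d.+1, exists x, int_points _ x /\ x *m A = delta_mx 0 i.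
  by move=> i; apply: AS; apply: int_delta.
pose A' : 'M[R]_d.+1 := \matrix_i r i.
have A'A : A' *m A = 1%:M.
  by apply/row_matrixP => i; rewrite row_mul rowK rowE mulmx1; have [] := rP i.
have A'i : intmx A' by move=> i j; rewrite mxE; have [] := rP i.
have AI : lattice_inverse A' A by split=> //; apply: mulmx1C.
pose D := imx C2 A'; have Dc : cone D := cone_imx AI C2c.
have tD x : pr t1 (x *m A') = - pr t2 x.
  by rewrite -[in RHS](lattice_mulK AI x) tA opprK.
have TA x : pr t1 x = 0 -> x *m T *m A' = x.
  move=> tx; have -> : x *m T = x *m A by rewrite AE tx !scale0r !subr0.
  by rewrite (lattice_mulVK AI).
have tD0 x : D x -> 0 <= pr (- t1) x.
  by move=> [y C2y <-]; rewrite prNc tD opprK tC2.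
have DE : D `&` [set x | pr (- t1) x = 0] = F1.
  apply/seteqP; split=> x.
    move=> [[y C2y <-]]; rewrite /= prNc tD opprK => ty.
    have : F2 y by []. rewrite -TF => -[z Fz <-]; by rewrite TA //; case: Fz.
  move=> Fx; have tx : pr t1 x = 0 by case: Fx.
  have : imx F1 T (x *m T) by exists x.
  rewrite TF => -[C2x _]; split; last by rewrite /= prNc tx oppr0.
  by exists (x *m T) => //; rewrite TA.
have vC1 : pts C1 v by have [[vC _] vi] := vF; apply/ptsP.
(* Bottom functionals are at least 1 at the nonzero lattice point [v], and members of [L1] are
   positive there by [deep_pos]; so both kinds can be pushed. *)
have pos1 l : L1 l \/ bottom_functional C1 l -> (forall x, F1 x -> 0 <= pr l x) /\ 0 < pr l v.
  move=> [/L1P [l0 [x [C1x tx] lx]]|[_ l1 _]].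
    split=> [x' [C1x' _]|]; first exact: l0.
    by apply: (deep_pos F1c Fv) => [x' [/l0]//|]; exists x.
  split; last by apply: lt_le_trans (l1 _ vC1); rewrite ltr01.
  move=> x [C1x _]; apply: cone_ge0 C1x => // y /l1; apply: le_trans; exact: ler01.
have pos2 l : L2 l \/ bottom_functional C2 l ->
    (forall x, F1 x -> 0 <= pr (A *m l) x) /\ 0 < pr (A *m l) v.
  have F2A x : F1 x -> F2 (x *m A).
    move=> Fx; rewrite -TF; exists x => //; rewrite AE.
    by case: Fx => _ /= ->; rewrite !scale0r !subr0.
  have vA : pts C2 (v *m A).
    have [vF1 vi] := vF; have [vA _] := F2A _ vF1; apply/ptsP; split=> //.
      exact: int_points_mulmx.
    by apply: contraNneq v0 => vA0; rewrite -(lattice_mulVK AI v) vA0 mul0mx.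
  move=> [/L2P [l0 [x [C2x tx] lx]]|[_ l1 _]]; last first.
    split; last by rewrite -prMr; apply: lt_le_trans (l1 _ vA); rewrite ltr01.
    move=> x /F2A [C2x _]; rewrite -prMr; apply: cone_ge0 C2x => // y /l1.
    by apply: le_trans; exact: ler01.
  have l0' y : F1 y -> 0 <= pr (A *m l) y by move=> /F2A [C2y _]; rewrite -prMr l0.
  split=> //; apply: (deep_pos F1c Fv) => //; exists (x *m A').
    by rewrite -DE; split; [exists x|rewrite /= prNc tD tx !oppr0].
  by rewrite -prMr (lattice_mulK AI).
have fin1 : finite_set (L1 `|` bottom_functional C1).
  by rewrite finite_setU; split=> //; apply: finite_bottom_functional.
have fin2 : finite_set (L2 `|` bottom_functional C2).
  by rewrite finite_setU; split=> //; apply: finite_bottom_functional.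
have [K1 HK1] := finite_eventually fin1 (fun l ll =>
  shear_push C1c Dc tC1 tD0 DE tu1 ker1 Fv (pos1 l ll).1 (pos1 l ll).2).
have [K2 HK2] := finite_eventually fin2 (fun l ll =>
  shear_push C1c Dc tC1 tD0 DE tu1 ker1 Fv (pos2 l ll).1 (pos2 l ll).2).
have [K3 HK3] := shear_far C1c Dc tC1 tD0 DE t1i tu1 ker1 vF Fv v0.
(* A natural number beyond all three thresholds: integrality of [k] makes the shear unimodular. *)
pose k := (Num.truncn (Num.max K1 (Num.max K2 K3))).+1.
have : Num.max K1 (Num.max K2 K3) <= k%:R by apply/ltW/truncnS_gt.
rewrite !ge_max => /and3P [/HK1 {}HK1 /HK2 {}HK2 /HK3 {HK3} [Cc split12]].
have SI := shear_inverse t1i vF k; have [Si Si' SS' S'S] := SI.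
pose S := shear t1 v k%:R; pose S' := shear t1 v (- k%:R).
exists (A' *m S), (S' *m A).
have -> : imx C2 (A' *m S) = imx D S.
  apply/seteqP; split=> x; first by move=> [y C2y <-]; exists (y *m A'); rewrite ?mulmxA //; exists y.
  by move=> [_ [y C2y <-] <-]; exists y; rewrite ?mulmxA.
set C := C1 `|` imx D S.
have tS x : pr t1 (x *m S) = pr t1 x by apply: (pr_shear vF).
have SE x : pr t1 x = 0 -> x *m S = x by move=> tx; rewrite shearE tx mulr0 scale0r subr0.
have DS x : C2 x -> imx D S (x *m (A' *m S)).
  by move=> C2x; exists (x *m A'); rewrite ?mulmxA //; exists x.
have F1D x : F1 x -> imx D S x.
  move=> Fx; have tx : pr t1 x = 0 by case: Fx.
  by exists x; [rewrite -DE in Fx; case: Fx|rewrite SE].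
have DF1 x : imx D S x -> pr t1 x = 0 -> F1 x.
  move=> [y Dy <-]; rewrite tS => ty; rewrite SE // -DE; split=> //.
  by rewrite /= prNc ty oppr0.
have full_dual (E : set 'rV[R]_d.+1) c : (forall x, E x -> pr c x = 0) -> vspan E = fullv ->
    forall x, pr c x = 0.
  by move=> Ec Ef x; apply: (pr_vspan Ec); rewrite Ef memvf.
(* A lattice point across the wall has integral height at least 1, and the push guarantees twice its
   height. So across the wall no point becomes tight and no inequality fails. *)
have C1_far c x : bottom_functional C1 c -> pts C x -> ~ C1 x -> 1 < pr c x.
  move=> bc /ptsP [[//|[y Dy yx]] xi x0] nC1; have := (HK1 c (or_intror bc)).1 y Dy.
  rewrite yx; have : 1 <= - pr t1 y.
    rewrite -prNc; apply: int_ge1; last first.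
      rewrite lt_neqAle eq_sym tD0 // andbT prNc oppr_eq0; apply/eqP => ty; apply: nC1.
      by have [] : F1 x by apply: DF1; [exists y|rewrite -yx tS].
    by rewrite prNc rpredN -tS yx pr_int.
  by lra.
have D_far c x : bottom_functional (imx D S) c -> pts C x -> ~ imx D S x -> 1 < pr c x.
  move=> /(bottom_functional_imx SI) /(bottom_functional_imx AI) bc /ptsP [[C1x|//] xi x0] nD.
  have := (HK2 _ (or_intror bc)).2 x C1x.
  rewrite [A *m _]mulmxA (mulmx1C A'A) mul1mx -prMr -mulmxA S'S mulmx1.
  have : 1 <= pr t1 x.
    apply: int_ge1; first exact: pr_int.
    rewrite lt_neqAle eq_sym tC1 // andbT; apply/eqP => tx; apply: nD; exact: F1D.
  by lra.
have ptsC E x : E `<=` C -> pts E x -> pts C x.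
  by move=> EC /ptsP [Ex xi x0]; apply/ptsP; split=> //; apply: EC.
have tightE E c : E `<=` C -> (forall x, pts C x -> ~ E x -> 1 < pr c x) -> tight C c = tight E c.
  move=> EC far; apply/seteqP; split=> x [xp /= cx]; split=> //=; last exact: ptsC xp.
  case/ptsP: (xp) => _ xi x0; apply/ptsP; split=> //; apply: contrapT => nE.
  by have := far x xp nE; rewrite cx ltxx.
have bfE E c : E `<=` C -> cone E -> vspan E = fullv -> bottom_functional E c ->
    (forall x, pts C x -> ~ E x -> 1 < pr c x) -> bottom_functional C c.
  move=> EC Ec Ef [c0 c1 cd] far; have tE := tightE _ _ EC far; split; rewrite ?tE //.
    move=> x xp; have [Ex|nE] := pselect (E x); last exact/ltW/far.
    by apply: c1; case/ptsP: xp => _ xi x0; apply/ptsP.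
  move=> e et x _; apply: (full_dual (pts E)); first exact: cd.
  by rewrite vspan_pts.
have CE E c : E `<=` C -> bottom_functional C c -> tight C c `<=` E -> bottom_functional E c.
  move=> EC [c0 c1 cd] tE; have tCE : tight C c = tight E c.
    apply/seteqP; split=> x xt; last by case: xt => xp cx; split=> //; apply: ptsC xp.
    have Ex := tE x xt; case: xt => /ptsP [_ xi x0] cx; split=> //; exact/ptsP.
  split; rewrite -?tCE //; first by move=> x /(ptsC _ _ EC)/c1.
  by move=> e et x /(ptsC _ _ EC); apply: cd.
have C1C : C1 `<=` C by move=> x; left.
have DC : imx D S `<=` C by move=> x; right.
have Df : vspan (imx D S) = fullv.
  apply/eqP; rewrite eqEsubv subvf; apply/subvP => z _.
  have : z *m (S' *m A) \in vspan C2 by rewrite full2 memvf.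
  move=> /in_vspanP [m [y [c [yC zE]]]].
  have -> : z = \sum_i c i *: (y i *m (A' *m S)).
    have := congr1 (mulmx^~ (A' *m S)) zE; rewrite mulmx_suml /= !mulmxA -[z *m _ *m _ *m A']mulmxA.
    rewrite (mulmx1C A'A) mulmx1 -[z *m _ *m _]mulmxA S'S mulmx1 => ->.
    by apply: eq_bigr => i _; rewrite scalemxAl.
  by apply: memv_suml => i _; apply: memvZ; apply: mem_vspan; apply: DS.
split; [split=> //|split; [split|split]].
- split; [exact: intmx_mul|exact: intmx_mul| |].
    by rewrite mulmxA -[A' *m S *m S']mulmxA SS' mulmx1.
  by rewrite mulmxA -[S' *m A *m A']mulmxA (mulmx1C A'A) mulmx1.
- by move=> x C1x /t1s tx; rewrite mulmxA TA // SE.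
- move=> x C2x C1x; have := tC1 _ C1x; have := tC2 _ C2x.
  rewrite mulmxA tS tD => h1 h2.
  by split; [apply/t2s|apply/t1s; rewrite tS tD]; lra.
- move=> l x Ll C2x /(nz _ t2 _ t2s) tx; have Dx : D (x *m A') by exists x.
  have := (HK1 l (or_introl Ll)).1 _ Dx; rewrite tD opprK mulmxA; apply: lt_le_trans.
  by rewrite mulr_gt0 // lt_neqAle eq_sym tx tC2.
- move=> l x Ll C1x /(nz _ t1 _ t1s) tx; have := (HK2 l (or_introl Ll)).2 _ C1x.
  rewrite -prMr -mulmxA; apply: lt_le_trans.
  by rewrite mulr_gt0 // lt_neqAle eq_sym tx tC1.
- move=> c; split=> [bc|[bc|bc]].
  + by case: (split12 c bc) => h; [left|right]; apply: CE.
  + by apply: (bfE _ c C1C C1c full1 bc) => x; apply: C1_far.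
  + by apply: (bfE _ c DC (cone_imx SI Dc) Df bc) => x; apply: D_far.
- by move=> c bc; apply: tightE => // x; apply: C1_far.
- by move=> c bc; apply: tightE => // x; apply: D_far.
Qed.

End ConeGluing.

(** * Realizations of complexes *)

Section Realization.
Context {R : realType}.

Lemma face_image n m (g : 'rV[R]_n -> 'rV[R]_m) (r : 'rV[R]_m -> 'rV[R]_n) P F :
  affine_map r -> (forall x, P x -> r (g x) = x) -> face P F -> face (g @` P) (g @` F).
Proof.
move=> ra rg /facePr [c [e [ce ->]]]; have [d [s rE]] := affine_pr c ra.
have dg x : P x -> pr d (g x) = pr c x - s by move=> Px; rewrite -{2}(rg x Px) rE addrK.
apply/facePr; exists d, (e - s); split=> [_ [x Px <-]|].
  by rewrite dg // lerD2r ce.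
apply/seteqP; split=> y.
  by move=> [x [Px /= xe] <-]; split; [exists x|rewrite /= dg // xe].
move=> [[x Px <-]]; rewrite /= dg // => /addIr xe; by exists x.
Qed.

Lemma face_preimage n m (g : 'rV[R]_n -> 'rV[R]_m) P G :
  affine_map g -> face (g @` P) G ->
  face P (P `&` g @^-1` G) /\ g @` (P `&` g @^-1` G) = G.
Proof.
move=> ga GP; split; last first.
  apply/seteqP; split=> [_ [x [_ Gx] <-]//|y Gy].
  by have [x Px gx] := face_sub GP Gy; exists x => //; split=> //; rewrite /= gx.
move: GP => /facePr [c [e [ce GE]]]; have [d [s gE]] := affine_pr c ga.
apply/facePr; exists d, (e - s); split=> [x Px|].
  by have := ce (g x); rewrite gE lerBlDr; apply; exists x.
apply/seteqP; split=> x [Px].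
  by rewrite /= GE => -[_ /=]; rewrite gE => <-; rewrite addrK.
by move=> /= xe; split=> //; rewrite /= GE; split; [exists x|rewrite /= gE xe subrK].
Qed.

Definition cell_ok {T} (c : cell R T) (p : set T) : Prop :=
  [/\ polytope (cell_poly c), set_bij (cell_poly c) p (cell_chart c),
      cell_lat c `<=` aff_hull (cell_poly c),
      cell_poly c !=set0 -> affine_lattice (cell_lat c)
    & lattice_polytope (cell_lat c) (cell_poly c)].

Lemma lattice_complex_cell (X : complex R) p :
  lattice_complex X -> faces X p -> cell_ok (cell_of X p) p.
Proof.
move=> [[_ cX _ _] lX _] Xp; have [Pp bp] := cX p Xp; have [l1 l2 l3] := lX p Xp.
by split.
Qed.

(* The cell c is carried by phi onto G, which has the lattice induced from Z^n. *)
Definition realizes {n T} (c : cell R T) (phi : T -> 'rV[R]_n) (G : set 'rV[R]_n) : Prop :=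
  exists g : 'rV[R]_(cell_dim c) -> 'rV[R]_n,
    [/\ affine_map g, set_bij (cell_poly c) G g,
        forall x, cell_poly c x -> g x = phi (cell_chart c x),
        set_bij (cell_poly c `&` cell_lat c) (G `&` (int_points n `&` aff_hull G)) g
      & set_bij (cell_lat c) (int_points n `&` aff_hull G) g].

(** Convexity of the polytope supplies an affine left inverse [r], valid on the whole affine hull
    and hence on the lattice of reference. *)
Lemma realizes_data n T (c : cell R T) p (phi : T -> 'rV[R]_n) G :
  cell_ok c p -> realizes c phi G ->
  phi @` p = G /\ exists g r, [/\ affine_map g /\ affine_map r,
    forall x, aff_hull (cell_poly c) x -> r (g x) = x, g @` cell_poly c = G,
    forall x, cell_poly c x -> g x = phi (cell_chart c x)
    & g @` cell_lat c = int_points n `&` aff_hull G].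
Proof.
move=> [cp [cf ci cs] cl _ _] [g [ga gb gp _ [lf li ls]]].
have gG : g @` cell_poly c = G.
  have [gf gi gs] := gb; apply/seteqP; split=> [_ [x Px <-]|y /gs]; last by [].
  exact: gf.
have [r ra rg] := affine_linv ga (polytope_conv cp) (let: And3 _ gi _ := gb in gi).
split.
  rewrite -gG; apply/seteqP; split=> _ [x px <-].
    by have [y Py <-] := cs x px; exists y; rewrite ?gp.
  by exists (cell_chart c x); rewrite ?gp //; apply: cf.
exists g, r; split=> //; apply/seteqP; split=> [_ [x Lx <-]|y /ls//]; exact: lf.
Qed.

Lemma realizes_intro n T (c : cell R T) p (phi : T -> 'rV[R]_n) g :
  cell_ok c p -> affine_map g -> set_inj (cell_poly c) g ->
  (forall x, cell_poly c x -> g x = phi (cell_chart c x)) ->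
  g @` cell_lat c = int_points n `&` aff_hull (g @` cell_poly c) ->
  realizes c phi (g @` cell_poly c).
Proof.
move=> [cp _ cl _ _] ga gi gp gl; have [r ra rg] := affine_linv ga (polytope_conv cp) gi.
have inj (A : set 'rV[R]_(cell_dim c)) : A `<=` aff_hull (cell_poly c) -> set_inj A g.
  by move=> AP x y /set_mem/AP Ax /set_mem/AP Ay gxy; rewrite -(rg x Ax) gxy rg.
exists g; split=> //.
- by split=> // x Px; exists x.
- split; last 1 first.
  + move=> y [[x Px <-]]; rewrite -gl => -[z Lz gz]; exists x => //; split=> //.
    by rewrite -(rg _ (aff_hull_sub Px)) -gz rg //; apply: cl.
  + move=> x [Px Lx]; split; first by exists x.
    by rewrite -gl; exists x.
  + by apply: inj => x [Px _]; apply: aff_hull_sub.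
- split; last 1 first.
  + by rewrite -gl => y [x Lx <-]; exists x.
  + by move=> x Lx; rewrite -gl; exists x.
  + exact: inj.
Qed.

Section Bottom.
Variables (n : nat) (C : set 'rV[R]_n) (X : complex R) (phi : points X -> 'rV[R]_n).
Hypothesis Cc : cone C.

Lemma faces_realized p : complex_isom (X := X) (Y := bottom_complex C) phi ->
  faces X p -> exists2 G, faces (bottom_complex C) G & realizes (cell_of X p) phi G.
Proof. by move=> [_ H] /H [q Yq Hq]; exists q. Qed.

(** An isomorphism sends faces into bottom faces and is a bijection on points, but does not provide
    a preimage face. The barycentre [b] of a bottom facet [F] lies in the image [G0] of some face;
    [G0] meets [F] in a face containing [b], hence contains [F], and maximality gives equality.
    Smaller bottom faces are then pulled back from facets. *)
Lemma bottom_faces_hit : lattice_complex X -> faces X !=set0 ->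
  complex_isom (X := X) (Y := bottom_complex C) phi ->
  forall G, faces (bottom_complex C) G -> exists2 p, faces X p & G = phi @` p.
Proof.
move=> XL [p0 Xp0] iso; have [[_ _ faceX _] _ _] := XL.
have faceG p G E : faces X p -> realizes (cell_of X p) phi G -> face G E ->
    exists2 q, faces X q & E = phi @` q.
  move=> Xp /(realizes_data (lattice_complex_cell XL Xp)) [_ [g [r [[ga ra] rg <- gp _]]]] GE.
  have [fE gE] := face_preimage ga GE; exists (chart_of p @` (polytope_of p `&` g @^-1` E)).
    exact: faceX.
  rewrite -[LHS]gE; apply/seteqP; split=> [_ [x [Px Ex] <-]|_ [_ [x [Px Ex] <-] <-]].
    by exists (chart_of p x); [exists x|rewrite gp].
  by exists x; rewrite ?gp.
move=> G [->|[F bF FG]].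
  have [G0 _ rG0] := faces_realized iso Xp0; exact: faceG Xp0 rG0 (face_set0 _).
have fF : faces (bottom_complex C) F by right; exists F => //; apply: face_refl.
have [c bc FE] := (bottom_facetP Cc F).1 bF; have [[z zt] c1 _] := bc.
have [H HP] := tight_seq Cc; have tE := HP c c1.
have [|b bF' bmax] := @barycentre _ _ [seq h <- H | pr c h == 1].
  by move: zt; rewrite tE; case: [seq _ <- _ | _].
rewrite -tE -FE in bF' bmax.
have [[phif phii phis] _] := iso.
have [|y [p Xp py] yb] := phis b; first by exists F.
have [G0 fG0 rG0] := faces_realized iso Xp.
have [pG0 _] := realizes_data (lattice_complex_cell XL Xp) rG0.
have G0b : G0 b by rewrite -pG0 -yb; exists y.
have FG0 : F `&` G0 = F by apply: bmax; [exact: (bottom_face_setI Cc)|split].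
suff EG0 : G0 = F by apply: faceG Xp rG0 _; rewrite EG0.
have sF : F `<=` G0 by rewrite -FG0 => x [].
case: fG0 => [G00|[F' /(bottom_facetP Cc) [c' bc' F'E] F'G]]; first by rewrite G00 in G0b.
have FF' : F = F'.
  rewrite FE F'E; congr conv_hull; apply: (bottom_functional_inj bc bc').
  by rewrite -FE -F'E => x /sF /(face_sub F'G).
by apply: bmax => //; rewrite FF'.
Qed.

(** Every axiom for [X] is transported from the bottom complex, where intersections of faces are
    faces and all lattices come from the same ambient one. Injectivity on points makes a face
    recoverable from its image. *)
Lemma realization : (forall p, faces X p -> cell_ok (cell_of X p) p) ->
  set_inj (carrier X) phi ->
  (forall p, faces X p -> exists2 G, faces (bottom_complex C) G & realizes (cell_of X p) phi G) ->
  (forall G, faces (bottom_complex C) G -> exists2 p, faces X p & G = phi @` p) ->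
  lattice_complex X /\ complex_isom (X := X) (Y := bottom_complex C) phi.
Proof.
move=> okX phii realX hitX.
have imX p G : faces X p -> realizes (cell_of X p) phi G -> phi @` p = G.
  by move=> Xp rG; have [] := realizes_data (okX p Xp) rG.
have inX p x : faces X p -> p x -> carrier X x by exists p.
have memX p G y : faces X p -> realizes (cell_of X p) phi G -> carrier X y -> G (phi y) -> p y.
  move=> Xp rG Xy; rewrite -(imX p G Xp rG) => -[z pz] /phii zy.
  by rewrite -zy ?inE //; apply: inX pz.
have injX p q : faces X p -> faces X q -> phi @` p = phi @` q -> p = q.
  move=> Xp Xq pq; have sub p1 p2 : faces X p1 -> faces X p2 -> phi @` p1 `<=` phi @` p2 -> p1 `<=` p2.
    move=> X1 X2 p12 x p1x; have [|z p2z zx] := p12 (phi x); first by exists x.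
    suff -> : x = z by []. by apply: phii; rewrite ?inE //; [exact: inX p1x|exact: inX p2z].
  by apply/seteqP; split; apply: sub => //; rewrite pq.
split; last first.
  split; last by move=> p /realX [G fG rG]; exists G.
  split=> //.
    by move=> x [p Xp px]; have [G fG rG] := realX p Xp; exists G; rewrite // -(imX p G) //; exists x.
  by move=> y [G /hitX [p Xp ->] [x px <-]]; exists x => //; apply: inX px.
split.
- split.
  + pose h G := xget set0 [set p | faces X p /\ phi @` p = G].
    apply: (@sub_finite_set _ _ (h @` faces (bottom_complex C))).
      move=> p Xp; have [G fG rG] := realX p Xp; exists G => //; rewrite /h.
      case: xgetP => [q _ [Xq qG]|/(_ p) []]; last by split=> //; apply: imX.
      by apply: injX => //; rewrite qG (imX p G).
    exact/finite_image/finite_bottom_face.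
  + by move=> p /okX [].
  + move=> p F Xp pF; have [G fG rG] := realX p Xp.
    have [pG [g [r [[ga ra] rg gG gp _]]]] := realizes_data (okX p Xp) rG.
    have fE : face G (g @` F).
      by rewrite -gG; apply: face_image ra _ pF => x Px; apply/rg/aff_hull_sub.
    have [q Xq qE] := hitX _ (bottom_face_face Cc fG fE).
    suff -> : chart_of p @` F = q by [].
    have [_ [cf _ _] _ _ _] := okX p Xp.
    apply/seteqP; split=> [_ [x Fx <-]|y qy].
      have Px := face_sub pF Fx; have [Gq fGq rGq] := realX q Xq.
      apply: (memX q Gq) => //; first by apply: inX (cf x Px).
      by rewrite -(imX q Gq) // -qE; exists x => //; rewrite gp.
    have : (phi @` q) (phi y) by exists y.
    rewrite -qE => -[x Fx]; have Px := face_sub pF Fx; rewrite gp // => /phii E.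
    exists x => //; apply: E; rewrite inE; [exact: inX (cf x Px)|exact: inX qy].
  + move=> p q Xp Xq; have [Gp fGp rGp] := realX p Xp; have [Gq fGq rGq] := realX q Xq.
    have [pG [gp [rp [[gpa rpa] rgp gpG gpp _]]]] := realizes_data (okX p Xp) rGp.
    have [qG [gq [rq [[gqa rqa] rgq gqG gqp _]]]] := realizes_data (okX q Xq) rGq.
    have [_ [cpf cpi cps] _ _ _] := okX p Xp; have [_ [cqf cqi cqs] _ _ _] := okX q Xq.
    have fp : face (gp @` polytope_of p) (Gp `&` Gq) by rewrite gpG; apply: bottom_face_setI.
    have fq : face (gq @` polytope_of q) (Gp `&` Gq).
      by rewrite gqG setIC; apply: bottom_face_setI.
    have [fF FE] := face_preimage gpa fp; have [fG GE] := face_preimage gqa fq.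
    (* The chart change goes through the ambient space: into it by [gp] and back by the left inverse
       of [gq]. *)
    exists (polytope_of p `&` gp @^-1` (Gp `&` Gq)), (polytope_of q `&` gq @^-1` (Gp `&` Gq)), (rq \o gp).
    have half p1 q1 (G1 G2 : set 'rV[R]_n) (g1 : 'rV[R]_(cell_dim (cell_of X p1)) -> 'rV[R]_n) :
        faces X p1 -> faces X q1 -> realizes (cell_of X p1) phi G1 -> realizes (cell_of X q1) phi G2 ->
        g1 @` polytope_of p1 = G1 ->
        (forall x, polytope_of p1 x -> g1 x = phi (chart_of p1 x)) ->
        p1 `&` q1 = chart_of p1 @` (polytope_of p1 `&` g1 @^-1` (G1 `&` G2)).
      move=> X1 X2 r1 r2 gG1 gE1; have [_ [cf _ cs] _ _ _] := okX p1 X1.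
      apply/seteqP; split=> [y [p1y q1y]|_ [x [Px [_ gx]] <-]].
        have [x Px xy] := cs y p1y; exists x => //; split=> //=; rewrite gE1 // /chart_of xy.
        by split; [rewrite -(imX p1 G1)|rewrite -(imX q1 G2)] => //; exists y.
      split; first exact: cf.
      by apply: (memX q1 G2) => //; [apply: inX (cf x Px)|rewrite -gE1].
    have chq x y : polytope_of p x -> polytope_of q y -> gp x = gq y -> chart_of q y = chart_of p x.
      move=> Px Qy; rewrite gpp // gqp // => /phii E; symmetry; apply: E; rewrite inE.
        exact: inX (cpf x Px).
      exact: inX (cqf y Qy).
    have lift x : polytope_of p x -> (Gp `&` Gq) (gp x) ->
        exists2 y, (polytope_of q `&` gq @^-1` (Gp `&` Gq)) y & gq y = gp x /\ rq (gp x) = y.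
      move=> Px gx; have : (gq @` polytope_of q) (gp x) by rewrite gqG; case: gx.
      move=> [y Qy yx]; exists y; first by split=> //=; rewrite yx.
      by split=> //; rewrite -yx rgq //; apply: aff_hull_sub.
    split.
    * by [].
    * exact: half.
    * by rewrite setIC [Gp `&` _]setIC; apply: half.
    * split; first exact: affine_comp.
      split.
      -- by move=> x [Px gx] /=; have [y Gy [_ ->]] := lift x Px gx.
      -- move=> x x' /set_mem [Px gx] /set_mem [Px' gx'] /=.
         have [y _ [yx ->]] := lift x Px gx; have [y' _ [yx' ->]] := lift x' Px' gx' => yy'.
         have e : gp x = gp x' by rewrite -yx -yx' yy'.
         by rewrite -[LHS](rgp x (aff_hull_sub Px)) e rgp //; apply: aff_hull_sub.
      -- move=> y [Qy gy]; have : (gp @` polytope_of p) (gq y) by rewrite gpG; case: gy.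
         move=> [x Px xy].
         exists x; first by split=> //=; rewrite xy.
         by rewrite /= xy rgq //; apply: aff_hull_sub.
    * move=> x [Px gx] /=; have [y [Qy _] [yx ->]] := lift x Px gx.
      exact: chq.
- by move=> p /okX [].
- move=> p q F G g Xp Xq [[fF fG] pqF pqG [ga [gf gi gs]] gch].
  have [Gp fGp rGp] := realX p Xp; have [Gq fGq rGq] := realX q Xq.
  have [pG [gp [rp [[gpa rpa] rgp gpG gpp gpL]]]] := realizes_data (okX p Xp) rGp.
  have [qG [gq [rq [[gqa rqa] rgq gqG gqp gqL]]]] := realizes_data (okX q Xq) rGq.
  have [_ _ Lp _ _] := okX p Xp; have [_ _ Lq _ _] := okX q Xq.
  (* Any transition map commutes with the maps into the ambient space, first on [F] and then on its
     affine hull, where both lattices become ambient integral points. *)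
  have gE x : F x -> gq (g x) = gp x.
    move=> Fx; have Px := face_sub fF Fx; have Qx := face_sub fG (gf _ Fx).
    by rewrite (gpp _ Px) (gqp _ Qx); congr phi; apply: gch.
  have gEa x : aff_hull F x -> gq (g x) = gp x.
    move=> [k [y [c [yF c1 ->]]]]; rewrite !affine_comb //; apply: eq_bigr => i _.
    by rewrite gE.
  have gaff : g @` aff_hull F = aff_hull G.
    rewrite aff_hull_image //; congr aff_hull; apply/seteqP; split=> [_ [x Fx <-]|y /gs//].
    exact: gf.
  have Faff : aff_hull F `<=` aff_hull (polytope_of p) := aff_hull_mono (face_sub fF).
  have Gaff : aff_hull G `<=` aff_hull (polytope_of q) := aff_hull_mono (face_sub fG).
  have gpaff : gp @` aff_hull (polytope_of p) = aff_hull Gp by rewrite aff_hull_image // gpG.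
  have gqaff : gq @` aff_hull (polytope_of q) = aff_hull Gq by rewrite aff_hull_image // gqG.
  apply/seteqP; split=> [_ [x [Lx Fx] <-]|y [Ly Gy]].
    have Gx : aff_hull G (g x) by rewrite -gaff; exists x.
    split=> //; have : (int_points n `&` aff_hull Gq) (gq (g x)).
      split; last by rewrite -gqaff; exists (g x) => //; apply: Gaff.
      by rewrite gEa //; have : (gp @` lattice_of p) (gp x) by [exists x]; rewrite gpL => -[].
    rewrite -gqL => -[z Lz zx]; rewrite -(rgq (g x)); last exact: Gaff.
    by rewrite -zx rgq //; apply: Lq.
  have := Gy; rewrite -gaff => -[x Fx xy]; exists x => //; split=> //.
  have : (int_points n `&` aff_hull Gp) (gp x).
    split; last by rewrite -gpaff; exists x => //; apply: Faff.
    by rewrite -gEa // xy; have : (gq @` lattice_of q) (gq y) by [exists y]; rewrite gqL => -[].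
  rewrite -gpL => -[z Lz zx]; rewrite -(rgp x); last exact: Faff.
  by rewrite -zx rgp //; apply: Lp.
Qed.

End Bottom.
End Realization.

(** * Conic gluings of complexes *)

Section Facets.
Context {R : realType}.

Lemma dim_affine_le n m (g : 'rV[R]_n -> 'rV[R]_m) P x0 : affine_map g ->
  (\dim (vspan [set (y - g x0)%R | y in g @` P]) <= \dim (vspan [set (y - x0)%R | y in P]))%N.
Proof.
move=> [f [b gE]]; set U := vspan [set y - x0 | y in P].
apply: leq_trans (_ : \dim (linfun f @: U) <= _)%N; last first.
  by rewrite -(limg_ker_dim (linfun f) U) leq_addl.
apply: dimvS; apply: vspan_sub => _ [_ [x Px <-] <-].
have -> : g x - g x0 = linfun f (x - x0).
  by rewrite lfunE !gE [RHS]linearB opprD addrACA subrr addr0.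
by apply: memv_img; apply: mem_vspan; exists x.
Qed.

Lemma has_dim_affine n m (g : 'rV[R]_n -> 'rV[R]_m) (r : 'rV[R]_m -> 'rV[R]_n) P k :
  affine_map g -> affine_map r -> (forall x, P x -> r (g x) = x) ->
  has_dim P k <-> has_dim (g @` P) k.
Proof.
move=> ga ra rg; have rgP : r @` (g @` P) = P.
  apply/seteqP; split=> [_ [_ [x Px <-] <-]|x Px]; first by rewrite rg.
  by exists (g x); [exists x|exact: rg].
have eqd x0 : P x0 -> \dim (vspan [set y - x0 | y in P]) =
    \dim (vspan [set (y - g x0)%R | y in g @` P]).
  move=> Px0; apply/eqP; rewrite eqn_leq dim_affine_le // andbT.
  by have := dim_affine_le (g @` P) (g x0) ra; rewrite rgP rg.
split=> Pk; have [y] := has_dim_nonempty Pk.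
  move=> Py; have gy : (g @` P) (g y) by exists y.
  by apply/(has_dimP _ gy); rewrite -eqd //; apply/(has_dimP _ Py).
move=> [x Px _]; have gx : (g @` P) (g x) by exists x.
by apply/(has_dimP _ Px); rewrite eqd //; apply/(has_dimP _ gx).
Qed.

Section Cone.
Variables (n : nat) (C : set 'rV[R]_n).
Hypothesis Cc : cone C.

Lemma complex_facet_bottom F : complex_facet (X := bottom_complex C) F ->
  F = set0 \/ bottom_facet C F.
Proof.
move=> [[->|[F' bF' /face_sub sF] Fmax]]; first by left.
right; rewrite -(Fmax F') //; right; exists F' => //; exact: face_refl.
Qed.

Lemma bottom_facet_complex F : bottom_facet C F -> complex_facet (X := bottom_complex C) F.
Proof.
move=> bF; split; first by right; exists F => //; exact: face_refl.
have /(bottom_facetP Cc) [c bc FE] := bF; have [[x xt] _ _] := bc.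
move=> q [->|[F' /(bottom_facetP Cc) [c' bc' F'E] /face_sub qF']] Fq.
  by have := Fq x; rewrite FE => /(_ (conv_hull_sub xt)).
have FF' : F = F'.
  rewrite FE F'E; congr conv_hull; apply: (bottom_functional_inj bc bc').
  by rewrite -FE -F'E => y /Fq /qF'.
by apply/seteqP; split=> //; rewrite FF'.
Qed.

(** A bottom functional of [C] is at least 1 on the lattice points of the face [F], but its tight
    points in [F] need not span [F]. [bottom_functional_above] tilts it to a bottom functional of
    [F] without losing tight points. *)
Lemma bottom_carrier_face t : (forall x, C x -> 0 <= pr t x) ->
  let F := C `&` [set x | pr t x = 0] in
  forall x, carrier (bottom_complex C) x -> F x -> carrier (bottom_complex F) x.
Proof.
move=> tC F x [G [->//|[E /(bottom_facetP Cc) [c [c0 c1 _] EE] /face_sub GE]] /GE].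
rewrite EE => xc [_ tx]; have Fc : cone F by apply: cone_face.
have ptsF y : pts F y <-> pts C y /\ pr t y = 0.
  split=> [/ptsP [[Cy ty] yi y0]|[/ptsP [Cy yi y0] ty]]; last exact/ptsP.
  by split=> //; apply/ptsP.
have tF : tight C c `&` [set x | pr t x = 0] = tight F c.
  apply/seteqP; split=> y; first by move=> [[yp y1] ty]; split=> //; apply/ptsF.
  by move=> [/ptsF [yp ty] y1].
have xF : conv_hull (tight F c) x.
  rewrite -tF -conv_hull_face; first by split.
  by move=> y [/ptsP [/tC]].
have [||c' bc' tt'] := @bottom_functional_above _ _ _ Fc c.
- by move=> y /ptsF [/c1].
- exact: aff_hull_neq0 (conv_hull_aff xF).
exists (conv_hull (tight F c')); last exact: conv_hullS xF.
right; exists (conv_hull (tight F c')); last exact: face_refl.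
by apply/(bottom_facetP Fc); exists c'.
Qed.

Lemma bottom_carrier_sub x : carrier (bottom_complex C) x -> C x.
Proof. by move=> [G fG Gx]; apply: (hull_pts_sub Cc); apply: bottom_face_sub Gx. Qed.

Section Lattice.
Variables B B' : 'M[R]_n.
Hypothesis BB : lattice_inverse B B'.

Lemma face_imx P G : face (imx P B) G <-> exists2 E, face P E & G = imx E B.
Proof.
split=> [fG|[E PE ->]].
  have [fE GE] := face_preimage (affine_mulmx B) fG.
  by exists (P `&` (fun x => x *m B) @^-1` G).
apply: (face_image (affine_mulmx B')) => // x _; exact: (lattice_mulK BB).
Qed.

Lemma bottom_facet_imx F : bottom_facet (imx C B) F <->
  exists2 E, bottom_facet C E & F = imx E B.
Proof.
rewrite (bottom_facetP (cone_imx BB Cc)); split=> [[c /(bottom_functional_imx BB) bc ->]|].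
  exists (conv_hull (tight C (B *m c))); first by apply/(bottom_facetP Cc); exists (B *m c).
  by rewrite (tight_imx BB) /imx -conv_hull_image //; exact: affine_mulmx.
move=> [E /(bottom_facetP Cc) [c bc ->] ->]; exists (B' *m c).
  by apply/(bottom_functional_imx BB); rewrite mulmxA; case: BB => _ _ -> _; rewrite mul1mx.
rewrite (tight_imx BB) mulmxA; case: BB => _ _ -> _.
by rewrite mul1mx /imx -conv_hull_image //; exact: affine_mulmx.
Qed.

Lemma Hilb_imx G : Hilb (cone_over G) `<=` G -> Hilb (cone_over (imx G B)) `<=` imx G B.
Proof.
have co x : cone_over (imx G B) x <-> cone_over G (x *m B').
  split=> [[c [_ [c0 [y Gy <-] ->]]]|[c [y [c0 Gy e]]]].
    by exists c, y; split=> //; rewrite -scalemxAl (lattice_mulK BB).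
  exists c, (y *m B); split=> //; first by exists y.
  by rewrite scalemxAl -e (lattice_mulVK BB).
have lm x : lattice_monoid (cone_over (imx G B)) x <-> lattice_monoid (cone_over G) (x *m B').
  split=> -[/co Gx xi]; split=> //; first exact/(int_points_lattice (lattice_inverseC BB)).
  by rewrite -(int_points_lattice (lattice_inverseC BB)).
move=> HG x [/lm xm x0 xH]; apply/(mem_imx BB)/HG; split=> //.
  by apply: contraNneq x0 => x0; rewrite -(lattice_mulVK BB x) x0 mul0mx.
move=> y z ym zm xyz; have [|||y0|z0] := xH (y *m B) (z *m B).
- by apply/lm; rewrite (lattice_mulK BB).
- by apply/lm; rewrite (lattice_mulK BB).
- by rewrite -mulmxDl -xyz (lattice_mulVK BB).
- by left; rewrite -(lattice_mulK BB y) y0 mul0mx.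
- by right; rewrite -(lattice_mulK BB z) z0 mul0mx.
Qed.

End Lattice.
End Cone.

Lemma bottom_facet_glued n (C1 C2 : set 'rV[R]_n) B B' : lattice_inverse B B' ->
  cone C1 -> cone C2 -> let C := C1 `|` imx C2 B in cone C ->
  (forall c, bottom_functional C c <->
     bottom_functional C1 c \/ bottom_functional (imx C2 B) c) ->
  (forall c, bottom_functional C1 c -> tight C c = tight C1 c) ->
  (forall c, bottom_functional (imx C2 B) c -> tight C c = tight (imx C2 B) c) ->
  forall F, bottom_facet C F <->
    bottom_facet C1 F \/ exists2 E, bottom_facet C2 E & F = imx E B.
Proof.
move=> BB C1c C2c C Cc bC t1 t2 F; rewrite -(bottom_facet_imx C2c BB) (bottom_facetP Cc) (bottom_facetP C1c).
rewrite (bottom_facetP (cone_imx BB C2c)).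
split=> [[c /bC [bc|bc] ->]|[[c bc ->]|[c bc ->]]].
- by left; exists c; rewrite ?t1.
- by right; exists c; rewrite ?t2.
- by exists c; rewrite ?t1 //; apply/bC; left.
- by exists c; rewrite ?t2 //; apply/bC; right.
Qed.

Lemma bottom_face_glued n (C1 C2 : set 'rV[R]_n) B B' : lattice_inverse B B' ->
  cone C1 -> cone C2 -> let C := C1 `|` imx C2 B in
  (forall F, bottom_facet C F <->
    bottom_facet C1 F \/ exists2 E, bottom_facet C2 E & F = imx E B) ->
  forall G, faces (bottom_complex C) G <-> faces (bottom_complex C1) G \/
    exists2 E, faces (bottom_complex C2) E & G = imx E B.
Proof.
move=> BB C1c C2c C bC G; split=> [[->|[F /bC [bF|[E bE ->]]]]|[[->|[F bF FG]]|[E [->|[F bF FE]] ->]]].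
- by left; left.
- by move=> FG; left; right; exists F.
- by move=> /(face_imx BB) [E' EE' ->]; right; exists E' => //; right; exists E.
- by left.
- by right; exists F => //; apply/bC; left.
- by left; rewrite /imx image_set0.
- right; exists (imx F B); first by apply/bC; right; exists F.
  by apply/(face_imx BB); exists E.
Qed.

(** The minimum on a cone is 0, as the cone contains 0 and the double of each of its points. By
    dimension the functional does not vanish on all of [C]. *)
Lemma facet_cone d (C F : set 'rV[R]_d.+1) : cone C -> vspan C = fullv -> facet C F ->
  exists t, [/\ forall x, C x -> 0 <= pr t x, F = C `&` [set x | pr t x = 0],
    \dim (vspan F) = d & exists2 x, C x & pr t x != 0].
Proof.
move=> Cc Cf [/facePr [c [m [cm FE]]] [k [Fk Ck]]].
have aff0 (A : set 'rV[R]_d.+1) : A 0 -> aff_hull A 0 by apply: aff_hull_sub.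
have C0 := cone0 Cc; move: Ck => /(has_dim_linear _ (aff0 _ C0)).
rewrite Cf dimvf /dim /= mul1n => -[dk]; rewrite -dk in Fk.
have [x0 Fx0] := has_dim_nonempty Fk;
have [Cx0 /= cx0] : (C `&` [set x | pr c x = m]) x0 by rewrite -FE.
have m0 : m = 0.
  apply/eqP; rewrite eq_le; have := cm _ C0; rewrite pr0 => -> /=.
  have /cm : C (2 *: x0) by apply: coneZ.
  by rewrite prZ cx0; lra.
rewrite m0 in FE cm; have F0 : F 0 by rewrite FE; split; rewrite //= pr0.
have Fd := (has_dim_linear d (aff0 _ F0)).1 Fk.
exists c; split=> //.
apply: contrapT => H; have FC : F = C.
  rewrite FE; apply/seteqP; split=> x; first by case.
  move=> Cx; split=> //=.
  by have [//|cx] := eqVneq (pr c x) 0; exfalso; apply: H; exists x.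
have := (has_dim_linear d (aff0 _ C0)).1; rewrite -{1}FC => /(_ Fk).
rewrite Cf dimvf /dim /= mul1n => /eqP.
by rewrite -[X in _ == X]addn0 -addn1 eqn_add2l.
Qed.

(** A face of dimension [d] is mapped to a bottom face at height 1 over some functional, whose span
    therefore has dimension [d.+1]. *)
Lemma realization_full d (X : complex R) (C : set 'rV[R]_d.+1) (phi : points X -> 'rV[R]_d.+1) :
  lattice_complex X -> complex_dim X d -> conic_realization C phi -> vspan C = fullv.
Proof.
move=> XL [[p Xp pd] _] [Cc iso]; have [G fG rG] := faces_realized iso Xp.
have [_ [g [r [[ga ra] rg gG _ _]]]] := realizes_data (lattice_complex_cell XL Xp) rG.
have Gd : has_dim G d.
  rewrite -gG; apply/(has_dim_affine d ga ra) => // x Px; exact/rg/aff_hull_sub.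
have [x Gx] := has_dim_nonempty Gd.
have := fG => -[G0|[F /(bottom_facetP Cc) [c _ FE] /face_sub GF]]; first by rewrite G0 in Gx.
have Gd1 : \dim (vspan G) = d.+1.
  apply/(has_dim_height (f := c)) => // y /GF; rewrite FE.
  by apply: conv_hull_eq => z [].
apply/eqP; rewrite eqEdim subvf dimvf /dim /= mul1n.
apply: leq_trans (_ : (\dim (vspan G) <= _)%N); first by rewrite Gd1.
by apply: dimvS; apply: vspanS => y /(bottom_face_sub Cc fG) /(hull_pts_sub Cc).
Qed.

(** Lattice points of the span are differences of lattice points of the cone. In this way an
    isomorphism of monoids extends to the lattice of the wall hyperplane. *)
Lemma lattice_span n (F : set 'rV[R]_n) v z : deep F v -> lattice_monoid F v ->
  int_points n z -> z \in vspan F -> exists x k, lattice_monoid F x /\ z = x - v *+ k.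
Proof.
move=> Fv [_ vi] zi /Fv [K HK]; pose k := (Num.truncn K).+1.
have Kk : K <= k%:R by apply/ltW/truncnS_gt.
exists (z + v *+ k), k; split; last by rewrite addrK.
split; first by have := HK _ Kk; rewrite scaler_nat.
by apply: int_pointsD => //; rewrite -scaler_nat; apply: int_pointsZ; rewrite ?rpred_nat.
Qed.

End Facets.

Section MapCell.
Context {R : realType}.

Lemma cell_ok_map T T' (j : T -> T') (c : cell R T) p : injective j ->
  cell_ok c p -> cell_ok (map_cell j c) (j @` p).
Proof.
move=> ji [cp [cf ci cs] cl ca cv]; split=> //; split.
- by move=> x Px; exists (cell_chart c x) => //; apply: cf.
- by move=> x y xP yP /= /ji; apply: ci.
- by move=> _ [y /cs [x Px <-] <-]; exists x.
Qed.

Lemma realizes_map n T T' (j : T -> T') (c : cell R T) p (phi : T -> 'rV[R]_n)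
    (psi : T' -> 'rV[R]_n) G :
  cell_ok c p -> (forall x, p x -> psi (j x) = phi x) ->
  realizes c phi G -> realizes (map_cell j c) psi G.
Proof.
move=> [_ [cf _ _] _ _ _] jE [g [ga gb gE gl gL]]; exists g; split=> //.
by move=> x Px; rewrite gE //= jE //; apply: cf.
Qed.

Lemma realizes_imx n T (c : cell R T) p (phi : T -> 'rV[R]_n) G B B' :
  lattice_inverse B B' -> cell_ok c p -> realizes c phi G ->
  realizes c (fun x => phi x *m B) (imx G B).
Proof.
move=> BB cok rG; have [_ [g [r [[ga ra] rg gG gE gL]]]] := realizes_data cok rG.
have -> : imx G B = (fun x => g x *m B) @` cell_poly c.
  by rewrite -gG /imx image_comp.
apply: (realizes_intro cok).
- exact: (affine_comp (affine_mulmx B) ga).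
- move=> x y /set_mem Px /set_mem Py /(congr1 (mulmx^~ B')) /=.
  rewrite !(lattice_mulK BB) => gxy.
  by rewrite -(rg x) ?gxy ?rg //; apply: aff_hull_sub.
- by move=> x Px; rewrite gE.
- have -> : (fun x => g x *m B) @` cell_lat c = imx (g @` cell_lat c) B by rewrite /imx image_comp.
  have -> : (fun x => g x *m B) @` cell_poly c = imx (g @` cell_poly c) B by rewrite /imx image_comp.
  rewrite gL gG /imx -(aff_hull_image G (affine_mulmx B)).
  apply/seteqP; split=> [_ [x [xi Gx] <-]|y [yi [x Gx xE]]].
    by split; [exact/(int_points_lattice BB)|exists x].
  by exists x => //; split=> //; apply/(int_points_lattice BB); rewrite xE.
Qed.

End MapCell.

(** * The points of a glued complex and their map into the union of the cones *)

Section GluedComplex.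
Context {R : realType} (X1 X2 : complex R) (n : nat).
Variables (phi1 : points X1 -> 'rV[R]_n) (phi2 : points X2 -> 'rV[R]_n).
Variables (F1 : set 'rV[R]_n) (theta : 'rV[R]_n -> 'rV[R]_n) (B : 'M[R]_n).
Hypotheses (inj1 : set_inj (carrier X1) phi1) (inj2 : set_inj (carrier X2) phi2).
Hypothesis Binj : forall x y : 'rV[R]_n, x *m B = y *m B -> x = y.
Hypothesis BK : forall x, carrier (bottom_complex F1) x -> theta x *m B = x.
Hypothesis meet : forall x y, carrier X1 x -> carrier X2 y -> phi1 x = phi2 y *m B ->
  carrier (bottom_complex F1) (phi1 x) /\ phi2 y = theta (phi1 x).

Notation inl' := (glue_inl phi1 phi2 F1 theta).
Notation inr' := (glue_inr phi1 phi2 F1 theta).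
Notation pair := (glue_pair phi1 phi2 F1 theta).
Notation X := (conic_gluing phi1 phi2 F1 theta).

Lemma glue_inl_inj : injective inl'.
Proof.
move=> x x' e; have : inl' x (inl x) by [].
by rewrite e.
Qed.

Lemma glue_inr_inj : injective inr'.
Proof.
move=> x x' e; have : inr' x (inr x) by [].
by rewrite e.
Qed.

(** Two classes agree as sets only because partners are unique: in [X2] by injectivity of [phi2], in
    [X1] because [BK] recovers [phi1 x] from its image under [theta]. *)
Lemma glue_inlr x y : inl' x = inr' y <-> pair x y.
Proof.
split=> [e|xy]; first by have : inr' y (inr y) by []; rewrite -e.
have [X1x X2y Fx xyE] := xy.
apply/seteqP; split=> -[z|z] /=; rewrite /glue_inl /glue_inr /=.
- by move=> <-.
- move=> [_ X2z _ zE]; apply: inj2; rewrite ?inE //.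
  by rewrite zE xyE.
- move=> [X1z _ Fz zE]; apply: inj1; rewrite ?inE // -(BK Fx) -(BK Fz).
  by rewrite -zE -xyE.
- by move=> <-.
Qed.

Lemma conic_gluing_cell p : faces X p ->
  (exists2 q, faces X1 q & p = inl' @` q /\ cell_of X p = map_cell inl' (cell_of X1 q)) \/
  (exists2 q, faces X2 q & p = inr' @` q /\ cell_of X p = map_cell inr' (cell_of X2 q)).
Proof.
move=> Xp; rewrite /= ; case: asboolP => [[q X1q pE]|np].
  left; exists q => //; split=> //; rewrite pE; congr (map_cell _ (cell_of _ _)).
  apply/seteqP; split=> [x [y qy /glue_inl_inj <-]//|x qx]; by exists x.
case: Xp => [//|[q X2q pE]]; right; exists q => //; split=> //.
rewrite pE; congr (map_cell _ (cell_of _ _)).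
by apply/seteqP; split=> [x [y qy /glue_inr_inj <-]//|x qx]; exists x.
Qed.

(** On identified classes the first branch decides, and [BK] shows that the second would give the
    same value. The default 0 concerns sets that are not classes. *)
Definition glue_map (c : points X) : 'rV[R]_n :=
  match pselect (exists x, c = inl' x) with
  | left e => phi1 (projT1 (cid e))
  | right _ => match pselect (exists y, c = inr' y) with
    | left e => phi2 (projT1 (cid e)) *m B
    | right _ => 0
    end
  end.

Lemma glue_map_inl x : glue_map (inl' x) = phi1 x.
Proof.
rewrite /glue_map; case: pselect => [e|[]]; last by exists x.
by case: (cid e) => z /= /glue_inl_inj ->.
Qed.

Lemma glue_map_inr y : glue_map (inr' y) = phi2 y *m B.
Proof.
rewrite /glue_map; case: pselect => [e|_].
  case: (cid e) => z /= /esym /glue_inlr [_ _ Fz ->].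
  by rewrite BK.
case: pselect => [e|[]]; last by exists y.
by case: (cid e) => z /= /glue_inr_inj ->.
Qed.

Lemma glue_carrier c : carrier X c ->
  (exists2 x, carrier X1 x & c = inl' x) \/ (exists2 y, carrier X2 y & c = inr' y).
Proof.
move=> [p [[q Xq ->]|[q Xq ->]] [x qx <-]]; [left|right]; exists x => //; by exists q.
Qed.

Lemma glue_map_inj : set_inj (carrier X) glue_map.
Proof.
have mixed x y : carrier X1 x -> carrier X2 y -> phi1 x = phi2 y *m B -> inl' x = inr' y.
  move=> X1x X2y xy; apply/glue_inlr; have [Fx yE] := meet X1x X2y xy; by split.
move=> c c' /set_mem /glue_carrier [[x Xx ->]|[x Xx ->]] /set_mem /glue_carrier [[y Xy ->]|[y Xy ->]];
  rewrite ?glue_map_inl ?glue_map_inr => xy.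
- by congr inl'; apply: inj1; rewrite ?inE.
- exact: mixed.
- by symmetry; apply: mixed.
- by congr inr'; apply: inj2; rewrite ?inE //; apply: Binj.
Qed.

End GluedComplex.

Section PartA.
Context {R : realType}.

(** The last clause describes the facets of the glued bottom up to a unimodular map, which is what
    the reduced case needs: the condition on Hilbert bases is checked facet by facet. *)
Lemma conic_gluing_bottom (d : nat) (X1 X2 : complex R) (C1 C2 : set 'rV[R]_d.+1)
    (phi1 : points X1 -> 'rV[R]_d.+1) (phi2 : points X2 -> 'rV[R]_d.+1)
    (F1 F2 : set 'rV[R]_d.+1) (theta : {linear 'rV[R]_d.+1 -> 'rV[R]_d.+1}) :
  (0 < d)%N -> lattice_complex X1 -> lattice_complex X2 ->
  complex_dim X1 d -> complex_dim X2 d ->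
  facet C1 F1 -> facet C2 F2 -> lattice_isom F1 F2 theta ->
  conic_realization C1 phi1 -> conic_realization C2 phi2 ->
  exists (C : set 'rV[R]_d.+1) phi B B',
    [/\ lattice_inverse B B', lattice_complex (conic_gluing phi1 phi2 F1 theta),
      conic_realization (X := conic_gluing phi1 phi2 F1 theta) C phi
    & forall F, bottom_facet C F <->
        bottom_facet C1 F \/ exists2 E, bottom_facet C2 E & F = imx E B].
Proof.
move=> d0 XL1 XL2 Xd1 Xd2 fF1 fF2 [[thf thi ths] [[lmf lmi lms] _ _]] real1 real2.
have full1 := realization_full XL1 Xd1 real1; have full2 := realization_full XL2 Xd2 real2.
have [C1c iso1] := real1; have [C2c iso2] := real2.
have [t1 [tC1 F1E Fd1 x1]] := facet_cone C1c full1 fF1.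
have [t2 [tC2 F2E Fd2 x2]] := facet_cone C2c full2 fF2.
have F1c : cone F1 by rewrite F1E; apply: cone_face.
have F2c : cone F2 by rewrite F2E; apply: cone_face.
have F1t x : F1 x -> pr t1 x = 0 by rewrite F1E => -[].
have F2t x : F2 x -> pr t2 x = 0 by rewrite F2E => -[].
pose T := lin1_mx theta; have TE x : x *m T = theta x by rewrite mul_rV_lin1.
have TF : imx (C1 `&` [set x | pr t1 x = 0]) T = C2 `&` [set x | pr t2 x = 0].
  rewrite -F1E -F2E; apply/seteqP; split=> [_ [x Fx <-]|y /ths [x Fx <-]].
    by rewrite TE; apply: thf.
  by exists x; rewrite ?TE.
have [v1 v1F Fv1] := deep_ex F1c; have [v2 v2F Fv2] := deep_ex F2c.
(* [theta] respects only the lattice points of [F1]; differences of these exhaust the lattice of the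
   hyperplane. *)
have Ti z : int_points _ z -> pr t1 z = 0 -> int_points _ (z *m T).
  have [x0 _ tx0] := x1 => zi tz; have zF := ker_vspan Fd1 F1t tx0 tz.
  have [x [k [xF ->]]] := lattice_span Fv1 v1F zi zF.
  rewrite TE linearB linearMn; apply: int_pointsB; first by have [] := lmf _ xF.
  rewrite -scaler_nat; apply: int_pointsZ; first by rewrite rpred_nat.
  by have [] := lmf _ v1F.
have TS y : int_points _ y -> pr t2 y = 0 ->
    exists z, [/\ int_points _ z, pr t1 z = 0 & z *m T = y].
  have [x0 _ tx0] := x2 => yi ty; have yF := ker_vspan Fd2 F2t tx0 ty.
  have [x [k [xF ->]]] := lattice_span Fv2 v2F yi yF.
  have [a [aF ai] ax] := lms _ xF; have [b [bF bi] bv] := lms _ v2F.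
  exists (a - b *+ k); split.
  - apply: int_pointsB => //; rewrite -scaler_nat; apply: int_pointsZ => //.
  - by rewrite prB -scaler_nat prZ !F1t // mulr0 subr0.
  - by rewrite TE linearB linearMn /= ax bv.
have no (L : 'cV[R]_d.+1 -> Prop) l : (@set0 'cV[R]_d.+1) l -> L l by [].
have [B [B' [[BB Cc TB disj] [_ [bC tC1e tC2e]]]]] := cone_gluing d0 C1c C2c tC1 tC2 x1 x2
  (etrans (congr1 (fun F => \dim (vspan F)) (esym F1E)) Fd1)
  (etrans (congr1 (fun F => \dim (vspan F)) (esym F2E)) Fd2) TF Ti TS
  (finite_set0 _) (finite_set0 _) (no _) (no _).
set C := C1 `|` imx C2 B in Cc bC tC1e tC2e.
have bfC := bottom_facet_glued BB C1c C2c Cc bC tC1e tC2e.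
have [[p1 Xp1 _] _] := Xd1; have [[p2 Xp2 _] _] := Xd2.
have hit1 := bottom_faces_hit C1c XL1 (ex_intro _ p1 Xp1) iso1.
have hit2 := bottom_faces_hit C2c XL2 (ex_intro _ p2 Xp2) iso2.
have [[phif1 inj1 _] _] := iso1; have [[phif2 inj2 _] _] := iso2.
have BK x : carrier (bottom_complex F1) x -> theta x *m B = x.
  move=> /(bottom_carrier_sub F1c); rewrite F1E => -[C1x tx].
  by rewrite -TE; apply: TB.
have meet x y : carrier X1 x -> carrier X2 y -> phi1 x = phi2 y *m B ->
    carrier (bottom_complex F1) (phi1 x) /\ phi2 y = theta (phi1 x).
  move=> X1x X2y xy; have bx := phif1 _ X1x; have C1x := bottom_carrier_sub C1c bx.
  have C2y := bottom_carrier_sub C2c (phif2 _ X2y).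
  have C1y : C1 (phi2 y *m B) by rewrite -xy.
  have [ty tx] := disj _ C2y C1y; rewrite -xy in tx.
  have Fx : F1 (phi1 x) by rewrite F1E.
  split; first by rewrite F1E; apply: bottom_carrier_face => //; rewrite -F1E.
  have [|z Fz zy] := ths (phi2 y); first by rewrite F2E.
  rewrite -zy; congr (theta _); rewrite xy -zy -TE TB //; last exact: F1t.
  by move: Fz; rewrite F1E => -[].
have Binj (x y : 'rV[R]_d.+1) : x *m B = y *m B -> x = y.
  by move=> /(congr1 (mulmx^~ B')) /=; rewrite !(lattice_mulK BB).
pose X := conic_gluing phi1 phi2 F1 theta.
pose phi : points X -> 'rV[R]_d.+1 :=
  @glue_map R X1 X2 d.+1 phi1 phi2 F1 theta B.
have faceC := bottom_face_glued BB C1c C2c bfC.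
have phil x : phi (glue_inl phi1 phi2 F1 theta x) = phi1 x by apply: glue_map_inl.
have phir y : phi (glue_inr phi1 phi2 F1 theta y) = phi2 y *m B by apply: glue_map_inr.
have := @realization _ _ C X phi Cc.
case.
- move=> p /conic_gluing_cell [[q Xq [-> ->]]|[q Xq [-> ->]]].
  + by apply: cell_ok_map; [exact: glue_inl_inj|exact: lattice_complex_cell].
  + by apply: cell_ok_map; [exact: glue_inr_inj|exact: lattice_complex_cell].
- exact: glue_map_inj.
- move=> p /conic_gluing_cell [[q Xq [_ ->]]|[q Xq [_ ->]]].
  + have [G fG rG] := faces_realized iso1 Xq; exists G; first by apply/faceC; left.
    by apply: realizes_map rG => //; exact: lattice_complex_cell.
  + have [G fG rG] := faces_realized iso2 Xq; exists (imx G B).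
      by apply/faceC; right; exists G.
    have ok := lattice_complex_cell XL2 Xq.
    by apply: (realizes_map ok _ (realizes_imx BB ok rG)) => y _; apply: phir.
- move=> G /faceC [/hit1 [q Xq ->]|[E /hit2 [q Xq ->] ->]].
  + exists (glue_inl phi1 phi2 F1 theta @` q); first by left; exists q.
    by rewrite image_comp; apply: eq_imagel => x _ /=; rewrite phil.
  + exists (glue_inr phi1 phi2 F1 theta @` q); first by right; exists q.
    by rewrite /imx !image_comp; apply: eq_imagel => x _ /=; rewrite phir.
by move=> XL iso; exists C, phi, B, B'; split.
Qed.

Lemma conic_gluing_reduced (d : nat) (X1 X2 : complex R) (C1 C2 : set 'rV[R]_d.+1)
    (phi1 : points X1 -> 'rV[R]_d.+1) (phi2 : points X2 -> 'rV[R]_d.+1)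
    (F1 F2 : set 'rV[R]_d.+1) (theta : {linear 'rV[R]_d.+1 -> 'rV[R]_d.+1}) :
  (0 < d)%N -> lattice_complex X1 -> lattice_complex X2 ->
  complex_dim X1 d -> complex_dim X2 d ->
  facet C1 F1 -> facet C2 F2 -> lattice_isom F1 F2 theta ->
  reduced_conic_realization C1 phi1 -> reduced_conic_realization C2 phi2 ->
  is_reduced_bottom (conic_gluing phi1 phi2 F1 theta).
Proof.
move=> d0 XL1 XL2 Xd1 Xd2 fF1 fF2 th [r1 red1] [r2 red2].
have [C [phi [B [B' [BB XL rC bC]]]]] :=
  conic_gluing_bottom d0 XL1 XL2 Xd1 Xd2 fF1 fF2 th r1 r2.
split=> //; exists d.+1, C, phi; split=> // F /complex_facet_bottom [-> x [[[c [y []//]]]]|].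
move=> /bC [bF|[E bE ->]]; first by apply: red1; apply: bottom_facet_complex => //; case: r1.
by apply: (Hilb_imx BB); apply: red2; apply: bottom_facet_complex => //; case: r2.
Qed.

End PartA.

(** * Stacked complexes *)

Section Frames.
Context {R : realType}.

Lemma face_restrict n (P F G : set 'rV[R]_n) : G `<=` P -> face P F -> F `<=` G -> face G F.
Proof.
move=> GP /facePr [c [m [cm FE]]] FG; apply/facePr; exists c, m; split=> [x /GP/cm//|].
apply/seteqP; split=> x; first by move=> Fx; split; [exact: FG|move: Fx; rewrite FE => -[]].
by move=> [Gx xm]; rewrite FE; split=> //; apply: GP.
Qed.

Lemma facet_face n (P F : set 'rV[R]_n) : facet P F -> face P F.
Proof. by case. Qed.

(** Equal dimensions give equal direction spaces, so the functional that cuts [F] out of [E] is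
    constant on [E]. *)
Lemma facet_eq n (P E F : set 'rV[R]_n) : facet P E -> facet P F -> F `<=` E -> F = E.
Proof.
move=> [PE [k [Ek Pk]]] [PF [l [Fl Pl]]] FE.
have [x0 Fx0] := has_dim_nonempty Fl; have Ex0 := FE _ Fx0; have Px0 := face_sub PE Ex0.
have kl : k = l.
  have /(has_dimP _ Px0) hk := Pk; have /(has_dimP _ Px0) hl := Pl.
  by apply: succn_inj; rewrite -hk -hl.
have /facePr [c [m [cm FcE]]] := face_restrict (face_sub PE) PF FE.
have cF x : F x -> pr c x = m by rewrite FcE => -[].
apply/seteqP; split=> // x Ex; rewrite FcE; split=> //=.
have U : vspan [set y - x0 | y in F] = vspan [set y - x0 | y in E].
  apply/eqP; rewrite eqEdim vspanS => [|_ [y /FE Fy <-]]; last by exists y.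
  have /(has_dimP _ Ex0) hk := Ek; have /(has_dimP _ Fx0) hl := Fl.
  by rewrite hk hl kl leqnn.
have : x - x0 \in vspan [set y - x0 | y in F] by rewrite U; apply: mem_vspan; exists x.
move=> /(@pr_vspan _ _ _ c) h; have := h; rewrite prB (cF _ Fx0) => {}h.
by apply/eqP; rewrite -subr_eq0; apply/eqP/h => _ [y Fy <-]; rewrite prB !cF // subrr.
Qed.


Definition e0 {d} : 'cV[R]_d.+1 := delta_mx 0 0.

Lemma pr_e0 d (y : 'rV[R]_d.+1) : pr e0 y = y 0 0.
Proof. by rewrite /pr /e0 -colE mxE. Qed.

Lemma e0_int d : intmx (e0 : 'cV[R]_d.+1).
Proof. by move=> i j; rewrite mxE; case: (_ && _); rewrite ?rpred0 ?rpred1. Qed.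

(* Coordinates c in which the affine hull of P is the hyperplane of height 1 and the lattice
   L is its set of integral points; the inverse is the linear map M. *)
Definition frame {m d} (P L : set 'rV[R]_m) (c : 'rV[R]_m -> 'rV[R]_d.+1)
    (M : 'M[R]_(d.+1, m)) : Prop :=
  [/\ affine_map c, (fun y => y *m M) @` [set y | pr e0 y = 1] = aff_hull P,
      forall y, pr e0 y = 1 -> c (y *m M) = y
    & (fun y => y *m M) @` ([set y | pr e0 y = 1] `&` int_points d.+1) = L].

Lemma lattice_polytope_vertices n (L P : set 'rV[R]_n) : lattice_polytope L P ->
  exists2 s : seq 'rV[R]_n, P = conv_hull [set x | x \in s] &
    forall v, v \in s -> face P [set v] /\ L v.
Proof.
move=> [/polytope_vertices [s PE sv] PL]; exists s => // v /sv fv; split=> //.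
exact: PL.
Qed.

(** The rows of [M] are an origin of the lattice followed by a lattice basis. Vertices of [P] in [L]
    and [L] in the affine hull force both to have the same affine span, so the rank of the lattice
    is the dimension of [P]. *)
Lemma frame_ex m d (P L : set 'rV[R]_m) : L `<=` aff_hull P -> affine_lattice L ->
  lattice_polytope L P -> has_dim P d -> exists c M, @frame m d P L c M.
Proof.
move=> LP [x0 [k [b [bf LE]]]] /lattice_polytope_vertices [s PE sv] Pd.
have Lx0 : L x0.
  by rewrite LE; exists (fun=> 0); rewrite big1 ?addr0 // => i _; rewrite mulr0z.
have Lb i : L (x0 + tnth b i).
  rewrite LE; exists (fun j => (j == i)%:Z); congr (_ + _).
  by rewrite (bigD1 i) //= eqxx mulr1z big1 ?addr0 // => j /negPf ->; rewrite mulr0z.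
have LU x : L x -> x - x0 \in span b.
  rewrite LE => -[z ->]; rewrite addrC addKr; apply: memv_suml => i _.
  by rewrite -scaler_int memvZ // memv_span // mem_tnth.
have PU x : P x -> x - x0 \in span b.
  rewrite PE => -[l [y [a [ys _ a1 ->]]]].
  have -> : \sum_i a i *: y i - x0 = \sum_i a i *: (y i - x0).
    under [RHS]eq_bigr do rewrite scalerBr.
    by rewrite sumrB -scaler_suml a1 scale1r.
  by apply: memv_suml => i _; apply/memvZ/LU; have [] := sv _ (ys i).
have [p0 Pp0] := has_dim_nonempty Pd.
have affU x : aff_hull P x <-> x - x0 \in span b.
  have bU : (span b <= vspan [set y - p0 | y in P])%VS.
    apply/span_subvP => _ /tnthP [i ->].
    have /LP /(aff_hullP _ Pp0) h1 := Lb i; have /LP /(aff_hullP _ Pp0) h2 := Lx0.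
    by have := rpredB h1 h2; rewrite opprB addrA subrK addrC addKr.
  rewrite (aff_hullP _ Pp0); split=> h.
    rewrite -[x](subrK p0) -addrA rpredD ?PU //; move: h; apply: subvP.
    by apply: vspan_sub => _ [y Py <-]; rewrite -[y](subrK x0) -addrA -[x0 - p0]opprB rpredB ?PU.
  have /LP /(aff_hullP _ Pp0) h2 := Lx0.
  by rewrite -[x](subrK x0) -addrA rpredD //; move: h; apply: subvP.
have kd : k = d.
  move: Pd => /(has_dimP _ Pp0) <-; rewrite -(size_tuple b) -(eqP bf).
  congr (\dim _); apply/eqP; rewrite eqEsubv; apply/andP; split.
    apply/span_subvP => _ /tnthP [i ->].
    have /LP /(aff_hullP _ Pp0) h1 := Lb i; have /LP /(aff_hullP _ Pp0) h2 := Lx0.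
    by have := rpredB h1 h2; rewrite opprB addrA subrK addrC addKr.
  by apply: vspan_sub => _ [y Py <-]; rewrite -[y](subrK x0) -addrA -[x0 - p0]opprB rpredB ?PU.
case: d / kd in Pd *.
pose M : 'M[R]_(k.+1, m) := \matrix_i (if unlift ord0 i is Some j then tnth b j else x0).
have ME y : y *m M = y 0 0 *: x0 + \sum_i y 0 (lift ord0 i) *: tnth b i.
  rewrite mulmx_sum_row big_ord_recl rowK unlift_none; congr (_ + _).
  by apply: eq_bigr => i _; rewrite rowK liftK.
pose H := [set y : 'rV[R]_k.+1 | pr e0 y = 1].
have Minj : set_inj H (fun y => y *m M).
  move=> y z /set_mem y1 /set_mem z1; rewrite /H /= !pr_e0 in y1 z1.
  rewrite !ME y1 z1 => /addrI /eqP; rewrite -subr_eq0 -sumrB => /eqP h.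
  apply/rowP => j; case: (unliftP ord0 j) => [i ->|->]; last by rewrite y1 z1.
  apply/eqP; rewrite -subr_eq0; apply/eqP.
  have /freeP := bf => /(_ (fun i => y 0 (lift ord0 i) - z 0 (lift ord0 i))); apply.
  rewrite -[RHS]h; apply: eq_bigr => l _.
  by rewrite -tnth_nth scalerBl.
(* [M] is required to be injective at height 1 only, since [x0] may be dependent on the basis. *)
have [c ca cM] := affine_linv (affine_mulmx M) (@conv_eq _ _ e0 1) Minj.
exists c, M; split=> //.
- apply/seteqP; split=> [_ [y /= y1 <-]|x /affU xU].
    apply/affU; rewrite ME -pr_e0 y1 scale1r addrC addKr; apply: memv_suml => i _.
    by rewrite memvZ // memv_span // mem_tnth.
  exists (\row_j if unlift ord0 j is Some i then coord b i (x - x0) else 1).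
    by rewrite /= pr_e0 mxE unlift_none.
  have := coord_span xU => xE; rewrite ME mxE unlift_none scale1r -[RHS](subrK x0) addrC.
  congr (_ + _); rewrite xE; apply: eq_bigr => i _.
  by rewrite -xE mxE liftK (tnth_nth 0).
- by move=> y y1; apply: cM; apply: aff_hull_sub.
rewrite LE; apply/seteqP; split=> [_ [y [/= y1 yi] <-]|_ [z ->]].
  exists (fun i => Num.floor (y 0 (lift ord0 i))); rewrite ME -pr_e0 y1 scale1r; congr (_ + _).
  by apply: eq_bigr => i _; rewrite -[RHS]scaler_int floorK.
exists (\row_j if unlift ord0 j is Some i then (z i)%:~R else 1).
  split; first by rewrite /= pr_e0 mxE unlift_none.
  by move=> j; rewrite mxE; case: unliftP => [i _|_]; rewrite ?intr_int ?rpred1.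
rewrite ME mxE unlift_none scale1r; congr (_ + _); apply: eq_bigr => i _.
by rewrite mxE liftK scaler_int.
Qed.

(** * The cone over a lattice polytope at height 1 *)

Section Frame.
Variables (m d : nat) (P L : set 'rV[R]_m) (c : 'rV[R]_m -> 'rV[R]_d.+1) (M : 'M[R]_(d.+1, m)).
Hypotheses (fr : frame P L c M) (Pv : lattice_polytope L P) (P0 : P !=set0).

Lemma frame_affine : affine_map c. Proof. by case: fr. Qed.

Lemma frameK x : aff_hull P x -> c x *m M = x.
Proof. by case: fr => _ <- cM _ [y y1 <-]; rewrite cM. Qed.

Lemma frame_height x : aff_hull P x -> pr e0 (c x) = 1.
Proof. by case: fr => _ <- cM _ [y y1 <-]; rewrite cM. Qed.

Lemma frame_aff y : pr e0 y = 1 -> aff_hull P (y *m M).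
Proof. by case: fr => _ <- _ _ y1; exists y. Qed.

Lemma frameVK y : pr e0 y = 1 -> c (y *m M) = y.
Proof. by case: fr => _ _ cM _; apply: cM. Qed.

Lemma frame_lat y : pr e0 y = 1 -> int_points _ y -> L (y *m M).
Proof. by case: fr => _ _ _ <- y1 yi; exists y. Qed.

Lemma frame_int x : L x -> int_points _ (c x).
Proof. by case: fr => _ _ cM <- [y [y1 yi] <-]; rewrite cM. Qed.

Lemma frame_poly x : P x -> c x *m M = x /\ pr e0 (c x) = 1.
Proof. by move=> /aff_hull_sub Px; rewrite frameK // frame_height. Qed.

Let D := cone_over (c @` P).

Lemma frame_cone_sub x : P x -> D (c x).
Proof. by move=> Px; exists 1, (c x); rewrite scale1r ler01; split=> //; exists x. Qed.

Lemma frame_coneP y : D y <-> exists a x, [/\ 0 <= a, P x & y = a *: c x].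
Proof.
split=> [[a [_ [a0 [x Px <-] ->]]]|[a [x [a0 Px ->]]]]; first by exists a, x.
by exists a, (c x); split=> //; exists x.
Qed.

Lemma frame_cone_height a x : P x -> pr e0 (a *: c x) = a.
Proof. by move=> Px; rewrite prZ (frame_poly Px).2 mulr1. Qed.

Lemma frame_gens : exists (s : seq 'rV[R]_m), [/\ forall v, v \in s -> P v /\ L v,
  P = conv_hull [set x | x \in s] & D = cone_hull (fun i : 'I_(size s) => c s`_i)].
Proof.
have [s PE sv] := lattice_polytope_vertices Pv; exists s; split=> //.
  by move=> v /sv [/face_sub vP Lv]; split=> //; apply: vP.
have ca := frame_affine.
apply/seteqP; split=> y.
  move=> /frame_coneP [a [x [a0 + ->]]]; rewrite PE => /conv_hull_seqP [w [w0 w1 ->]].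
  rewrite affine_comb //; apply: cone_hullZ => //; by exists (w 0).
have [x0 Px0] := P0; move=> [a [a0 ->]]; apply/frame_coneP.
have : 0 <= \sum_i a i by apply: sumr_ge0.
rewrite le_eqVlt eq_sym => /orP [/eqP S0|S0].
  exists 0, x0; split=> //; rewrite scale0r big1 // => i _.
  have /psumr_eq0P -> // := S0; by rewrite scale0r.
have S1 : \sum_i a i / (\sum_i a i) = 1 by rewrite -mulr_suml divff // gt_eqF.
exists (\sum_i a i), (\sum_(i < size s) (a i / \sum_i a i) *: s`_i); split=> //.
- exact: ltW.
- rewrite PE; exists (size s), (fun i => s`_i), (fun i => a i / \sum_i a i); split=> //.
    by move=> i; apply: mem_nth.
  by move=> i; rewrite divr_ge0 // ltW.
- rewrite affine_comb // scaler_sumr; apply: eq_bigr => i _.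
  by rewrite scalerA mulrC divfK // gt_eqF.
Qed.

Lemma frame_cone : cone D.
Proof.
have [s [sv PE DE]] := frame_gens.
apply: (cone_intro _ _ DE) => [i|y].
  by apply: frame_int; have [] := sv _ (mem_nth 0 (ltn_ord i)).
rewrite -DE => /frame_coneP [a [x [a0 Px ->]]] /frame_coneP [b [z [b0 Pz]]].
move=> /(congr1 (pr e0)); rewrite prN !frame_cone_height // => ab.
by have -> : a = 0 by [lra]; rewrite scale0r.
Qed.

Lemma frame_e0_ge1 y : pts D y -> 1 <= pr e0 y.
Proof.
move=> /ptsP [/frame_coneP [a [x [a0 Px ->]]] yi yn]; apply: int_ge1.
  by apply: pr_int yi; exact: e0_int.
rewrite frame_cone_height // lt_neqAle a0 andbT eq_sym.
by apply: contraNneq yn => ->; rewrite scale0r.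
Qed.

Lemma frame_tight : tight D e0 = c @` (P `&` L).
Proof.
apply/seteqP; split=> [y [/ptsP [/frame_coneP [a [x [a0 Px ->]]] yi yn]]|_ [x [Px Lx] <-]].
  rewrite /= frame_cone_height // => a1; rewrite a1 scale1r in yi *.
  exists x => //; split=> //; rewrite -(frame_poly Px).1; apply: frame_lat => //.
  exact: (frame_poly Px).2.
have h := (frame_poly Px).2; split=> //; apply/ptsP; split; first exact: frame_cone_sub.
  exact: frame_int.
by apply: contra_eq_neq h => ->; rewrite pr0 eq_sym oner_eq0.
Qed.

Lemma frame_bottom_functional : bottom_functional D e0.
Proof.
have [s [sv PE DE]] := frame_gens.
have [x0 Px0] := P0; split.
- move: Px0; rewrite PE => /conv_hull_aff/aff_hull_neq0 [y /sv ys].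
  by exists (c y); rewrite frame_tight; exists y.
- exact: frame_e0_ge1.
- move=> f ft x /ptsP [+ _ _]; rewrite DE => -[a [_ ->]].
  rewrite linear_sum big1 // => i _; rewrite linearZ /= ft ?mulr0 // frame_tight.
  by exists s`_i => //; apply: sv; apply: mem_nth.
Qed.

Lemma frame_full : vspan D = fullv.
Proof.
have [x0 Px0] := P0; apply/eqP; rewrite eqEsubv subvf; apply/subvP => y _.
have H z : pr e0 z = 1 -> z \in vspan D.
  move=> z1; rewrite -(frameVK z1); have := frame_aff z1.
  move=> [k [w [a [wP a1 ->]]]]; rewrite affine_comb //; last exact: frame_affine.
  by apply: memv_suml => i _; apply/memvZ/mem_vspan/frame_cone_sub.
have h := (frame_poly Px0).2.
rewrite -[y](addrK ((1 - pr e0 y) *: c x0)) rpredB ?rpredZ ?H //.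
by rewrite prD prZ h mulr1 addrC subrK.
Qed.

Lemma frame_hull : conv_hull (tight D e0) = c @` P.
Proof.
have [s [sv PE DE]] := frame_gens; rewrite frame_tight; apply/seteqP; split.
  apply: conv_hull_min => [|_ [x [Px _] <-]]; last by exists x.
  by rewrite {1}PE conv_hull_image; [exact: conv_hull_convex|exact: frame_affine].
rewrite PE conv_hull_image; last exact: frame_affine.
by apply: conv_hullS => _ [x /sv [Px Lx] <-]; exists x => //; rewrite -PE.
Qed.

(** Being at least 1 at the vertices, [f] is at least 1 on the polytope, hence at least the height
    on the cone. At tight points the height is then at most 1, and by integrality equal to 1; so [f]
    and [e0] agree where [f] is tight, and that spans. *)
Lemma frame_bottom_unique f : bottom_functional D f <-> f = e0.
Proof.
split=> [|->]; last exact: frame_bottom_functional.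
have [s [sv PE DE]] := frame_gens.
move=> [f0 f1 fd]; apply/eqP; rewrite -subr_eq0; apply/eqP/pr_eq0 => x.
have : x \in vspan (pts D) by rewrite vspan_pts ?frame_full ?memvf //; exact: frame_cone.
apply: pr_vspan; apply: fd => y yt; have := yt => -[yp /= fy].
suff e1 : pr e0 y = 1 by rewrite prBc fy e1 subrr.
apply/eqP; rewrite eq_le frame_e0_ge1 // andbT.
have /ptsP [/frame_coneP [a [z [a0 Pz yE]]] _ _] := yp.
rewrite yE frame_cone_height //.
have fz : 1 <= pr f (c z).
  have ca := frame_affine.
  have : conv_hull (c @` [set x | x \in s]) (c z).
    by rewrite -conv_hull_image // -PE; exists z.
  apply: conv_hull_ge => _ [w /sv [Pw Lw] <-]; apply: f1.
  have : tight D e0 (c w) by rewrite frame_tight; exists w.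
  by case.
by move: fy; rewrite yE prZ; nra.
Qed.

(** Homogenization: the bound [b] becomes the multiple [b *: e0] of the height. *)
Lemma frame_face F : face P F -> exists t, forall x, P x ->
  0 <= pr t (c x) /\ (pr t (c x) = 0 <-> F x).
Proof.
move=> /facePr [f [b [fb ->]]]; exists (M *m f - b *: e0) => x Px.
have [cx c1] := frame_poly Px.
rewrite prBc prZc c1 mulr1 -prMr cx; split; first by rewrite subr_ge0 fb.
split=> [/eqP|[_ /= ->]]; last by rewrite subrr.
by rewrite subr_eq0 => /eqP.
Qed.

End Frame.


End Frames.

(** * Normality and Hilbert bases *)

Section Normal.
Context {R : realType}.

(** A lattice point of the cone at height [k] splits by normality into [k] lattice points of height
    1; if it is indecomposable, it is one of them. *)
Lemma frame_normal m d (P L : set 'rV[R]_m) c (M : 'M[R]_(d.+1, m)) :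
  frame P L c M -> lattice_polytope L P -> P !=set0 -> normal_polytope L P ->
  Hilb (cone_over (c @` P)) `<=` c @` P.
Proof.
move=> fr Pv P0 nP y [[Dy yi] yn yH].
have [+ _ _] := frame_bottom_functional fr Pv P0.
rewrite (frame_tight fr) => -[_ [ z0 [Po Lo] _]].
have yp : pts (cone_over (c @` P)) y by apply/ptsP.
have /frame_coneP [a [x [a0 Px yE]]] := Dy.
have ae : pr e0 y = a by rewrite yE (frame_cone_height fr).
have : a \is a Num.nat.
  rewrite natrEint a0 andbT -ae; apply: pr_int => //; exact: e0_int.
move=> /natrP [k ak]; rewrite ak in yE.
have k1 : (0 < k)%N by have := frame_e0_ge1 fr yp; rewrite ae ak ler1n.
have ca := frame_affine fr.
(* Normality is stated relative to an origin, so the [k]-fold point is shifted by [k] times the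
   lattice point [z0]. *)
have [|| p [pP pS]] := nP z0 Lo k (k%:R *: (x - z0)).
- exists (k%:R *: x - (k%:R - 1) *: z0); last first.
    by apply/matrixP => i j; rewrite !mxE; ring.
  have -> : k%:R *: x - (k%:R - 1) *: z0 = (y - (k%:R - 1) *: c z0) *m M.
    by rewrite yE mulmxBl -!scalemxAl (frame_poly fr Px).1 (frame_poly fr Po).1.
  apply: (frame_lat fr).
    by rewrite prB prZ (frame_poly fr Po).2 ae ak; ring.
  apply: int_pointsB => //; apply: int_pointsZ; last exact: (frame_int fr).
  by rewrite rpredB ?rpred_nat ?rpred1.
- by exists (x - z0) => //; exists x.
have /choice [q' qP] : forall i, exists q, [/\ P q, L q & p i = q - z0].
  move=> i; have [[q1 Pq1 e1] [q2 Lq2 e2]] := pP i; exists q1; split=> //.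
  by move: e2; rewrite -e1 => /addIr <-.
have kn0 : k%:R != 0 :> R by rewrite pnatr_eq0 -lt0n.
have xE : k%:R *: x = \sum_i q' i.
  move: pS; rewrite (eq_bigr (fun i => q' i - z0)) => [|i _]; last by have [] := qP i.
  by rewrite sumrB sumr_const card_ord scalerBr -[z0 *+ k]scaler_nat => /addIr.
have yS : y = \sum_i c (q' i).
  have s1 : \sum_(i < k) k%:R^-1 = 1 :> R.
    by rewrite sumr_const card_ord -[_ *+ k]mulr_natl divff.
  have xS : x = \sum_i k%:R^-1 *: q' i.
    by rewrite -scaler_sumr -xE scalerA mulVf // scale1r.
  rewrite yE xS affine_comb // scaler_sumr; apply: eq_bigr => i _.
  by rewrite scalerA divff // scale1r.
case: k k1 => // k _ in p pP pS q' qP kn0 xE yS yE ak *.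
have Dq i : lattice_monoid (cone_over (c @` P)) (c (q' i)).
  have [Pq Lq _] := qP i; split; first exact: frame_cone_sub.
  exact: (frame_int fr).
have Dc := frame_cone fr Pv P0.
rewrite big_ord_recl in yS; have [Pq0 _ _] := qP ord0.
have [||e|e] := yH _ _ _ _ yS => //.
- by apply: big_ind => //; [exact: lattice_monoid0|move=> ? ?; exact: lattice_monoidD].
- have := (frame_poly fr Pq0).2; rewrite e pr0 => /esym/eqP; by rewrite oner_eq0.
- by rewrite yS e addr0; exists (q' ord0).
Qed.

(** Induction on an upper bound for [f]: both parts of a proper decomposition have value at least 1,
    so each loses at least 1. *)
Lemma Hilb_generates n (G : set 'rV[R]_n) f :
  (forall y, lattice_monoid (cone_over G) y -> y != 0 -> 1 <= pr f y) ->
  forall y, lattice_monoid (cone_over G) y -> exists s : seq 'rV[R]_n,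
    (forall h, h \in s -> Hilb (cone_over G) h) /\ y = \sum_(h <- s) h.
Proof.
move=> f1 y; have [m ym] : exists m, pr f y < m%:R by exists (Num.truncn (pr f y)).+1; apply: truncnS_gt.
elim: m y ym => [|m IH] y ym yM.
  have [->|yn] := eqVneq y 0; first by exists [::]; rewrite big_nil.
  by have := f1 y yM yn; lra.
have [->|yn] := eqVneq y 0; first by exists [::]; rewrite big_nil.
have [yH|yH] := pselect (Hilb (cone_over G) y).
  by exists [:: y]; rewrite big_seq1; split=> // h; rewrite inE => /eqP ->.
have [a [b [aM bM yab a0 b0]]] : exists a b, [/\ lattice_monoid (cone_over G) a,
    lattice_monoid (cone_over G) b, y = a + b, a != 0 & b != 0].
  apply: contrapT => H; apply: yH; split=> // a b aM bM yab.
  have [a0|a0] := eqVneq a 0; first by left.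
  have [b0|b0] := eqVneq b 0; first by right.
  by case: H; exists a, b.
have fa := f1 a aM a0; have fb := f1 b bM b0; rewrite yab prD -natr1 in ym.
have [||sa [saH aE]] := IH a => //; first by lra.
have [||sb [sbH bE]] := IH b => //; first by lra.
exists (sa ++ sb); rewrite big_cat -aE -bE; split=> // h.
by rewrite mem_cat => /orP [/saH|/sbH].
Qed.

(** A facet of [X] is carried onto a bottom facet [G]. A lattice point at height [k] over [G] is a
    sum of elements of the Hilbert basis; as these lie in [G], at height 1, there are [k] of them,
    and they pull back to lattice points of the polytope. *)
Lemma reduced_normal n (X : complex R) (C : set 'rV[R]_n) (phi : points X -> 'rV[R]_n) :
  lattice_complex X -> reduced_conic_realization C phi ->
  forall p : set (points X), complex_facet p -> normal_polytope (lattice_of p) (polytope_of p).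
Proof.
move=> XL [[Cc iso] red] p [Xp pmax] z0 Lo k z [w Lw wz] [_ [x Px <-] zE].
have ok := lattice_complex_cell XL Xp.
have [G fG rG] := faces_realized iso Xp.
have [pG [g [r [[ga ra] rg gG gE gL]]]] := realizes_data ok rG.
have Gx : G (g x) by rewrite -gG; exists x.
have [F bF FG] : exists2 F, bottom_facet C F & face F G.
  by case: fG => [G0|//]; rewrite G0 in Gx.
(* Maximality of [p] in [X] becomes maximality of its image because the bottom facet [F] is itself
   the image of a face of [X]. *)
have FG' : F = G.
  have fF : faces (bottom_complex C) F by right; exists F => //; apply: face_refl.
  have [q Xq Fq] := bottom_faces_hit Cc XL (ex_intro _ p Xp) iso fF.
  have [[_ phii _] _] := iso.
  suff qp : q = p by rewrite Fq qp pG.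
  apply: pmax => // a pa; have : (phi @` q) (phi a).
    by rewrite -Fq; apply: (face_sub FG); rewrite -pG; exists a.
  move=> [b qb] /phii <- //; rewrite inE; [by exists q|by exists p].
rewrite {F FG}FG' in bF; have [f [_ f1 _] GE] := (bottom_facetP Cc G).1 bF.
have Gf y : G y -> pr f y = 1 by rewrite GE; apply: conv_hull_eq => v [].
have GC : cone_over G `<=` C.
  move=> _ [a [y [a0 Gy ->]]]; apply: coneZ => //; apply: (hull_pts_sub Cc).
  exact: (bottom_face_sub Cc fG).
have HG := red G (bottom_facet_complex Cc bF).
have [_ _ Laff _ _] := ok.
have gint v : lattice_of p v -> int_points n (g v).
  by move=> Lv; have : (g @` lattice_of p) (g v) by [exists v]; rewrite gL => -[].
have yM : lattice_monoid (cone_over G) (k%:R *: g x).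
  split; first by exists k%:R, (g x); rewrite ler0n.
  have wE : w = k%:R *: x - (k%:R - 1) *: z0.
    rewrite -[LHS](subrK z0) wz zE; apply/matrixP => i j; rewrite !mxE; ring.
  have -> : k%:R *: g x = g w + (k%:R - 1) *: g z0.
    have [h [b hE]] := ga; rewrite !hE wE linearB !linearZ /=.
    by apply/matrixP => i j; rewrite !mxE; ring.
  apply: int_pointsD; first exact: gint.
  by apply: int_pointsZ; [rewrite rpredB ?rpred_nat ?rpred1|exact: gint].
have [|s [sH sE]] := @Hilb_generates _ G f _ _ yM.
  by move=> y [/GC Cy yi] yn; apply: f1; apply/ptsP.
have sG h : h \in s -> G h by move=> /sH /HG.
have sk : size s = k.
  apply/eqP; rewrite -(eqr_nat R); apply/eqP.
  have : pr f (k%:R *: g x) = k%:R by rewrite prZ Gf // mulr1.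
  rewrite sE linear_sum /= big_seq (eq_bigr (fun=> 1)) => [<-|h /sG /Gf //].
  by rewrite -big_seq big_const_seq count_predT iter_addr_0.
have hL h : h \in s -> exists v, [/\ polytope_of p v, lattice_of p v & g v = h].
  move=> hs; have Gh := sG h hs; have [[_ hi] _ _] := sH h hs.
  have : (g @` lattice_of p) h by rewrite gL; split=> //; apply: aff_hull_sub.
  move=> [v Lv vh]; exists v; split=> //.
  move: Gh; rewrite -gG => -[u Pu uh].
  by rewrite -(rg v (Laff _ Lv)) vh -uh rg //; apply: aff_hull_sub.
have [h [b rE]] := ra.
exists (fun i : 'I_k => r s`_i - z0); split.
  move=> i; have [|v [Pv Lv vh]] := hL s`_i; first by rewrite mem_nth ?sk.
  have -> : r s`_i = v by rewrite -vh rg //; apply: aff_hull_sub.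
  by split; exists v.
rewrite zE sumrB sumr_const card_ord scalerBr -[z0 *+ k]scaler_nat; congr (_ - _).
rewrite -[in LHS](rg x (aff_hull_sub Px)) rE scalerDr -linearZ /= sE linear_sum.
rewrite (eq_bigr (fun i : 'I_k => h s`_i + b)) => [|i _]; last exact: rE.
rewrite big_split /= sumr_const card_ord scaler_nat; congr (_ + _).
by rewrite (big_nth 0) big_mkord; move: sk => <-.
Qed.

End Normal.

(** * Realizing a stacked complex facet by facet *)

Section Stack.
Context {R : realType}.

Lemma vspan_imx n (A : set 'rV[R]_n) B B' : lattice_inverse B B' ->
  \dim (vspan (imx A B)) = \dim (vspan A).
Proof.
have le (A' : set 'rV[R]_n) (M : 'M[R]_n) : (\dim (vspan (imx A' M)) <= \dim (vspan A'))%N.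
  apply: leq_trans (_ : \dim (linfun (mulmxr M) @: vspan A') <= _)%N; last first.
    by rewrite -(limg_ker_dim (linfun (mulmxr M)) (vspan A')) leq_addl.
  apply: dimvS; apply: vspan_sub => _ [x Ax <-].
  have -> : x *m M = linfun (mulmxr M) x by rewrite lfunE.
  by apply: memv_img; apply: mem_vspan.
move=> BB; apply/eqP; rewrite eqn_leq le /=; apply: leq_trans (le (imx A B) B').
apply: dimvS; apply: vspanS => x Ax; exists (x *m B); first by exists x.
exact: lattice_mulK.
Qed.

Lemma vspan_cone_over n (A : set 'rV[R]_n) : vspan (cone_over A) = vspan A.
Proof.
apply/eqP; rewrite eqEsubv; apply/andP; split.
  by apply: vspan_sub => _ [a [x [_ Ax ->]]]; apply/memvZ/mem_vspan.
by apply: vspanS => x Ax; exists 1, x; rewrite scale1r ler01.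
Qed.

(** Compatibility of lattices of reference concerns affine hulls at height 1, while gluing cones
    needs the linear lattice of the wall. A lattice point [o] of height 1 reduces the latter to the
    former. *)
Lemma height_split d (A : set 'rV[R]_d.+1) o z : (forall y, A y -> pr e0 y = 1) ->
  A o -> int_points _ o -> int_points _ z -> z \in vspan A ->
  exists y m, [/\ int_points _ y, aff_hull A y, m \is a Num.int & z = y + m *: o].
Proof.
move=> A1 Ao oi zi zA; have zm : pr e0 z \is a Num.int by apply: pr_int => //; exact: e0_int.
have mi : pr e0 z - 1 \is a Num.int by rewrite rpredB ?rpred1.
exists (z - (pr e0 z - 1) *: o), (pr e0 z - 1); split=> //; last by rewrite subrK.
  by apply: int_pointsB => //; apply: int_pointsZ.
apply/(aff_hull_height _ A1); split; first by apply: rpredB => //; apply: rpredZ; apply: mem_vspan.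
by rewrite prB prZ (A1 _ Ao) mulr1 subKr.
Qed.

Lemma face_vertex n (P F L : set 'rV[R]_n) : lattice_polytope L P -> face P F -> F !=set0 ->
  exists2 o, F o & L o.
Proof.
move=> [Pp PL] PF [x]; have [s FE sv] := polytope_vertices (face_polytope Pp PF).
rewrite {1}FE => /conv_hull_aff/aff_hull_neq0 [v vs]; exists v; first exact: (face_sub (sv v vs)).
by apply: PL; apply: face_trans PF (sv v vs).
Qed.

Lemma facet_dim n (P F : set 'rV[R]_n) d : facet P F -> has_dim P d ->
  exists2 e, d = e.+1 & has_dim F e.
Proof.
move=> [PF [k [Fk Pk]]] Pd; have [x Fx] := has_dim_nonempty Fk; have Px := face_sub PF Fx.
exists k => //; move: Pk Pd => /(has_dimP _ Px) h1 /(has_dimP _ Px) h2.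
by rewrite -h2 h1.
Qed.

(** Among the faces containing [p], one contained in the fewest faces is maximal. *)
Lemma face_in_facet (X : complex R) p : polytopal_complex X -> faces X p ->
  exists2 q, complex_facet q & p `<=` q.
Proof.
move=> [/finite_seqP [s sE] _ _ _] Xp.
pose f (q : set (points X)) := count (fun q' => `[< q `<=` q' >]) s.
pose Q m := `[< exists q, [/\ faces X q, p `<=` q & f q = m] >].
have Q0 : exists m, Q m by exists (f p); apply/asboolP; exists p; split=> // x.
case: (ex_minnP Q0) => m /asboolP [q [Xq pq fq]] qmin.
exists q => //; split=> // q' Xq' qq'; apply: contrapT => ne.
have : (f q' < f q)%N.
  have qs : q \in s by rewrite sE in Xq.
  rewrite /f !(seq.permP (perm_to_rem qs)) /=.
  have /asboolF -> : ~ (q' `<=` q) by move=> q'q; apply: ne; apply/seteqP.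
  rewrite asboolT // add0n add1n ltnS; apply: sub_count => r /asboolP q'r.
  by apply/asboolP; apply: subset_trans q'r.
suff : (f q <= f q')%N by rewrite leqNgt => /negPf ->.
rewrite fq; apply: qmin; apply/asboolP; exists q'; split=> //.
exact: subset_trans qq'.
Qed.

Variables (X : complex R) (d n : nat) (P : 'I_n -> set (points X)).
Notation poly i := (polytope_of (P i)).
Notation chart i := (chart_of (P i)).
Notation lat i := (lattice_of (P i)).
Hypotheses (XL : lattice_complex X) (Pinj : injective P) (Pf : forall i, complex_facet (P i)).
Hypothesis Pd : forall i, has_dim (poly i) d.
Hypothesis stack : forall i : 'I_n, (0 < i)%N -> exists2 F, facet (poly i) F &
  P i `&` \bigcup_(j in [set j : 'I_n | (j < i)%N]) P j = chart i @` F.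
Hypothesis ub : unbranched X.
Variables (c : forall i, 'rV[R]_(cell_dim (cell_of X (P i))) -> 'rV[R]_d.+1)
  (M : forall i, 'M[R]_(d.+1, cell_dim (cell_of X (P i)))).
Arguments c : clear implicits.
Hypothesis fr : forall i, frame (poly i) (lat i) (c i) (M i).

Let ok i : cell_ok (cell_of X (P i)) (P i).
Proof. by apply: lattice_complex_cell => //; case: (Pf i). Qed.

Let P0 i : poly i !=set0. Proof. exact: has_dim_nonempty (Pd i). Qed.

Let Pv i : lattice_polytope (lat i) (poly i). Proof. by case: (ok i). Qed.

Let conv i : is_conv (poly i). Proof. by case: (ok i) => /polytope_conv. Qed.

Lemma chart_in i x : poly i x -> P i (chart i x).
Proof. by case: (ok i) => _ [h _ _] _ _ _; apply: h. Qed.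

Lemma chart_inj i x y : poly i x -> poly i y -> chart i x = chart i y -> x = y.
Proof. by case: (ok i) => _ [_ h _] _ _ _ Px Py; apply: h; rewrite inE. Qed.

Lemma chart_surj i p : P i p -> exists2 x, poly i x & chart i x = p.
Proof. by case: (ok i) => _ [_ _ h] _ _ _ /h [x]; exists x. Qed.

(** Stackedness speaks of the union of the earlier facets, gluing of a single neighbour. The
    barycentre of [F] lies in some earlier [P j], and [P i] meets [P j] in a face inside [F] through
    that point, hence in all of [F]. *)
Lemma wall (i : 'I_n) : (0 < i)%N -> exists F (j : 'I_n) G g,
  [/\ facet (poly i) F /\ facet (poly j) G, (j < i)%N, transition (P i) (P j) F G g &
    P i `&` \bigcup_(j in [set j : 'I_n | (j < i)%N]) P j = chart i @` F].
Proof.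
move=> i0; have [F fF FE] := stack i0; have PF := facet_face fF.
have [e de Fd] := facet_dim fF (Pd i).
have [[_ _ _ inter] _ _] := XL.
have [s FsE] := face_polytope (let: And5 h _ _ _ _ := ok i in h) PF.
have [x0 Fx0] := has_dim_nonempty Fd.
have [|b bF bmax] := @barycentre _ _ s.
  case: s FsE => // FsE; by move: Fx0; rewrite FsE => /conv_hull_aff/aff_hull_neq0 [].
rewrite -FsE in bF bmax.
have : (chart i @` F) (chart i b) by exists b.
rewrite -FE => -[_ [j /= ji Pjb]].
have [F' [G [g tr]]] := inter _ _ (Pf i).1 (Pf j).1.
have [[fF' fG] pF' pG [ga gb] gch] := tr.
have F'F : F' `<=` F.
  move=> x F'x; have Px := face_sub fF' F'x.
  have : (chart i @` F) (chart i x).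
    rewrite -FE; split; first exact: chart_in.
    exists j => //; have : (chart i @` F') (chart i x) by exists x.
    by rewrite -pF' => -[].
  by move=> [y Fy] /(chart_inj (face_sub PF Fy) Px) <-.
have F'E : F' = F.
  apply: bmax; first exact: face_restrict (face_sub PF) fF' F'F.
  have : (P i `&` P j) (chart i b) by split=> //; apply/chart_in/(face_sub PF).
  by rewrite pF' => -[y F'y] /(chart_inj (face_sub fF' F'y) (face_sub PF bF)) <-.
rewrite F'E in tr fF' ga gb gch.
exists F, j, G, g; split=> //; split=> //; split=> //; exists e; split; last by rewrite -de.
have [gf gi gs] := gb.
have [r ra rg] := affine_linv ga (face_conv (@conv i) PF) gi.
have -> : G = g @` F by apply/seteqP; split=> [y /gs//|_ [x Fx <-]]; apply: gf.
by apply/(has_dim_affine _ ga ra) => // x Fx; apply/rg/aff_hull_sub.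
Qed.

Section Wall.
Variables (i j : 'I_n) (F : set 'rV[R]_(cell_dim (cell_of X (P i))))
  (G : set 'rV[R]_(cell_dim (cell_of X (P j)))).
Variable g : 'rV[R]_(cell_dim (cell_of X (P i))) -> 'rV[R]_(cell_dim (cell_of X (P j))).
Hypothesis tr : transition (P i) (P j) F G g.

Let Faff : aff_hull F `<=` aff_hull (poly i).
Proof. by apply: aff_hull_mono; case: tr => -[/face_sub]. Qed.

Let Gaff : aff_hull G `<=` aff_hull (poly j).
Proof. by apply: aff_hull_mono; case: tr => -[_ /face_sub]. Qed.

Lemma wall_image : g @` F = G.
Proof.
case: tr => _ _ _ [_ [gf _ gs]] _.
by apply/seteqP; split=> [_ [x Fx <-]|y /gs//]; apply: gf.
Qed.

Lemma wall_aff x : aff_hull F x -> aff_hull G (g x).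
Proof.
by move=> Fx; case: tr => _ _ _ [ga _] _; rewrite -wall_image -aff_hull_image //; exists x.
Qed.

(** The change of frames along the wall is affine; at height 1 its constant term [b] is the linear
    term [e0 *m b]. *)
Lemma wall_matrix : exists T, forall x, aff_hull F x -> c j (g x) *m T = c i x.
Proof.
have [[fF fG] _ _ [ga [gf gi gs]] _] := tr.
have [r ra rg] := affine_linv ga (face_conv (@conv i) fF) gi.
have [f [b fE]] := affine_comp (frame_affine (fr i)) (affine_comp ra (affine_mulmx (M j))).
exists (lin1_mx f + e0 *m b) => x Fx; have Gx := Gaff (wall_aff Fx).
rewrite mulmxDr mul_rV_lin1 mulmxA [_ *m e0]mx11_scalar mul_scalar_mx.
rewrite -/(pr e0 _) (frame_height (fr j)) // scale1r -fE /=.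
by rewrite (frameK (fr j)) // rg.
Qed.

Lemma wall_lattice x : aff_hull F x -> int_points _ (c i x) -> int_points _ (c j (g x)).
Proof.
move=> Fx xi; apply: (frame_int (fr j)); have [_ _ H] := XL.
have E := H _ _ _ _ _ (Pf i).1 (Pf j).1 tr.
have : (g @` (lat i `&` aff_hull F)) (g x).
  exists x => //; split=> //; rewrite -[x](frameK (fr i) (Faff Fx)).
  by apply: (frame_lat (fr i)) => //; apply: (frame_height (fr i)); apply: Faff.
by rewrite E => -[].
Qed.

Lemma wall_lattice_inv y : aff_hull G y -> int_points _ (c j y) ->
  exists x, [/\ aff_hull F x, int_points _ (c i x) & g x = y].
Proof.
move=> Gy yi; have [_ _ H] := XL.
have E := H _ _ _ _ _ (Pf i).1 (Pf j).1 tr; have : (lat j `&` aff_hull G) y.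
  split=> //; rewrite -[y](frameK (fr j) (Gaff Gy)).
  by apply: (frame_lat (fr j)) => //; apply: (frame_height (fr j)); apply: Gaff.
rewrite -E => -[x [Lx Fx] <-].
by exists x; split=> //; apply: (frame_int (fr i)).
Qed.

End Wall.

Local Notation D i := (cone_over (c i @` poly i)).

Definition stack_cone (k : nat) (B : 'I_n -> 'M[R]_d.+1) : set 'rV[R]_d.+1 :=
  [set y | exists2 j : 'I_n, (j < k)%N & imx (D j) (B j) y].

Definition free_face (k : nat) (p : set (points X)) : Prop :=
  exists (i : 'I_n) E, [/\ (i < k)%N, facet (poly i) E, p = chart i @` E &
    forall j : 'I_n, (j < k)%N -> j != i -> ~ p `<=` P j].

(** The functional [B' j *m e0] is the height over the [j]-th polytope moved to its place. The
    clause on equal positions states at once that the placed cells are glued as in [X] and that they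
    do not overlap otherwise. The functional of a free face vanishes exactly on that face, so it can
    serve as the next wall. *)
Definition stack_realization (k : nat) (B B' : 'I_n -> 'M[R]_d.+1) : Prop :=
  [/\ forall j, lattice_inverse (B j) (B' j), cone (stack_cone k B),
    forall f, bottom_functional (stack_cone k B) f <->
      exists2 j : 'I_n, (j < k)%N & f = B' j *m e0,
    forall j : 'I_n, (j < k)%N ->
      tight (stack_cone k B) (B' j *m e0) = imx (tight (D j) e0) (B j) &
    (forall (i j : 'I_n) x y, (i < k)%N -> (j < k)%N -> poly i x -> poly j y ->
      c i x *m B i = c j y *m B j <-> chart i x = chart j y) /\
    (forall p, free_face k p -> exists l, forall (j : 'I_n) x, (j < k)%N -> poly j x ->
      0 <= pr l (c j x *m B j) /\ (pr l (c j x *m B j) = 0 <-> p (chart j x)))].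

Lemma stack_coneP k B y : stack_cone k B y <->
  exists (j : 'I_n) a x, [/\ (j < k)%N, 0 <= a, poly j x & y = a *: (c j x *m B j)].
Proof.
split=> [[j jk [_ /frame_coneP [a [x [a0 Px ->]]] <-]]|[j [a [x [jk a0 Px ->]]]]].
  by exists j, a, x; rewrite scalemxAl.
exists j => //; exists (a *: c j x); last by rewrite -scalemxAl.
by apply/frame_coneP; exists a, x.
Qed.

Lemma stack_base (i : 'I_n) : i = 0%N :> nat ->
  stack_realization 1 (fun=> 1%:M) (fun=> 1%:M).
Proof.
move=> i0; have only (j : 'I_n) : (j < 1)%N -> j = i.
  by rewrite ltnS leqn0 => /eqP j0; apply: val_inj; rewrite /= j0 i0.
have imx1 A : imx A (1%:M : 'M[R]_d.+1) = A.
  by apply/seteqP; split=> [_ [x Ax <-]|x Ax]; [rewrite mulmx1|exists x; rewrite ?mulmx1].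
have int1 : intmx (1%:M : 'M[R]_d.+1).
  by move=> k l; rewrite mxE; case: eqP; rewrite ?rpred0 ?rpred1.
have CE : stack_cone 1 (fun=> 1%:M) = D i.
  apply/seteqP; split=> y; first by move=> [j /only ->]; rewrite imx1.
  by move=> Dy; exists i; rewrite ?i0 // imx1.
split; rewrite ?CE.
- by move=> _; split; rewrite ?mulmx1.
- exact: frame_cone (fr i) (Pv i) (P0 i).
- move=> f; rewrite (frame_bottom_unique (fr i) (Pv i) (P0 i)) mul1mx.
  by split=> [->|[]//]; exists i; rewrite ?i0.
- by move=> j /only ->; rewrite mul1mx imx1.
split.
  move=> k l x y k1 l1; have ki := only k k1; have li := only l l1; subst k l.
  rewrite !mulmx1 => Px Py; split=> [cxy|/(chart_inj Px Py) -> //].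
  by rewrite -(frame_poly (fr i) Px).1 cxy (frame_poly (fr i) Py).1.
move=> _ [k [E [k1 fE -> _]]]; have ki := only k k1; subst k.
have [l lP] := frame_face (fr i) (facet_face fE); exists l => k x k1' Px.
have ki := only k k1'; subst k; rewrite mulmx1; have [l0 lE] := lP x Px; split=> //.
rewrite lE; split=> [Ex|[y Ey]]; first by exists x.
by move=> /(chart_inj (face_sub (facet_face fE) Ey) Px) <-.
Qed.

Lemma stack_step (i : 'I_n) B B' : (0 < i)%N -> stack_realization i B B' ->
  exists B1 B1', stack_realization i.+1 B1 B1'.
Proof.
move=> i0 [BB Cc bf tC [meet free]].
have [F [j [G [g [[fF fG] ji tr FE]]]]] := wall i0.
have [[PF PG] pF pG [ga [gf gi gs]] gch] := tr.
have FP := face_sub PF; have GP := face_sub PG.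
set C1 := stack_cone i B in Cc bf tC.
have neq (l : 'I_n) : (l < i)%N -> l != i by move=> li; rewrite -val_eqE ltn_eqF.
pose p0 := chart j @` G; have p0E : p0 = chart i @` F by rewrite /p0 -pF pG.
have p0i : p0 `<=` P i by rewrite p0E -pF => x [].
have p0j : p0 `<=` P j by rewrite /p0 -pG => x [].
(* Unbranchedness applied to the new facet [P i], its neighbour [P j] and a third candidate; hence
   the wall is a free face of the part already built. *)
have only (l : 'I_n) : (l < i)%N -> p0 `<=` P l -> l = j.
  move=> li p0l; rewrite p0E in p0j p0l.
  case: (ub (Pf i) (Pf j) (Pf l) fF p0j p0l) => /Pinj e //.
    by have := neq _ ji; rewrite -e eqxx.
  by have := neq _ li; rewrite -e eqxx.
have p0free : free_face i p0.
  by exists j, G; split=> // l li lj p0l; move: lj; rewrite (only l) // eqxx.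
have [t1 t1P] := free p0 p0free.
have [t2 t2P] := frame_face (fr i) PF.
have C2c := frame_cone (fr i) (Pv i) (P0 i).
have p0G (l : 'I_n) x : (l < i)%N -> poly l x -> p0 (chart l x) ->
    exists2 y, G y & c l x *m B l = c j y *m B j.
  by move=> li Px [y Gy yx]; exists y => //; apply/meet => //; apply: GP.
have tC1 y : C1 y -> 0 <= pr t1 y.
  move=> /stack_coneP [l [a [x [li a0 Px ->]]]]; rewrite prZ mulr_ge0 //.
  by have [] := t1P l x li Px.
have tC2 y : D i y -> 0 <= pr t2 y.
  move=> /frame_coneP [a [x [a0 Px ->]]]; rewrite prZ mulr_ge0 //.
  by have [] := t2P x Px.
have F1E : C1 `&` [set x | pr t1 x = 0] = imx (cone_over (c j @` G)) (B j).
  have [x1 Gx1] : G !=set0 by case: fG => _ [k [/has_dim_nonempty]].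
  apply/seteqP; split=> y.
    move=> [/stack_coneP [l [a [x [li a0 Px ->]]]] /eqP]; rewrite prZ mulf_eq0 => /orP [/eqP ->|/eqP tx].
      exists 0; last by rewrite mul0mx scale0r.
      by exists 0, (c j x1); rewrite scale0r; split=> //; exists x1.
    have [z Gz ->] := p0G l x li Px ((t1P l x li Px).2.1 tx).
    exists (a *: c j z); last by rewrite -scalemxAl.
    by exists a, (c j z); split=> //; exists z.
  move=> [_ [a [_ [a0 [x Gx <-] ->]]] <-]; split.
    by apply/stack_coneP; exists j, a, x; rewrite scalemxAl; split=> //; apply: GP.
  by rewrite /= -scalemxAl prZ (t1P j x ji (GP _ Gx)).2.2 ?mulr0 //; exists x.
have F2E : D i `&` [set x | pr t2 x = 0] = cone_over (c i @` F).
  have [x1 Fx1] : F !=set0 by case: fF => _ [k [/has_dim_nonempty]].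
  apply/seteqP; split=> y.
    move=> [/frame_coneP [a [x [a0 Px ->]]] /eqP]; rewrite prZ mulf_eq0 => /orP [/eqP ->|/eqP tx].
      by exists 0, (c i x1); rewrite !scale0r; split=> //; exists x1.
    by exists a, (c i x); split=> //; exists x => //; apply/(t2P x Px).2.
  move=> [a [_ [a0 [x Fx <-] ->]]]; split.
    by apply/frame_coneP; exists a, x; split=> //; apply: FP.
  by rewrite /= prZ (t2P x (FP _ Fx)).2.2 ?mulr0.
have [e de Fe] := facet_dim fF (Pd i); have [e' de' Ge] := facet_dim fG (Pd j).
have ee : e' = e by apply: succn_inj; rewrite -de -de'.
rewrite ee in Ge.
have height l (A : set 'rV[R]_(cell_dim (cell_of X (P l)))) : A `<=` poly l ->
    forall y, (c l @` A) y -> pr e0 y = 1.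
  by move=> AP _ [x /AP Px <-]; exact: (frame_poly (fr l) Px).2.
have dimA l (A : set 'rV[R]_(cell_dim (cell_of X (P l)))) : A `<=` poly l -> has_dim A e ->
    \dim (vspan (c l @` A)) = d.
  move=> AP Ae; apply: etrans (esym de); apply/(has_dim_height _ (height l A AP)).
  apply/(has_dim_affine _ (frame_affine (fr l)) (affine_mulmx (M l))) => // x /AP Px.
  exact: (frame_poly (fr l) Px).1.
have Fd1 : \dim (vspan (C1 `&` [set x | pr t1 x = 0])) = d.
  by rewrite F1E (vspan_imx _ (BB j)) vspan_cone_over; apply: dimA.
have Fd2 : \dim (vspan (D i `&` [set x | pr t2 x = 0])) = d.
  by rewrite F2E vspan_cone_over; apply: dimA.
have proper l (E : set 'rV[R]_(cell_dim (cell_of X (P l)))) : has_dim E e ->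
    exists2 x, poly l x & ~ E x.
  move=> Ee; apply: contrapT => H; have PE : poly l `<=` E.
    by move=> x Px; apply: contrapT => nE; apply: H; exists x.
  have [x Px] := P0 l; have Ex := PE _ Px.
  have h1 := (has_dimP _ Px).1 (Pd l); have h2 := (has_dimP _ Ex).1 Ee.
  have := dimvS (vspanS (image_subset (fun y => y - x) PE)).
  by rewrite h1 h2 de ltnn.
have x1 : exists2 x, C1 x & pr t1 x != 0.
  have [x Px nG] := proper j G Ge; exists (c j x *m B j).
    by apply/stack_coneP; exists j, 1, x; rewrite scale1r ler01.
  apply/eqP => /(t1P j x ji Px).2 [y Gy yx]; apply: nG.
  by rewrite -(chart_inj (GP _ Gy) Px yx).
have x2 : exists2 x, D i x & pr t2 x != 0.
  have [x Px nF] := proper i F Fe; exists (c i x); first exact: frame_cone_sub.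
  by apply/eqP => /(t2P x Px).2.
have [T' T'P] := wall_matrix tr; pose T := B' j *m T'.
have TP x : aff_hull F x -> c j (g x) *m B j *m T = c i x.
  by move=> Fx; rewrite /T mulmxA (lattice_mulK (BB j)) T'P.
have TPF x : F x -> c j (g x) *m B j *m T = c i x by move=> Fx; apply: TP; apply: aff_hull_sub.
have gG y : G y -> exists2 x, F x & g x = y by rewrite -(wall_image tr) => -[x Fx <-]; exists x.
have TF : imx (C1 `&` [set x | pr t1 x = 0]) T = D i `&` [set x | pr t2 x = 0].
  rewrite F1E F2E; apply/seteqP; split=> y.
    move=> [_ [_ [a [_ [a0 [z /gG [x Fx <-] <-] ->]]] <-] <-].
    by rewrite -!scalemxAl TPF //; exists a, (c i x); split=> //; exists x.
  move=> [a [_ [a0 [x Fx <-] ->]]]; exists (a *: c j (g x) *m B j).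
    exists (a *: c j (g x)) => //; exists a, (c j (g x)); split=> //.
    by exists (g x) => //; apply: gf.
  by rewrite -!scalemxAl TPF.
have [v0 Fo Lo] : exists2 v, F v & lat i v.
  exact: face_vertex (Pv i) PF (has_dim_nonempty Fe).
have oi := frame_int (fr i) Lo; have goi := wall_lattice tr (aff_hull_sub Fo) oi.
have gimg : (c j @` G) (c j (g v0)) by exists (g v0) => //; apply: gf.
have cimg : (c i @` F) (c i v0) by exists v0.
have [y1 _ ty1] := x1; have [y2 _ ty2] := x2.
have affA l (A : set 'rV[R]_(cell_dim (cell_of X (P l)))) y :
    aff_hull (c l @` A) y -> exists2 x, aff_hull A x & c l x = y.
  by rewrite -aff_hull_image; [move=> [x]; exists x|exact: frame_affine (fr l)].
have Ti z : int_points _ z -> pr t1 z = 0 -> int_points _ (z *m T).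
  move=> zi tz; have zF : z \in vspan (C1 `&` [set x | pr t1 x = 0]).
    by apply: (ker_vspan Fd1 _ ty1) => // x [].
  have zG : z *m B' j \in vspan (c j @` G).
    move: zF; rewrite F1E => /in_vspanP [k [y [a [yF ->]]]].
    rewrite mulmx_suml; apply: memv_suml => l _; rewrite -scalemxAl; apply: memvZ.
    have yl := (mem_imx (BB j) _ _).1 (yF l).
    by rewrite -vspan_cone_over; apply: mem_vspan.
  have zi' := (int_points_lattice (lattice_inverseC (BB j)) z).2 zi.
  have [y [m [yi /affA [w Gw wy] mi zE]]] := height_split (height j G GP) gimg goi zi' zG.
  rewrite -wy in yi zE; have [x [Fx xi gx]] := wall_lattice_inv tr Gw yi.
  rewrite /T mulmxA zE mulmxDl -gx T'P // -scalemxAl T'P; last exact: aff_hull_sub.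
  by apply: int_pointsD => //; apply: int_pointsZ.
have TS y : int_points _ y -> pr t2 y = 0 ->
    exists z, [/\ int_points _ z, pr t1 z = 0 & z *m T = y].
  move=> yi ty; have : y \in vspan (D i `&` [set x | pr t2 x = 0]).
    by apply: (ker_vspan Fd2 _ ty2) => // x [].
  rewrite F2E vspan_cone_over => yF.
  have [z [m [zi /affA [x Fx xz] mi yE]]] := height_split (height i F FP) cimg oi yi yF.
  rewrite -xz in zi yE.
  have gxi := wall_lattice tr Fx zi.
  exists ((c j (g x) + m *: c j (g v0)) *m B j); split.
  - apply/(int_points_lattice (BB j)); apply: int_pointsD => //; exact: int_pointsZ.
  - have tG w : aff_hull G w -> pr t1 (c j w *m B j) = 0.
      move=> Gw; rewrite prMr; apply: (@pr_vspan _ _ (c j @` G)).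
        by move=> _ [v Gv <-]; rewrite -prMr (t1P j v ji (GP _ Gv)).2.2 //; exists v.
      move: Gw => [k [v [a [vG a1 ->]]]]; rewrite affine_comb //; last exact: frame_affine (fr j).
      by apply: memv_suml => l _; apply/memvZ/mem_vspan; exists (v l).
    have h2 : aff_hull G (g v0) by apply: aff_hull_sub; apply: gf.
    by rewrite mulmxDl -scalemxAl prD prZ (tG _ h2) (tG _ (wall_aff tr Fx)) mulr0 addr0.
  - by rewrite !mulmxDl -!scalemxAl TP // TPF // yE.
pose good p l := forall (k : 'I_n) x, (k < i)%N -> poly k x ->
  0 <= pr l (c k x *m B k) /\ (pr l (c k x *m B k) = 0 <-> p (chart k x)).
pose good2 p l := forall x, poly i x ->
  0 <= pr l (c i x) /\ (pr l (c i x) = 0 <-> p (chart i x)).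
(* [S1] holds the old free faces other than the new wall, [S2] the facets of the new cell other than
   the wall. All faces that remain or become free are among them, and [xget] selects one functional
   for each. *)
pose S1 := [set p | [/\ faces X p, free_face i p & ~ p `<=` P i]].
pose S2 := [set p | faces X p /\ exists E, [/\ facet (poly i) E, p = chart i @` E &
  ~ p `<=` P j]].
pose L1 := (fun p => xget 0 [set l | good p l]) @` S1.
pose L2 := (fun p => xget 0 [set l | good2 p l]) @` S2.
have [[Xfin _ Xface _] _ _] := XL.
have L1P lx : L1 lx -> (forall x, C1 x -> 0 <= pr lx x) /\
     exists2 x, C1 x /\ pr t1 x = 0 & pr lx x != 0.
  move=> [p [Xp fp npi] <-]; case: xgetP => [l _ lP|H]; last first.
    by have [l lP] := free p fp; case: (H l).
  split.
    move=> y /stack_coneP [k [a [x [ki a0 Px ->]]]]; rewrite prZ mulr_ge0 //.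
    by have [] := lP k x ki Px.
  (* A functional vanishing on the whole wall would put the wall inside [p]. Then [p] is a facet of
     the same cell [P j], so it equals the wall and lies in [P i]. *)
  apply: contrapT => H; have p0p : p0 `<=` p.
    move=> _ [x Gx <-]; have Px := GP _ Gx; apply/(lP j x ji Px).2.
    have [//|lxn] := eqVneq (pr l (c j x *m B j)) 0; exfalso; apply: H.
    exists (c j x *m B j) => //; split.
      by apply/stack_coneP; exists j, 1, x; rewrite scale1r ler01.
    by apply/(t1P j x ji Px).2; exists x.
  have [k [E [ki fE pE _]]] := fp.
  have pk : p `<=` P k by rewrite pE => _ [x Ex <-]; apply/chart_in/(face_sub (facet_face fE)).
  have kj := only k ki (subset_trans p0p pk); subst k.
  have GE : G `<=` E.
    move=> x Gx; have : p (chart j x) by apply: p0p; exists x.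
    rewrite pE => -[y Ey] /(chart_inj (face_sub (facet_face fE) Ey) (GP _ Gx)) <- //.
  by apply: npi; rewrite pE -(facet_eq fE fG GE).
have L2P lx : L2 lx -> (forall x, D i x -> 0 <= pr lx x) /\
     exists2 x, D i x /\ pr t2 x = 0 & pr lx x != 0.
  move=> [p [Xp [E [fE pE npj]]] <-]; case: xgetP => [l _ lP|H]; last first.
    have [l lP] := frame_face (fr i) (facet_face fE); case: (H l) => x Px.
    have [l0 lE] := lP x Px; split=> //; rewrite lE pE; split=> [Ex|[y Ey]]; first by exists x.
    by move=> /(chart_inj (face_sub (facet_face fE) Ey) Px) <-.
  split.
    move=> y /frame_coneP [a [x [a0 Px ->]]]; rewrite prZ mulr_ge0 //.
    by have [] := lP x Px.
  apply: contrapT => H; have FsE : F `<=` E.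
    move=> x Fx; have Px := FP _ Fx; have : p (chart i x).
      apply/(lP x Px).2; have [//|lxn] := eqVneq (pr l (c i x)) 0; exfalso; apply: H.
      exists (c i x) => //; split; first exact: frame_cone_sub.
      exact/(t2P x Px).2.
    rewrite pE => -[y Ey] /(chart_inj (face_sub (facet_face fE) Ey) Px) <- //.
  by apply: npj; rewrite pE -(facet_eq fE fF FsE) -p0E.
have finS1 : finite_set S1 by apply: sub_finite_set Xfin => p [].
have finS2 : finite_set S2 by apply: sub_finite_set Xfin => p [].
(* Positive because the wall, a nonempty facet, has dimension one less. *)
have d0 : (0 < d)%N by rewrite de.
have [N [N' [[NN Ncone TN disj] [[LN1 LN2] [bN tN1 tN2]]]]] := cone_gluing d0 Cc C2c tC1 tC2 x1 x2
  Fd1 Fd2 TF Ti TS (finite_image _ finS1) (finite_image _ finS2) L1P L2P.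
pose B1 k := if k == i then N else B k; pose B1' k := if k == i then N' else B' k.
have B1i : B1 i = N by rewrite /B1 eqxx.
have B1i' : B1' i = N' by rewrite /B1' eqxx.
have B1k (k : 'I_n) : (k < i)%N -> B1 k = B k by move=> /neq /negPf ki; rewrite /B1 ki.
have B1k' (k : 'I_n) : (k < i)%N -> B1' k = B' k by move=> /neq /negPf ki; rewrite /B1' ki.
have ltS (k : 'I_n) : (k < i.+1)%N -> k = i \/ (k < i)%N.
  by rewrite ltnS leq_eqVlt => /orP [/eqP/val_inj|]; [left|right].
have CE : stack_cone i.+1 B1 = C1 `|` imx (D i) N.
  apply/seteqP; split=> y.
    move=> [k /ltS [->|ki]]; first by rewrite B1i; right.
    by rewrite B1k //; left; exists k.
  move=> [[k ki ky]|iy]; last by exists i; rewrite ?B1i.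
  by exists k; rewrite ?B1k // ltnS ltnW.
have NF x : F x -> c i x *m N = c j (g x) *m B j.
  move=> Fx; have Px := GP _ (gf _ Fx); rewrite -(TPF _ Fx) TN //.
    by apply/stack_coneP; exists j, 1, (g x); rewrite scale1r ler01.
  by apply/(t1P j _ ji Px).2; exists (g x) => //; apply: gf.
have C1in (k : 'I_n) x : (k < i)%N -> poly k x -> C1 (c k x *m B k).
  by move=> ki Px; apply/stack_coneP; exists k, 1, x; rewrite scale1r ler01.
(* All points common to the new cell and earlier ones lie in the wall: here the stacking condition
   on the union is used, not just the one neighbour. *)
have inwall (k : 'I_n) x y : (k < i)%N -> poly k x -> poly i y -> chart k x = chart i y -> F y.
  move=> ki Px Py xy; have : (chart i @` F) (chart i y).
    rewrite -FE; split; first exact: chart_in.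
    by exists k => //; rewrite -xy; apply: chart_in.
  by move=> [z Fz] /(chart_inj (FP _ Fz) Py) <-.
have mixed (k : 'I_n) x y : (k < i)%N -> poly k x -> poly i y ->
    c k x *m B k = c i y *m N <-> chart k x = chart i y.
  move=> ki Px Py; split=> xy.
    have Dy : D i (c i y) by apply: frame_cone_sub.
    have Cy : C1 (c i y *m N) by rewrite -xy; apply: C1in.
    have [ty _] := disj _ Dy Cy; have Fy := (t2P y Py).2.1 ty.
    rewrite NF // in xy; rewrite -(gch _ Fy).
    by apply/(meet k j) => //; apply/GP/gf.
  have Fy := inwall k x y ki Px Py xy; rewrite NF //.
  by apply/(meet k j) => //; [apply/GP/gf|rewrite gch].
exists B1, B1'; split; rewrite ?CE //.
- by move=> k; rewrite /B1 /B1'; case: eqP.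
- move=> f; rewrite bN bf (bottom_functional_imx NN) (frame_bottom_unique (fr i) (Pv i) (P0 i)).
  have [_ _ NN' N'N] := NN; split=> [[[k ki ->]|fE]|[k /ltS [->|ki] ->]].
  + by exists k; rewrite ?B1k' // ltnS ltnW.
  + by exists i; rewrite // B1i' -fE mulmxA N'N mul1mx.
  + by right; rewrite B1i' mulmxA NN' mul1mx.
  + by left; exists k; rewrite ?B1k'.
- have [_ _ NN' N'N] := NN; move=> k /ltS [->|ki].
    rewrite B1i B1i' tN2 ?(tight_imx NN) ?mulmxA ?NN' ?mul1mx //.
    apply/(bottom_functional_imx NN); rewrite mulmxA NN' mul1mx.
    exact: frame_bottom_functional (fr i) (Pv i) (P0 i).
  rewrite B1k // B1k' // tN1; first exact: tC.
  by apply/bf; exists k.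
split.
  move=> k l x y /ltS [ki|ki] /ltS [li|li] Px Py.
  - subst k l; rewrite B1i; split=> [/(congr1 (mulmx^~ N')) /=|/(chart_inj Px Py) -> //].
    rewrite !(lattice_mulK NN) => cxy.
    by rewrite -(frame_poly (fr i) Px).1 cxy (frame_poly (fr i) Py).1.
  - subst k; rewrite B1i (B1k _ li); have := mixed l y x li Py Px => -[h1 h2].
    by split=> /esym; [move/h1|move/h2].
  - by subst l; rewrite B1i (B1k _ ki); apply: mixed.
  - by rewrite (B1k _ ki) (B1k _ li); apply: meet.
move=> p [k [E [/ltS [ki|ki] fE pE np]]].
  subst k.
  have npj : ~ p `<=` P j by apply: np; [rewrite ltnS ltnW|exact: neq].
  have S2p : S2 p by split; [rewrite pE; apply: Xface (facet_face fE); case: (Pf i)|exists E].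
  have L2l : L2 (xget 0 [set l | good2 p l]) by exists p.
  have [l2 _] := L2P _ L2l; have := LN2 _ _ L2l; move: L2l l2.
  case: xgetP => [l _ lP|H]; last first.
    have [l lP] := frame_face (fr i) (facet_face fE); case: (H l) => x Px.
    have [l0 lE] := lP x Px; split=> //; rewrite lE pE; split=> [Ex|[y Ey]]; first by exists x.
    by move=> /(chart_inj (face_sub (facet_face fE) Ey) Px) <-.
  move=> _ _ far; exists (N' *m l).
  have atI x : poly i x -> 0 <= pr (N' *m l) (c i x *m N) /\
      (pr (N' *m l) (c i x *m N) = 0 <-> p (chart i x)).
    by move=> Px; rewrite -prMr (lattice_mulK NN); apply: lP.
  move=> k x /ltS [ki|ki] Px; first by subst k; rewrite B1i; apply: atI.
  (* An old point on the wall is also a point of the new cell, where the functional is known; off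
     the wall the shear has made it positive, and the point is not in [p]. *)
  rewrite B1k //; have [tx|tx] := eqVneq (pr t1 (c k x *m B k)) 0.
    have := (t1P k x ki Px).2.1 tx; rewrite p0E => -[y Fy yx].
    rewrite ((mixed k x y ki Px (FP _ Fy)).2 (esym yx)) -yx.
    exact/atI/FP.
  have pos : 0 < pr (N' *m l) (c k x *m B k) by rewrite -prMr; apply: far => //; apply: C1in.
  split; first exact: ltW.
  split=> [e0'|]; first by rewrite e0' ltxx in pos.
  rewrite pE => -[y Ey yx]; have Py := face_sub (facet_face fE) Ey.
  have Fy := inwall k x y ki Px Py (esym yx).
  case/eqP: tx; apply/(t1P k x ki Px).2; rewrite p0E -yx; by exists y.
have npi : ~ p `<=` P i by apply: np => //; rewrite eq_sym; apply: neq.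
have fp : free_face i p.
  by exists k, E; split=> // l li lk; apply: np => //; rewrite ltnS ltnW.
have S1p : S1 p by split=> //; rewrite pE; apply: Xface (facet_face fE); case: (Pf k).
have L1l : L1 (xget 0 [set l | good p l]) by exists p.
have := LN1 _ _ L1l; move: L1l; case: xgetP => [l _ lP|H]; last first.
  by have [l lP] := free p fp; case: (H l).
move=> _ far; exists l => m x /ltS [mi|mi] Px; last by rewrite B1k //; apply: lP.
(* The same dichotomy with the roles of the new cell and the old cells exchanged. *)
subst m; rewrite B1i; have [tx|tx] := eqVneq (pr t2 (c i x)) 0.
  have Fx := (t2P x Px).2.1 tx; rewrite NF // -gch //; apply: lP => //; exact/GP/gf.
have pos : 0 < pr l (c i x *m N) by apply: far => //; apply: frame_cone_sub.
split; first exact: ltW.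
split=> [e0'|]; first by rewrite e0' ltxx in pos.
rewrite pE => -[y Ey yx]; have Py := face_sub (facet_face fE) Ey.
have Fx := inwall k y x ki Py Px yx.
by case/eqP: tx; apply/(t2P x Px).2.
Qed.

Lemma stack_exists : (0 < n)%N -> exists B B', stack_realization n B B'.
Proof.
move=> n0; suff H k : (k < n)%N -> exists B B', stack_realization k.+1 B B'.
  by have := H n.-1; rewrite prednK // => /(_ (leqnn _)).
elim: k => [|k IH] kn; first by exists (fun=> 1%:M), (fun=> 1%:M); apply: (@stack_base (Ordinal kn)).
have [B [B' BP]] := IH (ltnW kn).
exact: (@stack_step (Ordinal kn) B B' isT BP).
Qed.

Variables (B B' : 'I_n -> 'M[R]_d.+1).
Hypothesis SR : stack_realization n B B'.
Hypothesis Psurj : forall q, complex_facet q -> exists i, P i = q.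
Notation C := (stack_cone n B).

Let BB i : lattice_inverse (B i) (B' i). Proof. by case: SR. Qed.

Let Cc : cone C. Proof. by case: SR. Qed.

Lemma stack_bottom_facet F : bottom_facet C F <->
  exists i, F = imx (c i @` poly i) (B i).
Proof.
have [_ _ bf tC _] := SR.
have hE i : conv_hull (tight C (B' i *m e0)) = imx (c i @` poly i) (B i).
  rewrite tC // /imx -conv_hull_image; last exact: affine_mulmx.
  by rewrite (frame_hull (fr i) (Pv i) (P0 i)).
rewrite (bottom_facetP Cc); split=> [[f /bf [i _ ->] ->]|[i ->]]; first by exists i.
by exists (B' i *m e0); rewrite ?hE //; apply/bf; exists i.
Qed.

(** The choice of a cell containing [p] is harmless, since equal points of [X] have equal positions
    in a [stack_realization]. *)
Definition stack_map (p : points X) : 'rV[R]_d.+1 :=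
  xget 0 [set y | exists i x, [/\ poly i x, chart i x = p & y = c i x *m B i]].

Lemma stack_mapE i x : poly i x -> stack_map (chart i x) = c i x *m B i.
Proof.
have [_ _ _ _ [meet _]] := SR.
move=> Px; rewrite /stack_map; case: xgetP => [y _ [j [z [Pz zx ->]]]|/(_ (c i x *m B i)) []].
  exact/meet.
by exists i, x.
Qed.

Hypothesis n0 : (0 < n)%N.

(** Only facets of [X] have frames. A smaller face is realized through the transition map into a
    facet containing it, and compatibility of the lattices of reference identifies its lattice with
    the induced one. *)
Lemma stack_isom : complex_isom (X := X) (Y := bottom_complex C) stack_map.
Proof.
have [XP _ XLL] := XL; have [Xfin _ Xface inter] := XP.
have [_ _ _ _ [meet _]] := SR.
have carr p : carrier X p -> exists i x, poly i x /\ chart i x = p.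
  move=> [q Xq qp]; have [q' fq' qq'] := face_in_facet XP Xq.
  have [i iE] := Psurj fq'; have [|x Px xp] := @chart_surj i p; first by rewrite iE; apply: qq'.
  by exists i, x.
have faceC i F : face (poly i) F -> faces (bottom_complex C) (imx (c i @` F) (B i)).
  move=> PF; right; exists (imx (c i @` poly i) (B i)); first by apply/stack_bottom_facet; exists i.
  apply/(face_imx (BB i)); exists (c i @` F) => //.
  by apply: face_image (affine_mulmx (M i)) _ PF => x /(frame_poly (fr i)) [].
have okX p : faces X p -> cell_ok (cell_of X p) p by apply: lattice_complex_cell.
have [] // := @realization R _ C X stack_map Cc okX.
- move=> p q /set_mem /carr [i [x [Px <-]]] /set_mem /carr [j [y [Py <-]]].
  by rewrite !stack_mapE // => /meet; apply.
- move=> p Xp; have [q fq pq] := face_in_facet XP Xp; have [i iE] := Psurj fq.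
  rewrite -iE in pq; have [E [F [g tr]]] := inter _ _ Xp (Pf i).1.
  have [[fE fF] pE pF [ga [gf gi gs]] gch] := tr.
  have EE : E = polytope_of p.
    apply/seteqP; split; first exact: face_sub fE.
    move=> x Px; have [_ [cf ci _] _ _ _] := okX p Xp.
    have : (chart_of p @` E) (chart_of p x).
      rewrite -pE; split; first exact: cf.
      by apply: pq; apply: cf.
    move=> [y Ey] /ci <- //; rewrite inE //; exact: (face_sub fE Ey).
  rewrite EE in tr fE gf gi gs gch.
  have gimg : g @` polytope_of p = F.
    by apply/seteqP; split=> [_ [x Px <-]|y /gs//]; apply: gf.
  have FP := face_sub fF.
  pose h x := c i (g x) *m B i.
  have hp (A : set 'rV[R]_(cell_dim (cell_of X p))) : h @` A = imx (c i @` (g @` A)) (B i).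
    by rewrite /imx !image_comp.
  exists (h @` polytope_of p); first by rewrite hp gimg; apply: faceC.
  apply: (realizes_intro (okX p Xp)).
  + exact: (affine_comp (affine_mulmx (B i)) (affine_comp (frame_affine (fr i)) ga)).
  + move=> x y xP yP /(congr1 (mulmx^~ (B' i))) /=; rewrite /h !(lattice_mulK (BB i)) => cxy.
    apply: gi => //; move/set_mem: xP => /gf Fx; move/set_mem: yP => /gf Fy.
    by rewrite -(frame_poly (fr i) (FP _ Fx)).1 cxy (frame_poly (fr i) (FP _ Fy)).1.
  + move=> x Px; rewrite /h -stack_mapE; last exact/FP/gf.
    by congr stack_map; apply: gch.
  + have [_ _ Laff _ _] := okX p Xp.
    have gL : g @` lattice_of p = lat i `&` aff_hull F.
      have E' := XLL _ _ _ _ _ Xp (Pf i).1 tr.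
      by rewrite -E' (setIidl Laff).
    rewrite !hp gL gimg /imx -(aff_hull_image _ (affine_mulmx (B i))) -(aff_hull_image _ (frame_affine (fr i))).
    apply/seteqP; split=> [_ [_ [x [Lx Fx] <-] <-]|y [yi [_ [x Fx <-] xE]]].
      split; last by exists (c i x) => //; exists x.
      by apply/(int_points_lattice (BB i)); apply: (frame_int (fr i)).
    exists (c i x) => //; exists x => //; split=> //.
    have Px := aff_hull_mono FP Fx; rewrite -(frameK (fr i) Px).
    apply: (frame_lat (fr i)); first exact: (frame_height (fr i)).
    by rewrite -xE in yi; apply/(int_points_lattice (BB i)).
- have img i A : A `<=` poly i -> imx (c i @` A) (B i) = stack_map @` (chart i @` A).
    move=> AP; rewrite /imx !image_comp; apply: eq_imagel => x Ax /=.
    by rewrite stack_mapE //; apply: AP.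
  move=> G [->|[F /stack_bottom_facet [i ->] /(face_imx (BB i)) [E fE ->]]].
    pose i := Ordinal n0.
    exists (chart i @` set0); first by apply: Xface (face_set0 _); case: (Pf i).
    by rewrite !image_set0.
  have [fA AE] := face_preimage (frame_affine (fr i)) fE.
  exists (chart i @` (poly i `&` c i @^-1` E)); first by apply: Xface fA; case: (Pf i).
  by rewrite -img ?AE // => x [].
Qed.

Lemma stack_reduced : (forall i, normal_polytope (lat i) (poly i)) ->
  forall F, complex_facet (X := bottom_complex C) F -> Hilb (cone_over F) `<=` F.
Proof.
move=> nP F /complex_facet_bottom [-> x [[[a [y []//]]]]|/stack_bottom_facet [i ->]].
apply: (Hilb_imx (BB i)); exact: frame_normal (fr i) (Pv i) (P0 i) (nP i).
Qed.

End Stack.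

(** * The degenerate case and the realization of stacked complexes *)

Section Stacked.
Context {R : realType}.

Lemma cone_zero : cone (set0 `|` [set 0 : 'rV[R]_0]).
Proof.
have E : set0 `|` [set 0 : 'rV[R]_0] = cone_hull (fun _ : 'I_0 => 0).
  apply/seteqP; split=> y; last by right; apply/matrixP => i [].
  by move=> _; exists (fun=> 0); rewrite big_ord0; split=> //; apply/matrixP => i [].
apply: (cone_intro _ _ E) => [[]//|y _ _]; by apply/matrixP => i [].
Qed.

Lemma empty_complex_isom (X : complex R) (C : set 'rV[R]_0) : cone C ->
  (forall p, faces X p -> p = set0) ->
  lattice_complex X -> complex_isom (X := X) (Y := bottom_complex C) (fun=> 0).
Proof.
move=> Cc X0 XL.
have noC x : ~ carrier (bottom_complex C) x.
  move=> [G fG Gx]; case: (fG) => [G0|[F /(bottom_facetP Cc) [f [[y [/ptsP [_ _ /eqP]]]]]]].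
    by rewrite G0 in Gx.
  by move=> + _ _; case; apply/matrixP => i [].
have noX x : ~ carrier X x by move=> [p /X0 ->].
split; first by split=> [x /noX|x y /set_mem /noX|x /noC].
move=> p Xp; have [_ [cf _ _] Laff _ _] := lattice_complex_cell XL Xp.
have Pp x : ~ polytope_of p x by move=> /cf px; have : carrier X (chart_of p x) by [exists p]; apply: noX.
have aff0 k (A : set 'rV[R]_k) : (forall x, ~ A x) -> forall x, ~ aff_hull A x.
  by move=> nA x /aff_hull_neq0 [y /nA].
have Lp x : ~ lattice_of p x by move=> /Laff; apply: aff0.
have no0 : forall x : 'rV[R]_0, ~ aff_hull set0 x by apply: aff0 => x [].
exists set0; first by left.
exists (fun=> 0); split.
- by exists \0, 0 => x; rewrite addr0.
- by split=> [x /Pp|x y /set_mem /Pp|x].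
- by move=> x /Pp.
- by split=> [x [/Pp]|x y /set_mem [/Pp]|x []].
- by split=> [x /Lp|x y /set_mem /Lp|x [_ /no0]].
Qed.

(** Purity gives all facets one dimension [d], so that all cones lie in the same space. A complex
    without points has no such dimension and is realized by the zero cone in dimension 0. *)
Lemma stacked_realization (X : complex R) :
  lattice_complex X -> stacked X -> pure X -> unbranched X ->
  exists n (C : set 'rV[R]_n) (phi : points X -> 'rV[R]_n), conic_realization C phi /\
    ((forall p : set (points X), complex_facet p ->
       normal_polytope (lattice_of p) (polytope_of p)) -> reduced_conic_realization C phi).
Proof.
move=> XL [n [P [[Pf Pinj Psurj] st]]] pu ub; have [XP _ _] := XL.
case: (pselect (exists2 p, complex_facet (X := X) p & polytope_of p !=set0)) => [[p fp [x px]]|H].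
  have [i0 _ i0p] := Psurj p fp.
  pose d := \dim (vspan [set y - x | y in polytope_of p]).
  have pd : has_dim (polytope_of p) d by apply/(has_dimP _ px).
  have Pf' i : complex_facet (P i) by apply: Pf.
  have Pd i : has_dim (polytope_of (P i)) d by apply: pu fp (Pf' i) pd.
  have Pi : injective P by move=> i j; apply: Pinj; rewrite inE.
  have Ps q : complex_facet q -> exists i, P i = q by move=> /Psurj [i _ <-]; exists i.
  have frX i : exists c M, frame (d := d) (polytope_of (P i)) (lattice_of (P i)) c M.
    have [_ _ Laff La Lv] := lattice_complex_cell XL (Pf' i).1.
    by apply: frame_ex => //; apply: La; apply: has_dim_nonempty (Pd i).
  pose cM i := cid (frX i); pose M i := cid (projT2 (cM i)).
  have fr i := projT2 (M i).
  have n0 : (0 < n)%N by apply: leq_ltn_trans (ltn_ord i0).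
  have [B [B' SR]] := stack_exists XL Pi Pf' Pd st ub fr n0.
  have real : conic_realization (stack_cone (fun i => projT1 (cM i)) n B)
      (stack_map (fun i => projT1 (cM i)) B).
    by split; [case: SR|exact: (stack_isom XL Pf' Pd fr SR Ps n0)].
  exists d.+1, (stack_cone (fun i => projT1 (cM i)) n B), (stack_map (fun i => projT1 (cM i)) B).
  split=> // nX; split=> //; apply: (stack_reduced XL Pf' Pd fr SR) => i; exact: nX.
(* With no nonempty facet, every face is empty because it lies in a facet. *)
have X0 p : faces X p -> p = set0.
  move=> Xp; have [q fq pq] := face_in_facet XP Xp.
  apply/seteqP; split=> // x /pq qx; apply: H; exists q => //.
  have [_ [_ _ cs] _ _ _] := lattice_complex_cell XL fq.1.
  by have [y qy _] := cs x qx; exists y.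
pose phi : points X -> 'rV[R]_0 := fun=> 0.
exists 0%N, (set0 `|` [set 0]), phi; have real : conic_realization (set0 `|` [set 0]) phi.
  by split; [exact: cone_zero|exact: empty_complex_isom cone_zero X0 XL].
split=> // _; split=> // F /complex_facet_bottom [-> x [[[a [y []//]]]]|].
move=> /(bottom_facetP cone_zero) [f [[y [/ptsP [_ _ /eqP]]]]] + _ _; case.
by apply/matrixP => i [].
Qed.

End Stacked.

Unset Implicit Arguments.

Theorem theorem4p2 (R : realType) :
  (forall (d : nat) (X1 X2 : complex R) (C1 C2 : set 'rV[R]_d.+1)
      (phi1 : points X1 -> 'rV[R]_d.+1) (phi2 : points X2 -> 'rV[R]_d.+1)
      (F1 F2 : set 'rV[R]_d.+1) (theta : {linear 'rV[R]_d.+1 -> 'rV[R]_d.+1}),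
    (0 < d)%N ->
    complex_dim X1 d -> complex_dim X2 d ->
    facet C1 F1 -> facet C2 F2 -> lattice_isom F1 F2 theta ->
    (is_bottom X1 -> is_bottom X2 ->
     conic_realization C1 phi1 -> conic_realization C2 phi2 ->
     is_bottom (conic_gluing phi1 phi2 F1 theta)) /\
    (is_reduced_bottom X1 -> is_reduced_bottom X2 ->
     reduced_conic_realization C1 phi1 -> reduced_conic_realization C2 phi2 ->
     is_reduced_bottom (conic_gluing phi1 phi2 F1 theta)))
  /\
  (forall X : complex R,
    lattice_complex X -> stacked X -> pure X -> unbranched X ->
    is_bottom X /\
    (is_reduced_bottom X <->
     forall p : set (points X), complex_facet p ->
       normal_polytope (lattice_of p) (polytope_of p))).
Proof.
split.
  move=> d X1 X2 C1 C2 phi1 phi2 F1 F2 theta d0 Xd1 Xd2 fF1 fF2 th.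
  split=> -[XL1 _] [XL2 _] r1 r2; last first.
    exact: conic_gluing_reduced d0 XL1 XL2 Xd1 Xd2 fF1 fF2 th r1 r2.
  have [C [phi [_ [_ [_ XL rC _]]]]] :=
    conic_gluing_bottom d0 XL1 XL2 Xd1 Xd2 fF1 fF2 th r1 r2.
  by split=> //; exists d.+1, C, phi.
move=> X XL st pu ub.
have [n [C [phi [rC red]]]] := stacked_realization XL st pu ub.
split; first by split=> //; exists n, C, phi.
split=> [[_ [m [C' [phi' rC']]]] p fp|nX]; first exact: reduced_normal XL rC' p fp.
by split=> //; exists n, C, phi; apply: red.
Qed.
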